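(* Let $\Lambda_0=\{\tau\in\mathbb C:|\tau|>40\}$, $f_\tau(z)=\frac{\tau}{2}(z^2-1)+1$ for $\tau\in\Lambda_0$, and let $\Lambda$ be the interior in $l^\infty(\mathbb C)$ (sup-norm topology) of the set of bounded sequences in $\Lambda_0^{\mathbb N}$. Then $f_\lambda$ is uniformly hyperbolic for every $\lambda\in\Lambda$, and the functions $\lambda\mapsto\mathrm{HD}(\mathcal J_\lambda)$ and $\lambda\mapsto\mathrm{PD}(\mathcal J_\lambda)$ on $\Lambda$ are not differentiable at any point $\eta\in\Lambda$ with respect to the $l^\infty$-topology.
   Context: Derivatives of rational maps on the Riemann sphere $\hat{\mathbb C}$ are taken with respect to the spherical metric. For $\lambda=(\lambda_1,\lambda_2,\dots)\in\Lambda_0^{\mathbb N}$ let $\sigma(\lambda)=(\lambda_2,\lambda_3,\dots)$, $f_\lambda:=f_{\lambda_1}$ and $f_\lambda^n:=f_{\lambda_n}\circ\dots\circ f_{\lambda_1}$. The Fatou set is the set of $z\in\hat{\mathbb C}$ near which $(f_\lambda^n)_n$ is a normal family, and the Julia set $\mathcal J_\lambda$ is its complement in $\hat{\mathbb C}$. $\mathrm{HD}$ and $\mathrm{PD}$ denote Hausdorff and packing dimension. Uniformly hyperbolic: $f_\lambda$ is uniformly hyperbolic if the family $\{f_{\lambda_j}:j\ge1\}$ is equicontinuous and there exist $c>0$, $\gamma>1$ such that $|(f_{\sigma^j(\lambda)}^n)'(z)|\ge c\gamma^n$ for all $j\ge0$, $z\in\mathcal J_{\sigma^j(\lambda)}$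 and $n\ge1$. Differentiability of a real-valued function on the open set $\Lambda\subset l^\infty(\mathbb C)$ means Fréchet differentiability, $l^\infty(\mathbb C)$ being regarded as a real Banach space. *)

(* Defs.v *)
From HB Require Import structures.
From mathcomp Require Import all_boot all_order all_algebra.
From mathcomp Require Import all_classical all_reals all_analysis.
From mathcomp Require Import complex.
From mathcomp Require Import ring lra.

Set Implicit Arguments.
Unset Strict Implicit.
Unset Printing Implicit Defensive.
Import Order.TTheory GRing.Theory Num.Theory.
Import numFieldNormedType.Exports.
Local Open Scope classical_set_scope.
Local Open Scope ring_scope.

(* Rcomplex R is the field R[i], regarded as a normed space over R: the norm
   `|z| and the scaling a *: z are real. *)

(* None is the point at infinity; the topology is that of the spherical metric
   below. *)
Definition sphere (R : realType) : Type := option (Rcomplex R).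

HB.instance Definition _ (R : realType) := Choice.on (sphere R).
HB.instance Definition _ (R : realType) := isPointed.Build (sphere R) None.

Section sphere_metric.
Context {R : realType}.
Implicit Types (p q r : sphere R) (u v w : R * R * R).

Definition stereo p : R * R * R :=
  match p with
  | None => (0, 0, 1)
  | Some z =>
      let d := 1 + complex.Re z ^+ 2 + complex.Im z ^+ 2 in
      (2 * complex.Re z / d, 2 * complex.Im z / d,
       (complex.Re z ^+ 2 + complex.Im z ^+ 2 - 1) / d)
  end.

Definition dot3 u v : R := u.1.1 * v.1.1 + u.1.2 * v.1.2 + u.2 * v.2.

(* The great-circle distance on the unit sphere: the distance of the Riemannian
   metric 2 |dz| / (1 + |z|^2). *)
Definition sphere_dist p q : R := acos (dot3 (stereo p) (stereo q)).

Lemma dot3C u v : dot3 u v = dot3 v u.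
Proof. by rewrite /dot3; ring. Qed.

Let den_gt0 (a b : R) : 0 < 1 + a ^+ 2 + b ^+ 2.
Proof. by rewrite -addrA ltr_pwDl// addr_ge0// sqr_ge0. Qed.

Lemma dot3_stereo p : dot3 (stereo p) (stereo p) = 1.
Proof.
case: p => [[a b]|]; rewrite /dot3/=; last by ring.
by have := den_gt0 a b => /lt0r_neq0 d0; field.
Qed.

Lemma stereo_inj : injective stereo.
Proof.
have ne (a b : R) : (a ^+ 2 + b ^+ 2 - 1) / (1 + a ^+ 2 + b ^+ 2) != 1.
  rewrite -subr_eq0 (_ : _ - 1 = - 2 / (1 + a ^+ 2 + b ^+ 2)).
    by rewrite mulf_neq0 ?oppr_eq0 ?pnatr_eq0// invr_neq0// lt0r_neq0.
  by have := den_gt0 a b => /lt0r_neq0 d0; field.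
move=> [[a b]|] [[c d]|] //=.
- case=> e1 e2 e3; have /lt0r_neq0 n1 := den_gt0 a b.
  have /lt0r_neq0 n2 := den_gt0 c d.
  have e : 1 + a ^+ 2 + b ^+ 2 = 1 + c ^+ 2 + d ^+ 2.
    apply: invr_inj; move: e3.
    rewrite (_ : _ / _ = 1 - 2 / (1 + a ^+ 2 + b ^+ 2)); last by field.
    rewrite (_ : (c ^+ 2 + _ - _) / _ = 1 - 2 / (1 + c ^+ 2 + d ^+ 2));
      last by field.
    by lra.
  move: e1 e2; rewrite e => /(mulIf (invr_neq0 n2)) e1.
  move=> /(mulIf (invr_neq0 n2)) e2.
  by congr (Some (Complex _ _)); lra.
- by case=> _ _ /eqP; rewrite (negbTE (ne _ _)).
- by case=> _ _ /esym/eqP; rewrite (negbTE (ne _ _)).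
Qed.

Lemma dot3_bound u v : dot3 u u = 1 -> dot3 v v = 1 -> -1 <= dot3 u v <= 1.
Proof.
case: u v => [[a b] c] [[d e] f]; rewrite /dot3/= => u1 v1.
have h1 : 0 <= (a - d) ^+ 2 + (b - e) ^+ 2 + (c - f) ^+ 2
  by rewrite !addr_ge0// sqr_ge0.
have h2 : 0 <= (a + d) ^+ 2 + (b + e) ^+ 2 + (c + f) ^+ 2
  by rewrite !addr_ge0// sqr_ge0.
by apply/andP; split; lra.
Qed.

Lemma dot3_eq1 u v : dot3 u u = 1 -> dot3 v v = 1 -> dot3 u v = 1 -> u = v.
Proof.
case: u v => [[a b] c] [[d e] f]; rewrite /dot3/= => u1 v1 uv.
have h : (a - d) ^+ 2 + (b - e) ^+ 2 + (c - f) ^+ 2 = 0 by lra.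
move: h => /eqP; rewrite !paddr_eq0 ?addr_ge0 ?sqr_ge0// !sqrf_eq0 !subr_eq0.
by move=> /andP[/andP[/eqP-> /eqP->] /eqP->].
Qed.

Lemma dot3_gram u v w : dot3 u u = 1 -> dot3 v v = 1 -> dot3 w w = 1 ->
  (dot3 u w - dot3 u v * dot3 v w) ^+ 2
    <= (1 - dot3 u v ^+ 2) * (1 - dot3 v w ^+ 2).
Proof.
move=> u1 v1 w1; rewrite -subr_ge0.
pose D := u.1.1 * (v.1.2 * w.2 - v.2 * w.1.2)
        - u.1.2 * (v.1.1 * w.2 - v.2 * w.1.1)
        + u.2 * (v.1.1 * w.1.2 - v.1.2 * w.1.1).
suff -> : (1 - dot3 u v ^+ 2) * (1 - dot3 v w ^+ 2)
          - (dot3 u w - dot3 u v * dot3 v w) ^+ 2 = D ^+ 2 by exact: sqr_ge0.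
have -> : D ^+ 2 = dot3 u u * dot3 v v * dot3 w w
    + 2 * dot3 u v * dot3 v w * dot3 u w - dot3 u u * dot3 v w ^+ 2
    - dot3 v v * dot3 u w ^+ 2 - dot3 w w * dot3 u v ^+ 2.
  by rewrite /D /dot3; ring.
by rewrite u1 v1 w1; ring.
Qed.

Lemma acos_dot3_triangle u v w :
    dot3 u u = 1 -> dot3 v v = 1 -> dot3 w w = 1 ->
  acos (dot3 u w) <= acos (dot3 u v) + acos (dot3 v w).
Proof.
move=> u1 v1 w1.
have buv := dot3_bound u1 v1; have bvw := dot3_bound v1 w1.
have buw := dot3_bound u1 w1; have G := dot3_gram u1 v1 w1.
have [ge_pi|lt_pi] := leP pi (acos (dot3 u v) + acos (dot3 v w)).
  by rewrite (le_trans _ ge_pi)// acos_lepi.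
rewrite leNgt; apply/negP => lt_ac.
have := lt_ac; rewrite -ltr_cos ?in_itv/=; first last.
- by rewrite acos_ge0//= acos_lepi.
- by rewrite addr_ge0 ?acos_ge0//= ltW.
rewrite cosD !acosK ?in_itv//= !sin_acos//.
rewrite ltNge => /negP; apply.
rewrite -sqrtrM; last by rewrite subr_ge0; nra.
rewrite lerBlDr -lerBlDl; apply: le_trans (ler_norm _) _.
by rewrite -normrN opprB -sqrtr_sqr ler_wsqrtr.
Qed.

Let sphere_distxx p : sphere_dist p p = 0.
Proof. by rewrite /sphere_dist dot3_stereo acos1. Qed.

Let sphere_dist_eq0 p q : sphere_dist p q = 0 -> p = q.
Proof.
move=> pq; apply/stereo_inj/dot3_eq1; rewrite ?dot3_stereo//.
rewrite -[LHS]acosK ?in_itv/= ?dot3_bound ?dot3_stereo//.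
by rewrite -/(sphere_dist p q) pq cos0.
Qed.

Let sphere_distC p q : sphere_dist p q = sphere_dist q p.
Proof. by rewrite /sphere_dist dot3C. Qed.

Let sphere_dist_triangle q p r :
  sphere_dist p r <= sphere_dist p q + sphere_dist q r.
Proof. by apply: acos_dot3_triangle; rewrite dot3_stereo. Qed.

HB.instance Definition _ := isMetric.Build R (sphere R)
  sphere_distxx sphere_dist_eq0 sphere_distC sphere_dist_triangle.

(* At a point where g is holomorphic, its differential is a similarity for the
   spherical metric, and the norm of the differential is this limit. *)
Definition spherical_deriv (g : sphere R -> sphere R) (p : sphere R) : R :=
  lim (mdist (g q) (g p) / mdist q p @[q --> p^']).

End sphere_metric.

Section dimension.
Context {R : realType} {T : metricType R}.
Implicit Types (A : set T) (s delta : R).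
Local Open Scope ereal_scope.

Definition diameter A : \bar R :=
  ereal_sup [set (mdist p.1 p.2)%:E | p in A `*` A].

(* Index sets I : set nat allow finite and infinite covers, and the requirement
   that the U i be nonempty avoids a convention for (diameter set0) `^ s. *)
Definition delta_cover delta A (I : set nat) (U : nat -> set T) : Prop :=
  A `<=` \bigcup_(i in I) U i /\
  forall i, I i -> U i !=set0 /\ diameter (U i) <= delta%:E.

Definition hausdorff_content s delta A : \bar R :=
  ereal_inf [set v | exists I U, delta_cover delta A I U /\
                       v = \esum_(i in I) (diameter (U i) `^ s)].

Definition hausdorff_measure s A : \bar R :=
  ereal_sup [set hausdorff_content s delta A | delta in [set d | 0 < d]%R].

Definition hausdorff_dim A : \bar R :=
  ereal_inf [set s%:E | s in [set s | (0 <= s)%R /\ hausdorff_measure s A = 0]].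

Definition delta_packing delta A (I : set nat) (x : nat -> T) (r : nat -> R)
    : Prop :=
  (forall i, I i -> A (x i) /\ (0 < r i <= delta)%R) /\
  trivIset I (fun i => [set y | mdist (x i) y <= r i]%R).

Definition packing_content s delta A : \bar R :=
  ereal_sup [set v | exists I x r, delta_packing delta A I x r /\
                       v = \esum_(i in I) ((2 * r i) `^ s)%:E].

Definition packing_premeasure s A : \bar R :=
  ereal_inf [set packing_content s delta A | delta in [set d | 0 < d]%R].

Definition packing_measure s A : \bar R :=
  ereal_inf [set \sum_(0 <= i <oo) packing_premeasure s (B i) |
              B in [set B : nat -> set T | A `<=` \bigcup_i B i]].

Definition packing_dim A : \bar R :=
  ereal_inf [set s%:E | s in [set s | (0 <= s)%R /\ packing_measure s A = 0]].

End dimension.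

Section nonautonomous.
Context {R : realType} {P : Type} (f : P -> sphere R -> sphere R).
Implicit Type l : nat -> P.

(* (lambda_1, lambda_2, ...) is encoded as l with l n = lambda_(n+1). *)
Definition shift_seq (j : nat) l : nat -> P := fun n => l (j + n)%N.

Fixpoint iter_seq l (n : nat) : sphere R -> sphere R :=
  if n is m.+1 then f (l m) \o iter_seq l m else id.

(* u ranges over all sequences in the family {F n}, repetitions allowed; the
   values of the limit g outside U are irrelevant. *)
Definition normal_on (F : nat -> sphere R -> sphere R) (U : set (sphere R))
    : Prop :=
  forall u : nat -> nat, exists (k : nat -> nat) (g : sphere R -> sphere R),
    {homo k : m n / (m < n)%N} /\
    {family compactly_in U, (fun m => F (u (k m))) @ \oo --> g}.

Definition fatou_set l : set (sphere R) :=
  [set z | exists2 U, open_nbhs z U & normal_on (iter_seq l) U].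

Definition julia_set l : set (sphere R) := ~` fatou_set l.

Definition uniformly_hyperbolic l : Prop :=
  equicontinuous [set: nat] (fun j => f (l j)) /\
  exists c gamma : R, [/\ 0 < c, 1 < gamma &
    forall (j : nat) (z : sphere R) (n : nat),
      julia_set (shift_seq j l) z -> (1 <= n)%N ->
      c * gamma ^+ n <= spherical_deriv (iter_seq (shift_seq j l) n) z].

End nonautonomous.

Definition bounded_seq (R : realType) : {pred nat -> Rcomplex R} :=
  fun u => `[< exists M : R, forall n, `|u n| <= M >].

Record linf (R : realType) := Linf {
  linf_val :> nat -> Rcomplex R;
  linf_valP : linf_val \in @bounded_seq R }.

HB.instance Definition _ (R : realType) := [isSub for @linf_val R].
HB.instance Definition _ (R : realType) := [Choice of linf R by <:].

Lemma Rcomplex_normrZ (R : realType) (a : R) (z : Rcomplex R) :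
  `|a *: z| = `|a| * `|z|.
Proof.
case: z => x y; rewrite /Num.norm/= !exprMn -mulrDr.
by rewrite sqrtrM ?sqr_ge0// sqrtr_sqr.
Qed.

Section linf_normed.
Context {R : realType}.
Implicit Types (u v : linf R) (a : R).

Lemma bounded_seq_submod_closed : submod_closed (@bounded_seq R).
Proof.
split=> [|a u v /asboolP[M uM] /asboolP[N vN]]; apply/asboolP.
  by exists 0 => n; rewrite normr0.
exists (`|a| * M + N) => n; apply: le_trans (ler_normD _ _) _.
by rewrite lerD// Rcomplex_normrZ ler_wpM2l.
Qed.

HB.instance Definition _ := GRing.isSubmodClosed.Build R (nat -> Rcomplex R)
  (@bounded_seq R) bounded_seq_submod_closed.
HB.instance Definition _ := [SubChoice_isSubLmodule of linf R by <:].

Definition linf_norm u : R := sup (range (fun n => `|u n|)).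

Lemma linf_norm_ub u n : `|u n| <= linf_norm u.
Proof.
apply: ub_le_sup; last by exists n.
by have /asboolP[M uM] := linf_valP u; exists M => _ [m _ <-].
Qed.

Lemma linf_norm_le u (M : R) : (forall n, `|u n| <= M) -> linf_norm u <= M.
Proof.
move=> uM; apply: ge_sup; first by exists `|u 0%N|, 0%N.
by move=> _ [n _ <-].
Qed.

Let linf_normD u v : linf_norm (u + v) <= linf_norm u + linf_norm v.
Proof.
apply: linf_norm_le => n; apply: le_trans (ler_normD (u n) (v n)) _.
by rewrite lerD// linf_norm_ub.
Qed.

Let linf_normZ a u : linf_norm (a *: u) = `|a| * linf_norm u.
Proof.
have le b v : linf_norm (b *: v) <= `|b| * linf_norm v.
  apply: linf_norm_le => n; rewrite (Rcomplex_normrZ b (v n)).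
  by rewrite ler_wpM2l// linf_norm_ub.
apply/eqP; rewrite eq_le le /=; have [->|a0] := eqVneq a 0.
  rewrite normr0 mul0r (le_trans (normr_ge0 ((0 *: u : linf R) 0%N)))//.
  exact: linf_norm_ub.
rewrite -ler_pdivlMl ?normr_gt0// -normfV.
by have := le a^-1 (a *: u); rewrite scalerA mulVf// scale1r.
Qed.

Let linf_norm0_eq0 u : linf_norm u = 0 -> u = 0.
Proof.
move=> u0; apply/val_inj/funext => n; apply/eqP.
by rewrite -normr_le0 -u0 linf_norm_ub.
Qed.

HB.instance Definition _ := Lmodule_isNormed.Build R (linf R)
  linf_normD linf_normZ linf_norm0_eq0.

End linf_normed.

Section quadratic_family.
Context {R : realType}.

Definition quad (tau : Rcomplex R) (p : sphere R) : sphere R :=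
  if p is Some z then Some (tau / 2 * (z ^+ 2 - 1) + 1) else None.

Definition Lambda0 : set (Rcomplex R) := [set tau | 40 < `|tau|].

Definition Lambda : set (linf R) :=
  [set l : linf R | forall n, Lambda0 (l n)]^°.

(* Both dimensions lie in [0, 2], the dimension of the sphere being 2, so fine
   loses nothing. *)
Definition julia_HD (l : linf R) : R := fine (hausdorff_dim (julia_set quad l)).
Definition julia_PD (l : linf R) : R := fine (packing_dim (julia_set quad l)).

End quadratic_family.

(* Main.v *)
(* As 40 < |tau|, an orbit that stays bounded stays near 1 and -1, and recording
   the signs codes the Julia set by binary sequences.  Let S_n(x) be the logarithm
   of |(f^n)'| at the point coded by x, and Z_n(s) the sum of exp(-s S_n) over the
   words of length n.  Bounded distortion makes Z_n almost multiplicative, hence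
   Bowen's formula: HD is the critical s for "Z_n(s) stays away from 0", PD the
   critical s for "Z_n(s) stays bounded".  So HD and PD behave like the liminf and
   the limsup of a sequence s_n of critical exponents.

   Choose levels n_0 << n_1 << ... along which s_n tends to HD, let h be the
   indicator of the union of the blocks [n_2j, n_(2j+1)), and replace eta by
   (1 + t h) eta.  This moves S_n by a quantity comparable to t times the number of
   k < n in the blocks.  At the levels n_(2j+1), at least half full, s_n drops by
   at least a constant times t when t > 0, and so does HD; at the levels n_(2j+2),
   almost empty, s_n hardly moves, so that HD, which cannot drop when t < 0, is
   constant for t < 0.  The one-sided derivatives at t = 0 are different.  For PD
   the roles of t > 0 and t < 0 are exchanged. *)

Require Import Defs.
From mathcomp Require Import all_boot all_order all_algebra.
From mathcomp Require Import all_classical all_reals all_analysis.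
From mathcomp Require Import complex.
From mathcomp Require Import ring lra zify.

Set Implicit Arguments.
Unset Strict Implicit.
Unset Printing Implicit Defensive.
Import Order.TTheory GRing.Theory Num.Theory.
Import numFieldNormedType.Exports.
Local Open Scope classical_set_scope.
Local Open Scope ring_scope.

(** * Words and codings *)

(** Two parameters are compared through symbols: one symbol sequence codes a point in each Julia
    set, and the dimension estimates are proved for an abstract [coding], so that only inequalities
    between log-derivatives have to be transferred. The obstacle is that a perturbation moves the
    points as well as the multipliers, and the displacement might cancel the gain log (1 + t h).
    Expansion prevents this: for |tau| >= 40 the displacements cost, up to a constant, at most a
    quarter of the lower bound for the gain. Only factors 1 + s h with s >= 0 are analysed. For t <
    0 the perturbed sequence becomes the base point, and eta is recovered from it with s = - t / (1
    + t), the same s at every index because h takes only the values 0 and 1. No measure is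
    constructed on the coding space. The weights of the words of one deep level replace a conformal
    measure, once compactness has made a cover finite; the countable decompositions in the packing
    measure are handled by Baire's theorem. *)

Fixpoint words (n : nat) : seq (seq bool) :=
  if n is m.+1 then map (cons true) (words m) ++ map (cons false) (words m)
  else [:: [::]].

Lemma mem_words n w : (w \in words n) = (size w == n).
Proof.
elim: n w => [|n IH] w /=; first by rewrite inE; case: w.
rewrite mem_cat; case: w => [|[] w] /=.
- by apply/negbTE/negP => /orP[] /mapP[].
- rewrite (mem_map (_ : injective (cons true))) ?IH; last by move=> ? ? [].
  rewrite eqSS; case: eqP => //= _; apply/negP => /mapP[] //.
- rewrite [X in _ || X](mem_map (_ : injective (cons false))) ?IH; last by move=> ? ? [].
  rewrite eqSS orbC; case: eqP => //= _; apply/negP => /mapP[] //.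
Qed.

Lemma uniq_words n : uniq (words n).
Proof.
elim: n => //= n IH; rewrite cat_uniq !map_inj_uniq ?IH//=; do ?by move=> ? ? [].
by rewrite andbT; apply/hasPn => _ /mapP[w _ ->]; apply/negP => /mapP[].
Qed.

Lemma size_words n : size (words n) = (2 ^ n)%N.
Proof. by elim: n => //= n IH; rewrite size_cat !size_map IH expnS mul2n addnn. Qed.

Lemma big_words_cat (V : nmodType) m n (F : seq bool -> V) :
  \sum_(w <- words (m + n)) F w =
  \sum_(u <- words m) \sum_(v <- words n) F (u ++ v).
Proof.
elim: m F => [|m IH] F; first by rewrite big_seq1.
by rewrite addSn /= !big_cat !big_map /= !IH.
Qed.

Definition agree (n : nat) (x y : nat -> bool) := forall k, (k < n)%N -> x k = y k.

Lemma agreeC n x y : agree n x y -> agree n y x.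
Proof. by move=> xy k kn; rewrite xy. Qed.

Lemma first_diff n x y : ~ agree n x y ->
  exists2 m, (m < n)%N & agree m x y /\ x m != y m.
Proof.
move=> /existsNP[k /not_implyP[kn /eqP xyk]].
have ex : exists k, x k != y k by exists k.
case: (ex_minnP ex) => m xym mmin; exists m; first exact: leq_ltn_trans (mmin _ xyk) kn.
split=> // j jm; apply/eqP/negPn/negP => /mmin; by rewrite leqNgt jm.
Qed.

Lemma agree_cat (u v : seq bool) : agree (size u) (nth true (u ++ v)) (nth true u).
Proof. by move=> k ku; rewrite nth_cat ku. Qed.

Lemma agree_mkseq n x : agree n (nth true (mkseq x n)) x.
Proof. by move=> k kn; rewrite nth_mkseq. Qed.

Lemma agree_mkseqE n x (w : seq bool) : size w = n -> agree n (nth true w) x -> w = mkseq x n.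
Proof.
move=> wn wx; apply: (@eq_from_nth _ true); rewrite ?size_mkseq// => i.
by rewrite wn => ilt; rewrite nth_mkseq// wx.
Qed.

(* In the application, [lexp n x] is log |(f^n)'| at the point coded by [x]. *)
Record coding (R : realType) (T : metricType R) := Coding {
  point_of : (nat -> bool) -> T;
  lexp : nat -> (nat -> bool) -> R;
  lexp_lo : R;
  lexp_hi : R;
  distortion : R;
  lexp_lo_gt0 : 0 < lexp_lo;
  distortion_ge0 : 0 <= distortion;
  lexp0 : forall x, lexp 0 x = 0;
  lexpS_lo : forall n x, lexp n x + lexp_lo <= lexp n.+1 x;
  lexpS_hi : forall n x, lexp n.+1 x <= lexp n x + lexp_hi;
  lexp_tail : forall n N x y, (n <= N)%N ->
    (forall k, (n <= k)%N -> x k = y k) ->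
    lexp N x - lexp n x = lexp N y - lexp n y;
  lexp_distortion : forall n x y, agree n x y ->
    lexp n x <= lexp n y + distortion;
  mdist_le : forall n x y, agree n x y ->
    mdist (point_of x) (point_of y) <= expR (distortion - lexp n x);
  mdist_ge : forall n x y, agree n x y -> x n != y n ->
    expR (- distortion - lexp n x) <= mdist (point_of x) (point_of y) }.

Section coding_theory.
Context {R : realType} {T : metricType R} (c : coding T).
Implicit Types (x y : nat -> bool) (u v w : seq bool) (s t : R).

Local Notation p := (point_of c).
Local Notation L := (lexp c).
Local Notation a := (lexp_lo c).
Local Notation b := (lexp_hi c).
Local Notation K := (distortion c).

Let a0 : 0 < a. Proof. exact: lexp_lo_gt0. Qed.

Lemma lexp_hi_gt0 : 0 < b.
Proof.
apply: (lt_le_trans a0); have := lexpS_lo c 0 (fun=> true).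
have := lexpS_hi c 0 (fun=> true); rewrite lexp0; lra.
Qed.

Lemma lexp_ge n x : n%:R * a <= L n x.
Proof.
elim: n => [|n IH]; first by rewrite lexp0 mul0r.
by apply: le_trans (lexpS_lo c n x); rewrite -natr1 mulrDl mul1r lerD2r.
Qed.

Lemma lexp_le n x : L n x <= n%:R * b.
Proof.
elim: n => [|n IH]; first by rewrite lexp0 mul0r.
by apply: le_trans (lexpS_hi c n x) _; rewrite -natr1 mulrDl mul1r lerD2r.
Qed.

Lemma lexp_mono m n x : (m <= n)%N -> L m x <= L n x.
Proof.
elim: n => [|n IH]; first by rewrite leqn0 => /eqP ->.
rewrite leq_eqVlt => /orP[/eqP->//|/IH mn]; apply: le_trans mn _.
by apply: le_trans (lexpS_lo c n x); rewrite lerDl ltW.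
Qed.

(** Each cylinder is represented by its word continued with [true]; by bounded distortion another
    representative changes a term by a bounded factor only. *)
Definition Zsum (s : R) (n : nat) : R :=
  \sum_(w <- words n) expR (- (s * L n (nth true w))).

Lemma Zsum_gt0 s n : 0 < Zsum s n.
Proof.
rewrite /Zsum; case E : (words n) => [|w r].
  by have := size_words n; rewrite E /= => /esym/eqP; rewrite expn_eq0.
by rewrite big_cons ltr_pwDl ?expR_gt0// sumr_ge0// => *; rewrite expR_ge0.
Qed.

Lemma Zsum_decay s t n : s <= t -> Zsum t n <= expR (- ((t - s) * (n%:R * a))) * Zsum s n.
Proof.
move=> st; rewrite /Zsum big_distrr/=; apply: ler_sum => w _.
rewrite -expRD ler_expR.
have := ler_wpM2l (_ : 0 <= t - s) (lexp_ge n (nth true w)).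
rewrite subr_ge0 => /(_ st); lra.
Qed.

Lemma Zsum_decay_hi s t n : s <= t -> expR (- ((t - s) * (n%:R * b))) * Zsum s n <= Zsum t n.
Proof.
move=> st; rewrite /Zsum big_distrr/=; apply: ler_sum => w _.
rewrite -expRD ler_expR.
have := ler_wpM2l (_ : 0 <= t - s) (lexp_le n (nth true w)).
rewrite subr_ge0 => /(_ st); lra.
Qed.

Lemma Zsum_mono s t n : s <= t -> Zsum t n <= Zsum s n.
Proof.
move=> st; apply: le_trans (Zsum_decay n st) _.
rewrite ler_piMl ?(ltW (Zsum_gt0 _ _))// -expR0 ler_expR oppr_le0.
by rewrite mulr_ge0 ?subr_ge0// mulr_ge0// ltW.
Qed.

(** The sum of length [m] for the maps from time [n] on. By [lexp_tail] the prefix is arbitrary, and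
    [nseq n true] is one choice. *)
Definition tail_sum s n m : R :=
  \sum_(v <- words m) let x := nth true (nseq n true ++ v) in
    expR (- (s * (L (n + m) x - L n x))).

Definition sub_sum s m u : R :=
  \sum_(v <- words m) expR (- (s * L (size u + m) (nth true (u ++ v)))).

Lemma lexp_catE n m u v : size u = n -> L (n + m) (nth true (u ++ v)) =
  L n (nth true (u ++ v)) + (let x := nth true (nseq n true ++ v) in L (n + m) x - L n x).
Proof.
move=> un /=; rewrite -(@lexp_tail _ _ c n (n + m) (nth true (u ++ v))) ?leq_addr//.
  by rewrite addrCA subrr addr0.
by move=> k nk; rewrite !nth_cat size_nseq un ltnNge nk.
Qed.

Lemma sub_sum_le s m u : 0 <= s ->
  sub_sum s m u <= expR (s * K) * expR (- (s * L (size u) (nth true u))) * tail_sum s (size u) m.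
Proof.
move=> s0; rewrite /sub_sum big_distrr/=; apply: ler_sum => v _.
rewrite -!expRD ler_expR (lexp_catE _ _ erefl)/=.
have := lexp_distortion c (agreeC (@agree_cat u v)) => /(ler_wpM2l s0); lra.
Qed.

Lemma sub_sum_ge s m u : 0 <= s ->
  expR (- (s * K)) * expR (- (s * L (size u) (nth true u))) * tail_sum s (size u) m <= sub_sum s m u.
Proof.
move=> s0; rewrite /sub_sum big_distrr/=; apply: ler_sum => v _.
rewrite -!expRD ler_expR (lexp_catE _ _ erefl)/=.
have := lexp_distortion c (@agree_cat u v) => /(ler_wpM2l s0); lra.
Qed.

Lemma Zsum_cat s n m : Zsum s (n + m) = \sum_(u <- words n) sub_sum s m u.
Proof.
rewrite /Zsum big_words_cat big_seq [RHS]big_seq; apply: eq_bigr => u.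
by rewrite mem_words /sub_sum => /eqP ->.
Qed.

(** With [Zsum_ge], this is the almost multiplicativity of the sums. The second factor belongs to
    the shifted system, since the maps vary with time. *)
Lemma Zsum_le s n m : 0 <= s -> Zsum s (n + m) <= expR (s * K) * Zsum s n * tail_sum s n m.
Proof.
move=> s0; rewrite Zsum_cat mulrAC [Zsum s n]/Zsum big_distrr/= big_seq [leRHS]big_seq.
by apply: ler_sum => u; rewrite mem_words mulrAC => /eqP <-; exact: sub_sum_le.
Qed.

Lemma Zsum_ge s n m : 0 <= s -> expR (- (s * K)) * Zsum s n * tail_sum s n m <= Zsum s (n + m).
Proof.
move=> s0; rewrite Zsum_cat mulrAC [Zsum s n]/Zsum big_distrr/= big_seq [leRHS]big_seq.
by apply: ler_sum => u; rewrite mem_words mulrAC => /eqP <-; exact: sub_sum_ge.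
Qed.

(* The cylinder of [u] carries a proportion of the level [size u + m] sum that
   is comparable to its share [expR (- s L)] of the level [size u] sum. *)
Lemma sub_sum_upper s m u : 0 <= s ->
  sub_sum s m u * Zsum s (size u) <=
  expR (2 * s * K) * expR (- (s * L (size u) (nth true u))) * Zsum s (size u + m).
Proof.
move=> s0.
apply: le_trans (ler_wpM2r (ltW (Zsum_gt0 s (size u))) (sub_sum_le m u s0)) _.
have := ler_wpM2l (_ : 0 <= expR (2 * s * K) * expR (- (s * L (size u) (nth true u)))) (Zsum_ge (size u) m s0).
rewrite mulr_ge0 ?expR_ge0// => /(_ isT); apply: le_trans.
rewrite (_ : 2 * s * K = s * K + s * K); last by ring.
by rewrite expRD (expRN (s * K)) le_eqVlt; apply/orP/or_introl/eqP; field; rewrite gt_eqF ?expR_gt0.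
Qed.

Lemma sub_sum_lower s m u : 0 <= s ->
  expR (- (s * L (size u) (nth true u))) * Zsum s (size u + m) <=
  expR (2 * s * K) * sub_sum s m u * Zsum s (size u).
Proof.
move=> s0.
apply: le_trans (ler_wpM2l (expR_ge0 _) (Zsum_le (size u) m s0)) _.
have := ler_wpM2l (_ : 0 <= expR (2 * s * K) * Zsum s (size u)) (sub_sum_ge m u s0).
rewrite mulr_ge0 ?expR_ge0 ?(ltW (Zsum_gt0 _ _))// => /(_ isT) h.
rewrite [leRHS]mulrAC; apply: le_trans h.
rewrite (_ : 2 * s * K = s * K + s * K); last by ring.
by rewrite expRD (expRN (s * K)) le_eqVlt; apply/orP/or_introl/eqP; field; rewrite gt_eqF ?expR_gt0.
Qed.

End coding_theory.

(** * Hausdorff dimension of a coded set *)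

Section general_sums.
Context {R : realType}.

Lemma ler_sum_uniq_sub (I : eqType) (r1 r2 : seq I) (F : I -> R) :
  uniq r1 -> {subset r1 <= r2} -> (forall i, 0 <= F i) ->
  \sum_(i <- r1) F i <= \sum_(i <- r2) F i.
Proof.
move=> + + F0; elim: r1 r2 => [|i r1 IH] r2 /=.
  by rewrite big_nil => _ _; rewrite sumr_ge0.
move=> /andP[ir1 ur1] sub.
rewrite (perm_big _ (perm_to_rem (sub i (mem_head _ _)))) !big_cons lerD2l.
apply: IH => // j jr1; have /sub := mem_behead (s := i :: r1) jr1.
rewrite (perm_mem (perm_to_rem (sub i (mem_head _ _)))) inE.
by case: eqP => //= ji; rewrite -ji jr1 in ir1.
Qed.

Lemma sum_halves_le1 (r : seq nat) : uniq r -> \sum_(i <- r) (2^-1 : R) ^+ i.+1 <= 1.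
Proof.
move=> ur; have sub : {subset r <= iota 0 (\max_(i <- r) i).+1}.
  by move=> i ir; rewrite mem_iota add0n ltnS /= leq_bigmax_seq.
apply: le_trans (ler_sum_uniq_sub ur sub _) _; first by move=> i; rewrite exprn_ge0.
have E n : \sum_(i <- iota 0 n) (2^-1 : R) ^+ i.+1 = 1 - 2^-1 ^+ n.
  elim: n => [|n IH]; first by rewrite big_nil expr0 subrr.
  rewrite -addn1 iotaD big_cat/= IH big_seq1 add0n addn1 !exprS; lra.
by rewrite E gerBl exprn_ge0.
Qed.

Lemma expR_small (a B e : R) : 0 < a -> 0 < e ->
  exists N, forall n, (N <= n)%N -> expR (B - n%:R * a) <= e.
Proof.
move=> a0 e0; exists (Num.Def.truncn (Num.max 0 ((B - ln e) / a))).+1 => n Nn.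
rewrite -[leRHS](lnK e0) ler_expR lerBlDr -lerBlDl -ler_pdivrMr//.
apply: (@le_trans _ _ (Num.max 0 ((B - ln e) / a))); first by rewrite le_max lexx orbT.
have := truncnS_gt (Num.max 0 ((B - ln e) / a)) => /ltW/le_trans; apply.
by rewrite ler_nat.
Qed.

Lemma esum_seq (I : Type) (i0 : I) (r : seq I) (g : I -> R) : (forall w, 0 <= g w) ->
  (\esum_(i in `I_(size r)) (g (nth i0 r i))%:E = (\sum_(w <- r) g w)%:E)%E.
Proof.
move=> g0; rewrite esum_fset//; last by move=> i _; rewrite lee_fin.
by rewrite -fsbig_ord sumEFin (big_nth i0) big_mkord.
Qed.

Lemma esum_ge_seq (I : choiceType) (D : set I) (r : seq I) (g : I -> \bar R) :
  uniq r -> (forall i, i \in r -> D i) ->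
  (\sum_(i <- r) g i <= \esum_(i in D) g i)%E.
Proof.
move=> ur rD; apply: esum_ge; exists [set` r]; last by rewrite -fsbig_seq.
by split; [exact: finite_seq|move=> i /= /rD].
Qed.

End general_sums.

Section hausdorff_general.
Context {R : realType} {T : metricType R}.
Implicit Types (A : set T) (s : R).
Local Open Scope ereal_scope.

Lemma diameter_le A (d : R) : (forall q q', A q -> A q' -> (mdist q q' <= d)%R) ->
  diameter A <= d%:E.
Proof. by move=> Ad; apply: ge_ereal_sup => _ [[q q'] [/= Aq Aq'] <-]; rewrite lee_fin Ad. Qed.

Lemma mdist_le_diameter A q q' : A q -> A q' -> (mdist q q')%:E <= diameter A.
Proof. by move=> Aq Aq'; apply: ereal_sup_ubound; exists (q, q'). Qed.

Lemma diameter_ge0 A : A !=set0 -> 0 <= diameter A.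
Proof. by case=> q Aq; have := mdist_le_diameter Aq Aq; rewrite mdistxx. Qed.

Lemma hausdorff_content_ge0 s delta A : 0 <= hausdorff_content s delta A.
Proof.
by apply: le_ereal_inf_tmp => _ [I [U [_ ->]]]; apply: esum_ge0 => i _; exact: poweR_ge0.
Qed.

Lemma hausdorff_measure_ge0 s A : 0 <= hausdorff_measure s A.
Proof.
apply: le_trans (hausdorff_content_ge0 s 1 A) _.
by apply: ereal_sup_ubound; exists 1%R => //=; exact: ltr01.
Qed.

Lemma hausdorff_dim_ge0 A : 0 <= hausdorff_dim A.
Proof. by apply: le_ereal_inf_tmp => _ [s [s0 _] <-]; rewrite lee_fin. Qed.

End hausdorff_general.

Section hausdorff_coding.
Context {R : realType} {T : metricType R} (c : coding T).
Implicit Types (x y : nat -> bool) (u v w : seq bool) (s t : R).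

Local Notation p := (point_of c).
Local Notation L := (lexp c).
Local Notation a := (lexp_lo c).
Local Notation b := (lexp_hi c).
Local Notation K := (distortion c).

Let a0 : 0 < a. Proof. exact: lexp_lo_gt0. Qed.

Definition cylinder w : set T := [set p x | x in agree (size w) (nth true w)].

Lemma cylinder_mdist w q q' : cylinder w q -> cylinder w q' ->
  mdist q q' <= expR (2 * K - L (size w) (nth true w)).
Proof.
move=> [x wx <-] [y wy <-].
have xy : agree (size w) x y by move=> k kw; rewrite -wx// wy.
apply: le_trans (mdist_le c xy) _; rewrite ler_expR.
by have := lexp_distortion c wx; lra.
Qed.

(** Cover by the cylinders of a level [n] with [Zsum c s n <= C]: their diameters to the power [t]
    add up to at most a constant times [Zsum c t n], which is exponentially smaller. *)
Lemma hausdorff_measure_eq0 (C s t : R) : 0 <= s -> s < t ->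
  (forall N, exists2 n, (N <= n)%N & Zsum c s n <= C) ->
  hausdorff_measure t (range p) = 0%E.
Proof.
move=> s0 st ZC; apply/eqP; rewrite eq_le hausdorff_measure_ge0 andbT.
apply: ge_ereal_sup => _ [d /= d0 <-]; apply/lee_addgt0Pr => e e0; rewrite add0e.
have C0 : 0 < C by have [n _ /(lt_le_trans (Zsum_gt0 _ _ _))] := ZC 0.
have ts0 : 0 < t - s by rewrite subr_gt0.
(* [N1] makes the sum over the cover at most [e], [N2] makes the diameters at most [d]. *)
have [N1 N1P] := expR_small (t * (2 * K) + ln C) (mulr_gt0 ts0 a0) e0.
have [N2 N2P] := expR_small (2 * K) a0 d0.
have [n Nn Zn] := ZC (maxn N1 N2).
apply: ge_ereal_inf; eexists.
  exists `I_(size (words n)), (fun i => cylinder (nth [::] (words n) i)); split; last by [].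
  split.
    move=> _ [x _ <-]; have xw : mkseq x n \in words n by rewrite mem_words size_mkseq.
    exists (index (mkseq x n) (words n)) => /=; first by rewrite index_mem.
    by exists x => //; rewrite nth_index// size_mkseq; exact: agree_mkseq.
  move=> i iw; split; first by eexists; exists (nth true (nth [::] (words n) i)).
  apply: diameter_le => q q' Aq Aq'; apply: le_trans (cylinder_mdist Aq Aq') _.
  have /eqP -> : size (nth [::] (words n) i) == n by rewrite -mem_words mem_nth.
  apply: le_trans (N2P n _); last by rewrite (leq_trans _ Nn)// leq_maxr.
  by rewrite ler_expR lerD2l lerN2 lexp_ge.
apply: (@le_trans _ _ (\esum_(i in `I_(size (words n)))
    (expR (t * (2 * K - L n (nth true (nth [::] (words n) i)))))%:E)%E).
  apply: le_esum => i iw; have wi : nth [::] (words n) i \in words n by rewrite mem_nth.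
  move: wi; rewrite mem_words; move: (nth _ _ i) => w /eqP wn.
  have ne : cylinder w !=set0 by eexists; exists (nth true w).
  rewrite mulrC expRM -poweR_EFin; apply: gt0_ler_poweR.
  - by rewrite ltW// (le_lt_trans s0).
  - by rewrite in_itv/= leey andbT; exact: diameter_ge0.
  - by rewrite in_itv/= leey andbT lee_fin expR_ge0.
  - by apply: diameter_le => q q' Aq Aq'; rewrite -wn; exact: cylinder_mdist.
rewrite (@esum_seq _ _ [::] (words n) (fun w => expR (t * (2 * K - L n (nth true w)))))//.
rewrite lee_fin; apply: le_trans (N1P n _); last by rewrite (leq_trans _ Nn)// leq_maxl.
under eq_bigr do rewrite mulrBr expRD.
rewrite -mulr_sumr -/(Zsum c t n).
apply: le_trans (ler_wpM2l (expR_ge0 _) (Zsum_decay c n (ltW st))) _.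
apply: le_trans (ler_wpM2l (expR_ge0 _) (ler_wpM2l (expR_ge0 _) Zn)) _.
rewrite -[X in _ * (_ * X)](lnK C0) -!expRD ler_expR; lra.
Qed.

Lemma hausdorff_dim_le (C s : R) : 0 <= s ->
  (forall N, exists2 n, (N <= n)%N & Zsum c s n <= C) ->
  (hausdorff_dim (range p) <= s%:E)%E.
Proof.
move=> s0 ZC; apply/lee_addgt0Pr => e e0.
apply: ereal_inf_lbound; exists (s + e) => //=; split; first by rewrite addr_ge0// ltW.
by apply: hausdorff_measure_eq0 ZC => //; rewrite ltrDl.
Qed.

(** Compactness in the manner of König: a word whose cylinder has no finite subcover has a
    one-letter extension of the same kind. This yields an infinite branch [x], but a deep cylinder
    around [x] lies in a single [V i]. *)
Lemma coding_finite_subcover (I : set nat) (V : nat -> set T) :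
  (forall x, exists2 i, I i & exists2 e, 0 < e & forall q, mdist (p x) q < e -> V i q) ->
  exists2 F : seq nat, (forall i, i \in F -> I i) &
    forall x, exists2 i, i \in F & V i (p x).
Proof.
move=> IV.
pose good w := exists2 F : seq nat, (forall i, i \in F -> I i) &
  forall x, agree (size w) (nth true w) x -> exists2 i, i \in F & V i (p x).
suff [F FI FV] : good [::] by exists F => // x; exact: FV.
apply: contrapT => bad0.
have step w : exists b, ~ good w -> ~ good (rcons w b).
  case: (pselect (good (rcons w true))) => [[F FI FV]|]; last by exists true.
  exists false => bw [G GI GV]; apply: bw; exists (F ++ G).
    by move=> i; rewrite mem_cat => /orP[/FI|/GI].
  move=> x wx; have [xw|xw] := boolP (x (size w)).
    have [|i iF Vi] := FV x; last by exists i; rewrite ?mem_cat ?iF.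
    move=> k; rewrite size_rcons ltnS leq_eqVlt => /orP[/eqP ->|kw].
      by rewrite nth_rcons ltnn eqxx xw.
    by rewrite nth_rcons kw wx.
  have [|i iG Vi] := GV x; last by exists i; rewrite ?mem_cat ?iG ?orbT.
  move=> k; rewrite size_rcons ltnS leq_eqVlt => /orP[/eqP ->|kw].
    by rewrite nth_rcons ltnn eqxx (negbTE xw).
  by rewrite nth_rcons kw wx.
have [next nextP] := choice step.
pose ws := fix ws n := if n is m.+1 then rcons (ws m) (next (ws m)) else [::].
have badws n : ~ good (ws n) by elim: n => //= n /nextP.
pose x n := next (ws n).
have wsE n : ws n = mkseq x n.
  by elim: n => //= n IH; rewrite {1}IH /mkseq -addn1 iotaD map_cat cats1.
have [i Ii [e e0 Ve]] := IV x.
have e20 : 0 < e / 2 by rewrite divr_gt0.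
have [N /(_ N (leqnn _)) NP] := expR_small K a0 e20.
apply: (badws N); exists [:: i]; first by move=> j; rewrite inE => /eqP ->.
rewrite wsE size_mkseq => y xy; exists i; rewrite ?mem_head//; apply: Ve.
have xy' : agree N x y by move=> k kN; rewrite -xy// nth_mkseq.
apply: le_lt_trans (mdist_le c xy') _; apply: (@le_lt_trans _ _ (e / 2)); last by rewrite gtr_pMr// invf_lt1// ltr1n.
by apply: le_trans NP; rewrite ler_expR lerD2l lerN2 lexp_ge.
Qed.

(* Mass distribution principle: at deep levels, the normalised weights of the
   words give to a set of diameter [d] a mass at most a constant times [d ^ s]. *)
Lemma mass_le (C s d : R) (V : set T) : 0 < C -> 0 <= s -> (forall n, C <= Zsum c s n) ->
  0 < d -> (forall q q', V q -> V q' -> mdist q q' <= d) ->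
  exists N0, forall N, (N0 <= N)%N ->
    \sum_(w <- words N | `[<V (p (nth true w))>]) expR (- (s * L N (nth true w)))
    <= expR (4 * s * K) / C * d `^ s * Zsum c s N.
Proof.
move=> C0 s0 ZC d0 Vd.
(* If [L m x < B], then points that part at level [m] are more than [d] apart, so two points of [V]
   cannot part there. *)
pose B : R := - ln d - K.
have [N0 N0P] : exists N0 : nat, B <= N0%:R * a.
  exists (Num.Def.truncn (Num.max 0 (B / a))).+1; rewrite -ler_pdivrMr//.
  apply: (@le_trans _ _ (Num.max 0 (B / a))); first by rewrite le_max lexx orbT.
  by rewrite ltW// truncnS_gt.
exists N0 => N NN.
have [[x Vx]|noV] := pselect (exists x, V (p x)); last first.
  rewrite big_pred0; last by move=> w; apply/asboolPn => Vw; apply: noV; eexists; exact: Vw.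
  by rewrite mulr_ge0 ?(ltW (Zsum_gt0 _ _ _))// mulr_ge0 ?powR_ge0// divr_ge0 ?expR_ge0// ltW.
have exB : exists n, B <= L n x by exists N0; apply: le_trans N0P (lexp_ge c _ _).
(* Minimality of [n] puts all coded points of [V] in one cylinder of level [n], and [B <= L n x]
   bounds its weight by a constant times [d ^ s]. *)
case: (ex_minnP exB) => n Bn nmin.
have nN : (n <= N)%N by apply: leq_trans NN; apply: nmin; apply: le_trans N0P (lexp_ge c _ _).
have Vagree y : V (p y) -> agree n x y.
  move=> Vy; apply: contrapT => /first_diff[m mn [xym xyNm]].
  have := Vd _ _ Vx Vy; rewrite leNgt => /negP; apply.
  apply: lt_le_trans (mdist_ge c xym xyNm).
  rewrite -[ltLHS](lnK d0) ltr_expR; suff : L m x < B by rewrite /B; lra.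
  by rewrite ltNge; apply/negP => /nmin; rewrite leqNgt mn.
pose u := mkseq x n; have su : size u = n by rewrite size_mkseq.
have uw : u \in words n by rewrite mem_words su.
apply: (@le_trans _ _ (sub_sum c s (N - n) u)).
  rewrite big_mkcond/= -{1}(subnKC nN) big_words_cat.
  rewrite (bigD1_seq u) ?uniq_words//= [X in _ + X]big1_seq ?addr0.
    by rewrite /sub_sum su subnKC//; apply: ler_sum => v _; case: ifP => // _; rewrite expR_ge0.
  move=> u' /andP[u'u u'n]; rewrite big1// => v _; case: ifPn => // /asboolP /Vagree h.
  move: u'n u'u; rewrite mem_words => /eqP u'n; rewrite (agree_mkseqE (x := x) u'n) ?eqxx// -/u.
  by rewrite -u'n => k ku; rewrite -(agree_cat v ku) h// -u'n.
have := sub_sum_upper c (N - n) u s0; rewrite su subnKC// => ub.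
rewrite [X in _ <= X * _ * _]mulrC -!mulrA ler_pdivlMl// mulrC.
apply: le_trans (ler_wpM2l _ (ZC n)) _.
  by rewrite /sub_sum sumr_ge0// => *; rewrite expR_ge0.
apply: le_trans ub _; rewrite [leRHS]mulrA ler_wpM2r ?(ltW (Zsum_gt0 _ _ _))//.
rewrite -[X in X `^ _](lnK d0) -expRM -!expRD ler_expR.
have := lexp_distortion c (agreeC (@agree_mkseq n x)); rewrite -/u => Lu.
have : 0 <= s * (L n (nth true u) - B + K) by rewrite mulr_ge0//; lra.
rewrite /B; lra.
Qed.

Lemma diameter_fin (d : R) (U : set T) : U !=set0 -> (diameter U <= d%:E)%E ->
  exists2 r, diameter U = r%:E & 0 <= r <= d.
Proof.
move=> /diameter_ge0; case: (diameter U) => [r| |]//.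
by rewrite !lee_fin => r0 rd; exists r => //; rewrite r0.
Qed.

(** Slightly enlarged, the sets of the cover become neighbourhoods of the points they contain.
    Finitely many of them suffice, and their masses, compared at one common deep level, must add up
    to the full mass. *)
Lemma cover_sum_ge (C s : R) (I : set nat) (U : nat -> set T) : 0 < C -> 0 < s ->
  (forall n, C <= Zsum c s n) -> delta_cover 1 (range p) I U ->
  ((4 * (expR (4 * s * K) / C))^-1%:E <= \esum_(i in I) (diameter (U i) `^ s))%E.
Proof.
move=> C0 s0 ZC [cov diamU]; set C1 := expR _ / C.
have C10 : 0 < C1 by rewrite divr_gt0// expR_gt0.
set e := (4 * C1)^-1; have e0 : 0 < e by rewrite invr_gt0 mulr_gt0.
rewrite leNgt; apply/negP => esum_lt.
pose d i := fine (diameter (U i)).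
have diamE i : I i -> diameter (U i) = (d i)%:E.
  by move=> /diamU[U0 U1]; have [r rE _] := diameter_fin U0 U1; rewrite /d rE.
have d_ge0 i : 0 <= d i.
  rewrite /d; have : (0%E <= diameter (U i) \/ U i = set0)%E.
    by have [->|/set0P/diameter_ge0] := eqVneq (U i) set0; [right|left].
  case=> [|->]; first exact: fine_ge0.
  by rewrite /diameter (_ : _ @` _ = set0) ?ereal_sup0//; apply/seteqP; split => // x [[q q'] []].
(* [h i] is the price of the enlargement: the new diameter [d' i] satisfies d' ^ s = d ^ s + h,
   which is positive even for a one-point set, and the total price is at most [e]. *)
pose h i : R := e * 2^-1 ^+ i.+1.
have h0 i : 0 < h i by rewrite mulr_gt0// exprn_gt0.
pose d' i := (d i `^ s + h i) `^ s^-1.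
have d's i : d' i `^ s = d i `^ s + h i.
  by rewrite -powRrM mulVf ?gt_eqF// powRr1// addr_ge0 ?powR_ge0// ltW.
have dd' i : d i < d' i.
  rewrite -[ltLHS]powRr1// -(divff (lt0r_neq0 s0)) powRrM; apply: gt0_ltr_powR.
  - by rewrite invr_gt0.
  - by rewrite nnegrE powR_ge0.
  - by rewrite nnegrE addr_ge0 ?powR_ge0// ltW.
  - by rewrite ltrDl.
have d'0 i : 0 < d' i by apply: le_lt_trans (dd' i).
pose V i : set T := [set q | exists2 q0, U i q0 & mdist q0 q < (d' i - d i) / 2].
have VU i q : U i q -> V i q.
  by move=> Uq; exists q => //; rewrite mdistxx divr_gt0// subr_gt0.
have Vdiam i : I i -> forall q q', V i q -> V i q' -> mdist q q' <= d' i.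
  move=> Ii q q' [r Ur rq] [r' Ur' rq'].
  have := mdist_le_diameter Ur Ur'; rewrite diamE// lee_fin => rr'.
  have := metric_triangle q r q'; have := metric_triangle r r' q'.
  rewrite (metric_sym q r); lra.
have [|F0 F0I F0V] := @coding_finite_subcover I V.
  move=> x; have [|i Ii Ui] := cov (p x); first by exists x.
  exists i => //; exists ((d' i - d i) / 2); first by rewrite divr_gt0// subr_gt0.
  by move=> q pq; exists (p x).
pose F := undup F0.
have uF : uniq F by exact: undup_uniq.
have FI i : i \in F -> I i by rewrite mem_undup => /F0I.
have /choice[N0 N0P] i : exists N0, I i -> forall N, (N0 <= N)%N ->
    \sum_(w <- words N | `[<V i (p (nth true w))>]) expR (- (s * L N (nth true w)))
    <= C1 * d' i `^ s * Zsum c s N.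
  have [Ii|nI] := pselect (I i); last by exists 0.
  by have [N0 N0P] := mass_le C0 (ltW s0) ZC (d'0 i) (Vdiam i Ii); exists N0.
pose N := \max_(i <- F) N0 i.
have Zle : Zsum c s N <= \sum_(i <- F) (C1 * d' i `^ s * Zsum c s N).
  apply: (@le_trans _ _ (\sum_(i <- F)
      \sum_(w <- words N | `[<V i (p (nth true w))>]) expR (- (s * L N (nth true w))))).
    under eq_bigr do rewrite big_mkcond.
    rewrite exchange_big/=; apply: ler_sum => w _.
    have [i iF0 Vi] := F0V (nth true w).
    rewrite (bigD1_seq i) ?mem_undup//= asboolT// lerDl sumr_ge0// => j _.
    by case: ifP => // _; rewrite expR_ge0.
  rewrite big_seq [leRHS]big_seq; apply: ler_sum => i iF; apply: N0P; first exact: FI.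
  exact: leq_bigmax_seq.
have : Zsum c s N <= (C1 * \sum_(i <- F) d' i `^ s) * Zsum c s N.
  by move: Zle; move: (Zsum c s N) => z; rewrite mulr_sumr mulr_suml.
rewrite ler_pMl ?Zsum_gt0//; apply/negP; rewrite -ltNge.
under eq_bigr do rewrite d's.
rewrite big_split/= -mulr_sumr.
have sumd : \sum_(i <- F) d i `^ s < e.
  rewrite -lte_fin; apply: le_lt_trans esum_lt; rewrite -sumEFin.
  apply: le_trans (esum_ge_seq _ uF FI).
  rewrite big_seq [leRHS]big_seq; apply: lee_sum => i iF.
  by rewrite diamE ?poweR_EFin//; exact: FI.
have := ler_wpM2l (ltW e0) (sum_halves_le1 uF); rewrite mulr1 => sumh.
(* Origin of the 4 in [e]: this makes [C1 * (e + e)] equal to 1/2, below the full mass 1. *)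
apply: (@lt_le_trans _ _ (C1 * (e + e))); first by rewrite ltr_pM2l// ltr_leD.
by rewrite /e invfM mulrDr mulrCA divff ?gt_eqF// mulr1; lra.
Qed.

Lemma hausdorff_dim_ge (C s : R) : 0 < C -> 0 < s -> (forall n, C <= Zsum c s n) ->
  (s%:E <= hausdorff_dim (range p))%E.
Proof.
move=> C0 s0 ZC; apply: le_ereal_inf_tmp => _ [t [t0 Ht] <-].
rewrite lee_fin leNgt; apply/negP => ts.
set e := (4 * (expR (4 * s * K) / C))^-1.
have e0 : 0 < e by rewrite invr_gt0 mulr_gt0// divr_gt0// expR_gt0.
have : (e%:E <= hausdorff_measure t (range p))%E.
  apply: le_ereal_sup_tmp; exists (hausdorff_content t 1 (range p)); first by exists 1 => //=.
  apply: le_ereal_inf_tmp => _ [I [U [cov ->]]].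
  apply: le_trans (cover_sum_ge C0 s0 ZC cov) _; apply: le_esum => i Ii.
  have [U0 U1] := cov.2 i Ii; have [r -> /andP[r0 r1]] := diameter_fin U0 U1.
  rewrite !poweR_EFin lee_fin; move: r0; rewrite le_eqVlt => /orP[/eqP <-|r0].
    by rewrite powR0 ?powR_ge0 ?gt_eqF.
  by apply: ger_powR; rewrite ?r0// ltW.
by rewrite Ht lee_fin leNgt e0.
Qed.

End hausdorff_coding.

(** * Packing dimension of a coded set *)

Section packing_general.
Context {R : realType} {T : metricType R}.
Implicit Types (A : set T) (s : R).
Local Open Scope ereal_scope.

(* In an empty [T] there is no packing at all, not even the one indexed by
   [set0], and all these quantities are [-oo]: hence the point [q]. *)
Lemma packing_content_ge0 (q : T) s delta A : 0 <= packing_content s delta A.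
Proof.
apply: ereal_sup_ubound; exists set0, (fun=> q), (fun=> 0%R); rewrite esum_set0.
by split => //; split => // i j [].
Qed.

Lemma packing_premeasure_ge0 (q : T) s A : 0 <= packing_premeasure s A.
Proof. by apply: le_ereal_inf_tmp => _ [d _ <-]; exact: packing_content_ge0. Qed.

Lemma packing_measure_ge0 (q : T) s A : 0 <= packing_measure s A.
Proof.
apply: le_ereal_inf_tmp => _ [B _ <-]; apply: nneseries_ge0 => n _ _.
exact: packing_premeasure_ge0.
Qed.

Lemma packing_dim_ge0 A : 0 <= packing_dim A.
Proof. by apply: le_ereal_inf_tmp => _ [s [s0 _] <-]; rewrite lee_fin. Qed.

Lemma geometric_tail_le (q : R) n m : (0 <= q < 1)%R ->
  (\sum_(i <- iota n m) q ^+ i <= q ^+ n / (1 - q))%R.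
Proof.
move=> /andP[q0 q1]; have q10 : (0 < 1 - q)%R by rewrite subr_gt0.
elim: m n => [|m IH] n /=; first by rewrite big_nil divr_ge0 ?exprn_ge0// ltW.
rewrite big_cons; apply: (@le_trans _ _ (q ^+ n + q ^+ n.+1 / (1 - q)))%R.
  by rewrite lerD2l IH.
rewrite exprS le_eqVlt; apply/orP/or_introl/eqP; field; exact: lt0r_neq0.
Qed.

End packing_general.

Section packing_coding.
Context {R : realType} {T : metricType R} (c : coding T).
Implicit Types (x y : nat -> bool) (u v w : seq bool) (s t : R).

Local Notation p := (point_of c).
Local Notation L := (lexp c).
Local Notation a := (lexp_lo c).
Local Notation b := (lexp_hi c).
Local Notation K := (distortion c).

Let a0 : 0 < a. Proof. exact: lexp_lo_gt0. Qed.
Let K0 : 0 <= K. Proof. exact: distortion_ge0. Qed.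
Let q0 : T := p (fun=> true).

(* The level at which the cylinder around a point first fits in the ball of
   radius [r] around it. *)
Lemma ball_level (n0 : nat) x (r : R) : 0 < r -> r < expR (K - n0%:R * b) ->
  exists n, [/\ (n0 < n)%N, forall y, agree n x y -> mdist (p x) (p y) <= r &
                r <= expR (K + b - L n x)].
Proof.
move=> r0 rd; have [N0 N0P] := expR_small K a0 r0.
have ex : exists n, expR (K - L n x) <= r.
  by exists N0; apply: le_trans (N0P N0 _) => //; rewrite ler_expR lerD2l lerN2 lexp_ge.
case: (ex_minnP ex) => n nr nmin.
have n0n : (n0 < n)%N.
  rewrite ltnNge; apply/negP => nn0.
  have := le_lt_trans nr rd; rewrite ltr_expR ltrD2l ltrN2 ltNge => /negP; apply.
  apply: le_trans (lexp_le c n x) _; rewrite ler_wpM2r ?ler_nat//.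
  exact/ltW/lexp_hi_gt0.
exists n; split => // [y xy|]; first exact: le_trans (mdist_le c xy) nr.
case: n n0n nr nmin => // n _ nr nmin.
have : ~~ (expR (K - L n x) <= r) by apply/negP => /nmin; rewrite ltnn.
rewrite -ltNge => /ltW/le_trans; apply; rewrite ler_expR.
have := lexpS_hi c n x; lra.
Qed.

(** A ball of the packing contains a cylinder of level above [n0] and of comparable size. Disjoint
    balls give distinct words, so the packing sum is dominated by the sum over all words of length
    at least [n0], level by level a geometric series. *)
Lemma packing_sum_le (C s t : R) (n0 : nat) (I : set nat) (x : nat -> T) (r : nat -> R) d :
  0 <= s -> s < t -> (forall n, Zsum c s n <= C) ->
  d < expR (K - n0%:R * b) -> delta_packing d (range p) I x r ->
  (\esum_(i in I) ((2 * r i) `^ t)%:E <=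
   (expR (t * (ln 2 + 2 * K + b)) * C *
     (expR (- ((t - s) * a)) ^+ n0 / (1 - expR (- ((t - s) * a)))))%:E)%E.
Proof.
move=> s0 st ZC dn0 [Axr triv].
have t0 : 0 < t by apply: le_lt_trans st.
have /choice[y yP] i : exists y, I i -> p y = x i.
  have [/Axr[[y _ yx] _]|nI] := pselect (I i); first by exists y.
  by exists (fun=> true).
have /choice[n nP] i : exists n, I i -> [/\ (n0 < n)%N,
    forall z, agree n (y i) z -> mdist (x i) (p z) <= r i &
    r i <= expR (K + b - L n (y i))].
  have [Ii|nI] := pselect (I i); last by exists 0.
  have [_ /andP[r0 rd]] := Axr i Ii.
  by have [m mP] := ball_level (y i) r0 (le_lt_trans rd dn0); exists m; rewrite -yP.
pose u i := mkseq (y i) (n i).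
(* If the words coincide, the centre [x j] lies in the cylinder of [u i], hence in ball [i]: the
   balls meet. *)
have u_inj i j : I i -> I j -> u i = u j -> i = j.
  move=> Ii Ij uij; apply: (triv _ _ Ii Ij); exists (x j).
  have nij : n i = n j by have := congr1 size uij; rewrite !size_mkseq.
  split => /=; last by rewrite mdistxx; have [_ /andP[/ltW]] := Axr j Ij.
  rewrite -(yP j Ij); have [_ + _] := nP i Ii; apply => k kn.
  by have := congr1 (nth true ^~ k) uij; rewrite !nth_mkseq// -nij.
pose g w := expR (- (t * L (size w) (nth true w))).
have rg i : I i -> (2 * r i) `^ t <= expR (t * (ln 2 + 2 * K + b)) * g (u i).
  move=> Ii; have [_ _ rn] := nP i Ii; have [_ /andP[r0 _]] := Axr i Ii.
  apply: (@le_trans _ _ ((2 * expR (K + b - L (n i) (y i))) `^ t)).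
    apply: ge0_ler_powR; first exact: ltW.
    - by rewrite nnegrE mulr_ge0// ltW.
    - by rewrite nnegrE mulr_ge0// expR_ge0.
    - by rewrite ler_pM2l.
  rewrite -[X in X * expR _](@lnK R 2) ?posrE// -expRD -expRM /g -expRD ler_expR size_mkseq.
  have := lexp_distortion c (@agree_mkseq (n i) (y i)) => /(ler_wpM2l (ltW t0)); lra.
apply: ge_ereal_sup => _ [X [finX XI] <-].
have [F uF XE] : exists2 F : seq nat, uniq F & X = [set` F].
  have [F0 ->] := (finite_seqP X).1 finX; exists (undup F0); first exact: undup_uniq.
  by apply/seteqP; split => i /=; rewrite mem_undup.
have FI i : i \in F -> I i by move=> iF; apply: XI; rewrite XE.
rewrite XE -fsbig_seq//= sumEFin lee_fin.
apply: (@le_trans _ _ (\sum_(i <- F) expR (t * (ln 2 + 2 * K + b)) * g (u i))).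
  by rewrite big_seq [leRHS]big_seq; apply: ler_sum => i iF; exact/rg/FI.
rewrite -mulr_sumr -mulrA ler_wpM2l ?expR_ge0// -(big_map u xpredT g).
pose M := (\max_(i <- F) n i).+1.
pose words_between := flatten [seq words m | m <- iota n0 M].
apply: (@le_trans _ _ (\sum_(w <- words_between) g w)).
  apply: ler_sum_uniq_sub => [|w|w]; last by rewrite expR_ge0.
    by rewrite map_inj_in_uniq ?uF// => i j /FI Ii /FI Ij; exact: u_inj.
  move=> /mapP[i iF ->]; apply/flatten_mapP; exists (n i); last first.
    by rewrite mem_words size_mkseq.
  rewrite mem_iota; have [/ltnW -> _ _ /=] := nP i (FI i iF).
  by rewrite /M addnS ltnS (leq_trans _ (leq_addl _ _))// leq_bigmax_seq.
rewrite big_flatten big_map.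
apply: (@le_trans _ _ (\sum_(m <- iota n0 M) C * expR (- ((t - s) * a)) ^+ m)).
  apply: ler_sum => m _; rewrite [leLHS](_ : _ = Zsum c t m); last first.
    by apply: eq_big_seq => w; rewrite mem_words /g => /eqP ->.
  apply: le_trans (Zsum_decay c m (ltW st)) _.
  rewrite mulrC -expRM_natl; apply: ler_pM; rewrite ?expR_ge0//.
  - exact/ltW/Zsum_gt0.
  - by rewrite ler_expR; lra.
rewrite -mulr_sumr ler_wpM2l ?(le_trans (ltW (Zsum_gt0 c s 0)))//.
apply: geometric_tail_le; rewrite expR_ge0 expR_lt1 oppr_lt0 mulr_gt0//.
by rewrite subr_gt0.
Qed.

Lemma packing_premeasure_eq0 (C s t : R) : 0 <= s -> s < t ->
  (forall n, Zsum c s n <= C) -> packing_premeasure t (range p) = 0%E.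
Proof.
move=> s0 st ZC; apply/eqP; rewrite eq_le packing_premeasure_ge0// andbT.
apply/lee_addgt0Pr => e e0; rewrite add0e.
have C0 : 0 < C by apply: lt_le_trans (ZC 0); exact: Zsum_gt0.
have ta0 : 0 < (t - s) * a by rewrite mulr_gt0// subr_gt0.
have q1 : 0 < 1 - expR (- ((t - s) * a)) by rewrite subr_gt0 expR_lt1 oppr_lt0.
have [n0 /(_ n0 (leqnn _)) n0P] := expR_small
  (t * (ln 2 + 2 * K + b) + ln C - ln (1 - expR (- ((t - s) * a)))) ta0 e0.
apply: ge_ereal_inf; eexists.
  by exists (expR (K - n0%:R * b) / 2) => //=; rewrite divr_gt0// expR_gt0.
apply: ge_ereal_sup => _ [I [x [r [pack ->]]]].
apply: le_trans (packing_sum_le (n0 := n0) s0 st ZC _ pack) _.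
  by rewrite ltr_pdivrMr// ltr_pMr ?expR_gt0// ltr1n.
rewrite lee_fin; apply: le_trans n0P.
rewrite -expRM_natl -[X in _ * X * _](lnK C0) -[X in _ / X](lnK q1) -expRN.
by rewrite -!expRD ler_expR; lra.
Qed.

Lemma packing_dim_le (C s : R) : 0 <= s -> (forall n, Zsum c s n <= C) ->
  (packing_dim (range p) <= s%:E)%E.
Proof.
move=> s0 ZC; apply/lee_addgt0Pr => e e0.
apply: ereal_inf_lbound; exists (s + e) => //=; split; first by rewrite addr_ge0// ltW.
apply/eqP; rewrite eq_le packing_measure_ge0// andbT.
apply: ereal_inf_lbound; exists (fun=> range p); first by move=> q Aq; exists 0.
by apply: eseries0 => i _ _; apply: packing_premeasure_eq0 ZC => //; rewrite ltrDl.
Qed.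

(* Baire's theorem on the coding space. *)
Lemma coding_baire (B : nat -> set T) : range p `<=` \bigcup_i B i ->
  exists i w, forall v, exists2 x, agree (size (w ++ v)) (nth true (w ++ v)) x & B i (p x).
Proof.
move=> cov; apply: contrapT => nowhere.
have step iw : exists v, forall x, agree (size (iw.2 ++ v)) (nth true (iw.2 ++ v)) x ->
    ~ B iw.1 (p x).
  apply: contrapT => no; apply: nowhere; exists iw.1, iw.2 => v.
  apply: contrapT => nox; apply: no; exists v => x wx Bx; apply: nox; by exists x.
have [ext extP] := choice step.
(* Stage [m] avoids [B m]; the extra letter makes the words grow even if [ext] returns the empty
   word, so that they define an infinite sequence. *)
pose ws := fix ws n := if n is m.+1 then rcons (ws m ++ ext (m, ws m)) true else [::].
have ws_size n : (n <= size (ws n))%N.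
  by elim: n => //= n IH; rewrite size_rcons size_cat ltnS (leq_trans IH)// leq_addr.
have ws_agree n m : (n <= m)%N ->
    (size (ws n) <= size (ws m))%N /\ agree (size (ws n)) (nth true (ws n)) (nth true (ws m)).
  elim: m => [|m IH]; first by rewrite leqn0 => /eqP ->.
  rewrite leq_eqVlt => /orP[/eqP ->//|/IH[le_nm nm]]; split=> [|k kn] /=.
    by rewrite size_rcons size_cat (leq_trans le_nm)// ltnW// ltnS leq_addr.
  rewrite nm//= nth_rcons size_cat nth_cat (leq_trans kn le_nm).
  by rewrite (leq_trans (leq_trans kn le_nm) (leq_addr _ _)).
pose x k := nth true (ws k.+1) k.
have wsx n : agree (size (ws n)) (nth true (ws n)) x.
  move=> k kn; rewrite /x; have [le_nk|lt_kn] := leqP n k.+1.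
    by have [_ ->] := ws_agree _ _ le_nk.
  by have [_ ->//] := ws_agree _ _ (ltnW lt_kn); exact: ws_size.
have [i _ Bi] := cov (p x) (imageT _ _).
apply: (extP (i, ws i) x) Bi => /= k kv.
rewrite -(wsx i.+1) /= ?nth_rcons ?kv//.
by rewrite size_rcons (leq_trans kv).
Qed.

(** Density of [D] gives a point of [D] in every subcylinder of [w] of level [n]. Small balls around
    these points form a packing whose sum is comparable to [sub_sum c t m w], and since t < s this
    is large at suitable levels. *)
Lemma packing_premeasure_ge1 (C s t : R) (D : set T) w : 0 < C -> 0 <= t -> t < s ->
  (forall N, exists2 n, (N <= n)%N & C <= Zsum c s n) ->
  (forall v, exists2 x, agree (size (w ++ v)) (nth true (w ++ v)) x & D (p x)) ->
  (1 <= packing_premeasure t D)%E.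
Proof.
move=> C0 t0 ts ZC dense; apply: le_ereal_inf_tmp => _ [d /= d0 <-].
have [X XP] := choice (fun v => let: ex_intro2 x h1 h2 := dense v in
  ex_intro (fun x => agree (size (w ++ v)) (nth true (w ++ v)) x /\ D (p x)) x (conj h1 h2)).
have st0 : 0 < (s - t) * a by rewrite mulr_gt0// subr_gt0.
(* [B] collects the logarithms of all constants in the final estimate; the gain (s - t) n a has to
   exceed [- B]. *)
pose B := t * (ln (2 / 3) - 4 * K) - t * L (size w) (nth true w) + ln C - ln (Zsum c t (size w)).
have [N1 N1P] := expR_small (- B) st0 ltr01.
have [N2 N2P] := expR_small (- K) a0 d0.
have [n + Zn] := ZC (maxn (size w) (maxn N1 N2)).
rewrite !geq_max => /and3P[wn N1n N2n].
pose m := (n - size w)%N; have nE : n = (size w + m)%N by rewrite subnKC.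
(* A third of the least distance from [X v] to a point that parts from it before level [n]: two such
   balls cannot meet. *)
pose r v := expR (- K - L n (X v)) / 3.
have r_gt0 v : 0 < r v by rewrite divr_gt0// expR_gt0.
apply: le_ereal_sup_tmp.
exists (\esum_(i in `I_(size (words m))) ((2 * r (nth [::] (words m) i)) `^ t)%:E)%E.
  exists `I_(size (words m)), (fun i => p (X (nth [::] (words m) i))),
    (fun i => r (nth [::] (words m) i)); split => //; split.
    move=> i im; split; first by have [] := XP (nth [::] (words m) i).
    rewrite r_gt0/= ler_pdivrMr// (le_trans _ (_ : d <= _))//; last by rewrite ler_peMr ?ler1n// ltW.
    apply: le_trans (N2P n N2n); rewrite ler_expR lerD2l lerN2; exact: lexp_ge.
  move=> i j /= im jm [q [/= qi qj]].
  apply/eqP; rewrite -(nth_uniq [::] im jm (uniq_words m)); apply/eqP.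
  set v := nth _ _ i in qi *; set v' := nth _ _ j in qj *.
  have sv : size v = m by apply/eqP; rewrite -mem_words mem_nth.
  have sv' : size v' = m by apply/eqP; rewrite -mem_words mem_nth.
  have [Xv _] := XP v; have [Xv' _] := XP v'.
  rewrite size_cat sv -nE in Xv; rewrite size_cat sv' -nE in Xv'.
  apply: contrapT => vv'; have : ~ agree n (X v) (X v').
    move=> XX; apply: vv'; apply: (@eq_from_nth _ true); rewrite ?sv ?sv'// => k km.
    have := XX (size w + k)%N; rewrite -Xv -?Xv' ?nE ?ltn_add2l// => /(_ km).
    by rewrite !nth_cat ltnNge leq_addr/= addKn.
  move=> /first_diff[l ln [XXl XXlN]].
  have h1 := mdist_ge c XXl XXlN.
  rewrite eq_sym in XXlN; have h2 := mdist_ge c (agreeC XXl) XXlN.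
  rewrite metric_sym in h2.
  have h3 := metric_triangle (p (X v)) q (p (X v')).
  rewrite (metric_sym q) in h3.
  have mono z : 3 * r z <= expR (- K - L l (X z)).
    by rewrite mulrCA divff// mulr1 ler_expR lerD2l lerN2 lexp_mono// ltnW.
  have := mono v; have := mono v'; have := r_gt0 v; have := r_gt0 v'; lra.
rewrite (@esum_seq _ _ [::] (words m) (fun v => (2 * r v) `^ t)); last by move=> v; exact: powR_ge0.
rewrite lee_fin.
apply: (@le_trans _ _ (expR (t * (ln (2 / 3) - 2 * K)) * sub_sum c t m w)); last first.
  rewrite /sub_sum mulr_sumr big_seq [leRHS]big_seq; apply: ler_sum => v.
  rewrite mem_words => /eqP sv.
  have -> : 2 * r v = expR (ln (2 / 3) + (- K - L n (X v))).
    by rewrite expRD lnK ?posrE ?divr_gt0// /r; ring.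
  rewrite -!expRD -expRM ler_expR -nE.
  have [Xv _] := XP v; rewrite size_cat sv -nE in Xv.
  have := lexp_distortion c (agreeC Xv) => /(ler_wpM2l t0).
  have := mulr_ge0 t0 K0; lra.
have Zt0 := Zsum_gt0 c t (size w).
have low := sub_sum_lower c m w t0.
have Zt : expR ((s - t) * (n%:R * a)) * C <= Zsum c t n.
  rewrite -ler_pdivlMl ?expR_gt0// -expRN; apply: le_trans Zn _.
  exact: Zsum_decay (ltW ts).
rewrite -nE in low.
have {}low := le_trans (ler_wpM2l (expR_ge0 _) Zt) low.
rewrite -[X in _ * (_ * X) <= _](lnK C0) -[X in _ <= _ * X](lnK Zt0) -!expRD in low.
rewrite mulrAC -expRD -ler_pdivrMl ?expR_gt0// -expRN -expRD in low.
apply: le_trans (ler_wpM2l (expR_ge0 _) low); rewrite -expRD leNgt expR_lt1 -leNgt.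
have := N1P n N1n; rewrite expR_le1 /B; lra.
Qed.

Lemma packing_dim_ge (C s : R) : 0 < C ->
  (forall N, exists2 n, (N <= n)%N & C <= Zsum c s n) ->
  (s%:E <= packing_dim (range p))%E.
Proof.
move=> C0 ZC; apply: le_ereal_inf_tmp => _ [t [t0 Pt] <-].
rewrite lee_fin leNgt; apply/negP => ts.
suff : (1 <= packing_measure t (range p))%E by rewrite Pt lee_fin ler10.
apply: le_ereal_inf_tmp => _ [B /= cov <-].
have [i [w dense]] := coding_baire cov.
apply: le_trans (packing_premeasure_ge1 C0 t0 ts ZC dense) _.
have pos k : (0 <= packing_premeasure t (B k))%E by exact: packing_premeasure_ge0.
apply: (le_trans _ (@nneseries_lim_ge _ _ xpredT 0 i.+1 (fun k _ _ => pos k))).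
by rewrite big_nat_recr//= leeDr// sume_ge0.
Qed.

End packing_coding.

(** * Quadratic maps and bounded orbits *)

(* [cabs] fixes the structure through which the norm of [Rcomplex R] is
   inferred: that of [complex R] takes its values in [complex R]. *)
Definition cabs {R : realType} (z : Rcomplex R) : R := `|z|.

Section cabs_theory.
Context {R : realType}.
Implicit Types z w : Rcomplex R.

Lemma cabs_ge0 z : 0 <= cabs z. Proof. exact: normr_ge0. Qed.

Lemma cabsM z w : cabs (z * w) = cabs z * cabs w.
Proof. exact: ComplexField.Normc.normcM. Qed.

Lemma cabsV z : cabs z^-1 = (cabs z)^-1.
Proof. exact: ComplexField.Normc.normcV. Qed.

Lemma cabs1 : cabs (1 : Rcomplex R) = 1.
Proof. exact: ComplexField.Normc.normc1. Qed.

Lemma cabsN z : cabs (- z) = cabs z.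
Proof. exact: normrN. Qed.

Lemma cabsBC z w : cabs (z - w) = cabs (w - z).
Proof. exact: distrC. Qed.

Lemma cabsD z w : cabs (z + w) <= cabs z + cabs w.
Proof. exact: ler_normD. Qed.

Lemma cabsB z w : cabs (z - w) <= cabs z + cabs w.
Proof. exact: ler_normB. Qed.

Lemma cabs_gt0 z : (0 < cabs z) = (z != 0).
Proof. exact: normr_gt0. Qed.

Lemma cabs_subr_ge z w : cabs z - cabs w <= cabs (z - w).
Proof. exact: lerB_dist. Qed.

Lemma cabs_nat n : cabs (n%:R : Rcomplex R) = n%:R.
Proof. by rewrite /cabs [LHS]normrMn -/(cabs 1) cabs1. Qed.

Lemma cabsX z n : cabs (z ^+ n) = cabs z ^+ n.
Proof. by elim: n => [|n IH]; rewrite ?expr0 ?cabs1// !exprS cabsM IH. Qed.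

Lemma cabs_sqr z : cabs z ^+ 2 = complex.Re z ^+ 2 + complex.Im z ^+ 2.
Proof.
case: z => x y; rewrite /cabs [`|_|]/Num.norm/= sqr_sqrtr//.
by rewrite addr_ge0// sqr_ge0.
Qed.

Lemma cabs_ge_Re z : `|complex.Re z| <= cabs z.
Proof.
by rewrite -ler_sqr ?nnegrE ?cabs_ge0// cabs_sqr real_normK ?num_real// lerDl sqr_ge0.
Qed.

Lemma cabs_ge_Im z : `|complex.Im z| <= cabs z.
Proof.
by rewrite -ler_sqr ?nnegrE ?cabs_ge0// cabs_sqr real_normK ?num_real// lerDr sqr_ge0.
Qed.

Lemma cabs_le_ReIm z : cabs z <= `|complex.Re z| + `|complex.Im z|.
Proof.
rewrite -ler_sqr ?nnegrE ?addr_ge0 ?cabs_ge0// cabs_sqr sqrrD !real_normK ?num_real//.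
by rewrite -addrA lerD2l lerDr mulrn_wge0// mulr_ge0.
Qed.

Lemma ReB z w : complex.Re (z - w) = complex.Re z - complex.Re w.
Proof. by case: z w => [? ?] [? ?]. Qed.

Lemma ImB z w : complex.Im (z - w) = complex.Im z - complex.Im w.
Proof. by case: z w => [? ?] [? ?]. Qed.

(** The intervals [[lo n, up n]] are nested, and the limit is the supremum of their left ends. *)
Lemma fast_cauchy_real (r : nat -> R) (A q : R) : 0 <= A -> 0 < q < 1 ->
  (forall n, `|r n.+1 - r n| <= A * q ^+ n) ->
  exists a : R, forall n, `|a - r n| <= A / (1 - q) * q ^+ n.
Proof.
move=> A0 /andP[q0 q1] rA.
have q10 : 0 < 1 - q by rewrite subr_gt0.
pose lo n := r n - A / (1 - q) * q ^+ n; pose up n := r n + A / (1 - q) * q ^+ n.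
have AE n : A / (1 - q) * q ^+ n = A * q ^+ n + A / (1 - q) * q ^+ n.+1.
  by rewrite exprS; field; exact: lt0r_neq0.
have loS n : lo n <= lo n.+1.
  by rewrite /lo (AE n); have := rA n; rewrite ler_norml => /andP[]; lra.
have upS n : up n.+1 <= up n.
  by rewrite /up (AE n); have := rA n; rewrite ler_norml => /andP[]; lra.
have loup n : lo n <= up n.
  have : 0 <= A / (1 - q) * q ^+ n by apply: mulr_ge0; [apply: divr_ge0|apply: exprn_ge0]; rewrite // ltW.
  rewrite /lo /up; lra.
have lo_mono m n : (m <= n)%N -> lo m <= lo n.
  elim: n => [|n IH]; first by rewrite leqn0 => /eqP ->.
  by rewrite leq_eqVlt => /orP[/eqP ->//|/IH/le_trans]; apply.
have up_mono m n : (m <= n)%N -> up n <= up m.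
  elim: n => [|n IH]; first by rewrite leqn0 => /eqP ->.
  by rewrite leq_eqVlt => /orP[/eqP ->//|/IH]; apply: le_trans.
have lo_up m n : lo m <= up n.
  apply: le_trans (lo_mono _ _ (leq_maxl m n)) _.
  by apply: le_trans (loup _) (up_mono _ _ (leq_maxr m n)).
exists (sup (range lo)) => n.
have h1 : lo n <= sup (range lo).
  by apply: ub_le_sup; [exists (up 0%N) => _ [m _ <-]|exists n].
have h2 : sup (range lo) <= up n by apply: ge_sup; [exists (lo 0%N), 0%N|move=> _ [m _ <-]].
by rewrite ler_norml; move: h1 h2; rewrite /lo /up => h1 h2; apply/andP; split; lra.
Qed.

Lemma fast_cauchy (u : nat -> Rcomplex R) (A q : R) : 0 <= A -> 0 < q < 1 ->
  (forall n, cabs (u n.+1 - u n) <= A * q ^+ n) ->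
  exists z, forall n, cabs (z - u n) <= 2 * (A / (1 - q)) * q ^+ n.
Proof.
move=> A0 q01 uA.
have [n|x xP] := @fast_cauchy_real (fun n => complex.Re (u n)) A q A0 q01.
  by apply: le_trans (uA n); have := cabs_ge_Re (u n.+1 - u n); rewrite raddfB.
have [n|y yP] := @fast_cauchy_real (fun n => complex.Im (u n)) A q A0 q01.
  by apply: le_trans (uA n); have := cabs_ge_Im (u n.+1 - u n); rewrite raddfB.
exists (Complex x y) => n; apply: le_trans (cabs_le_ReIm _) _.
rewrite (raddfB (@complex.Re R : Rcomplex R -> R)) (raddfB (@complex.Im R : Rcomplex R -> R))/=.
rewrite -mulrA mulr_natl mulr2n; exact: lerD.
Qed.

End cabs_theory.

Section quadratic_maps.
Context {R : realType}.
Local Notation C := (Rcomplex R).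
Implicit Types (tau z w : C) (l : nat -> C) (x y : nat -> bool).

Definition fquad tau z : C := tau / 2 * (z ^+ 2 - 1) + 1.

Lemma fquad_sub tau z w : fquad tau z - fquad tau w = tau / 2 * ((z - w) * (z + w)).
Proof. by rewrite /fquad; ring. Qed.

Lemma norm_fquad_sub tau z w :
  cabs (fquad tau z - fquad tau w) = cabs tau * cabs (z + w) / 2 * cabs (z - w).
Proof.
by rewrite fquad_sub !cabsM cabsV cabs_nat; ring.
Qed.

(** Origin of the radius 11/10: for r beyond it, 20 (r^2 - 1) - 1 is at least 2 r. *)
Lemma fquad_escape tau z : 40 <= cabs tau -> 11 / 10 < cabs z -> 2 * cabs z <= cabs (fquad tau z).
Proof.
move=> t40 z1; have : cabs tau / 2 * (cabs z ^+ 2 - 1) - 1 <= cabs (fquad tau z).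
  have := cabs_subr_ge (tau / 2 * (z ^+ 2 - 1)) (- 1).
  rewrite opprK -/(fquad tau z) cabsN cabs1 !cabsM cabsV cabs_nat; apply: le_trans.
  rewrite lerD2r ler_wpM2l ?divr_ge0 ?cabs_ge0// -cabsX.
  by have := cabs_subr_ge (z ^+ 2) 1; rewrite cabs1.
have : 20 * (cabs z ^+ 2 - 1) <= cabs tau / 2 * (cabs z ^+ 2 - 1).
  by rewrite ler_wpM2r//; nra.
nra.
Qed.

Definition sgc (b : bool) : C := if b then 1 else -1.

Lemma norm_sgc b : cabs (sgc b) = 1.
Proof. by case: b; rewrite /= ?cabsN cabs1. Qed.

(** Origin of 21/200: it is (2 / 40) (11/10 + 1). *)
Lemma fquad_inv_near tau z : 40 <= cabs tau -> cabs (fquad tau z) <= 11 / 10 ->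
  cabs (z ^+ 2 - 1) <= 21 / 200.
Proof.
move=> t40 fz.
have E : cabs (fquad tau z - 1) = cabs tau / 2 * cabs (z ^+ 2 - 1).
  by rewrite /fquad addrK !cabsM cabsV cabs_nat.
have : cabs (fquad tau z - 1) <= 21 / 10.
  by have := cabsB (fquad tau z) 1; rewrite cabs1; lra.
rewrite E; have := cabs_ge0 (z ^+ 2 - 1); nra.
Qed.

Lemma norm_le_of_sqr z : cabs (z ^+ 2 - 1) <= 21 / 200 -> 9 / 10 <= cabs z <= 11 / 10.
Proof.
move=> z1; have h1 : cabs z ^+ 2 <= 221 / 200.
  have := cabsD (z ^+ 2 - 1) 1; rewrite subrK cabsX cabs1; lra.
have h2 : 179 / 200 <= cabs z ^+ 2.
  have := cabsB (z ^+ 2) (z ^+ 2 - 1); rewrite subKr cabsX cabs1; lra.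
have := cabs_ge0 z => z0; apply/andP; split; nra.
Qed.

(** Of the two factors z - 1 and z + 1 of z^2 - 1, the one belonging to the other root has modulus
    at least 1. *)
Lemma near_sgc z : cabs (z ^+ 2 - 1) <= 21 / 200 -> cabs (z - sgc (0 <= complex.Re z)) <= 21 / 200.
Proof.
have E : cabs (z ^+ 2 - 1) = cabs (z - 1) * cabs (z + 1).
  by rewrite -cabsM; congr (cabs (_)); ring.
rewrite E /sgc => h; case: ifPn => [Re0|]; last rewrite -ltNge => Re0.
  apply: le_trans h; rewrite ler_peMr ?cabs_ge0//.
  have -> : z + 1 = z - (-1) by rewrite opprK.
  apply: le_trans (cabs_ge_Re _); rewrite ReB/=.
  by rewrite ger0_norm; lra.
rewrite opprK; apply: le_trans h; rewrite ler_peMl ?cabs_ge0//.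
apply: le_trans (cabs_ge_Re _); rewrite ReB/=.
by rewrite ltr0_norm; lra.
Qed.

Lemma norm_addl_sgc b z w : cabs (z - sgc b) <= 21 / 200 -> cabs (w - sgc b) <= 21 / 200 ->
  7 / 4 <= cabs (z + w).
Proof.
move=> zb wb; have : cabs (sgc b + sgc b) <= cabs (z + w) + (cabs (z - sgc b) + cabs (w - sgc b)).
  have -> : sgc b + sgc b = (z + w) - ((z - sgc b) + (w - sgc b)) by ring.
  by apply: le_trans (cabsB _ _) _; rewrite lerD2l cabsD.
have -> : sgc b + sgc b = 2 * sgc b by ring.
rewrite cabsM cabs_nat norm_sgc; lra.
Qed.

Lemma norm_sub_sgc b b' z w : b != b' -> cabs (z - sgc b) <= 21 / 200 ->
  cabs (w - sgc b') <= 21 / 200 -> 7 / 4 <= cabs (z - w).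
Proof.
move=> bb' zb wb; rewrite -[z - w]/(z + - w); apply: (norm_addl_sgc zb).
suff -> : sgc b = - sgc b' by rewrite -opprD cabsN.
by case: b b' bb' {zb wb} => -[]//= _; rewrite opprK.
Qed.

(** The root [sqrtc] has nonnegative real part, so for [w] in the disc of radius 11/10 the sign [b]
    selects the preimage near [sgc b]. *)
Definition branch tau b w : C := sgc b * sqrtc (1 + 2 * (w - 1) / tau).

Lemma branch_sqr tau b w : branch tau b w ^+ 2 = 1 + 2 * (w - 1) / tau.
Proof.
rewrite /branch exprMn sqr_sqrtc; case: b; rewrite /= ?sqrrN expr1n mul1r//.
Qed.

Lemma fquad_branch tau b w : tau != 0 -> fquad tau (branch tau b w) = w.
Proof. by move=> t0; rewrite /fquad branch_sqr; field. Qed.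

Lemma Re_sqrtc_ge0 z : 0 <= complex.Re (sqrtc z : C).
Proof. by case: z => u v /=; exact: sqrtr_ge0. Qed.

Lemma branch_near tau b w : 40 <= cabs tau -> cabs w <= 11 / 10 ->
  cabs (branch tau b w - sgc b) <= 21 / 200 /\ cabs (branch tau b w) <= 11 / 10.
Proof.
move=> t40 w1; have t0 : tau != 0 by rewrite -cabs_gt0 (lt_le_trans _ t40).
have /fquad_inv_near : 40 <= cabs tau := t40.
have fq b' : cabs (branch tau b' w ^+ 2 - 1) <= 21 / 200.
  by apply: (fquad_inv_near t40); rewrite fquad_branch.
move=> _; split; last by have /andP[] := norm_le_of_sqr (fq b).
have h : cabs (branch tau true w - 1) <= 21 / 200.
  have := near_sgc (fq true); rewrite /branch /= mul1r.
  by rewrite Re_sqrtc_ge0.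
case: b; first exact: h.
have -> : branch tau false w - sgc false = - (branch tau true w - 1).
  by rewrite /branch/=; ring.
by rewrite cabsN.
Qed.

(** [norm_fquad_sub] and [norm_addl_sgc] give the factor 40 (7/4) / 2 = 35. *)
Lemma fquad_contract tau b z w : 40 <= cabs tau ->
  cabs (z - sgc b) <= 21 / 200 -> cabs (w - sgc b) <= 21 / 200 ->
  32 * cabs (z - w) <= cabs (fquad tau z - fquad tau w).
Proof.
move=> t40 zb wb; rewrite norm_fquad_sub ler_wpM2r ?cabs_ge0//.
have := norm_addl_sgc zb wb; have := cabs_ge0 (z + w); nra.
Qed.

Fixpoint orb l z (n : nat) : C := if n is m.+1 then fquad (l m) (orb l z m) else z.

Lemma iter_quad l z n : iter_seq quad l n (Some z) = Some (orb l z n).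
Proof. by elim: n => //= n ->. Qed.

Lemma orb_shift l z j n : orb l z (j + n) = orb (shift_seq j l) (orb l z j) n.
Proof. by elim: n => [|n IH] /=; rewrite ?addn0// addnS /= IH. Qed.

Definition coded l x z := forall k, cabs (orb l z k) <= 11 / 10 /\
  cabs (orb l z k - sgc (x k)) <= 21 / 200.

Lemma coded_shift l x z j : coded l x z ->
  coded (shift_seq j l) (fun k => x (j + k)%N) (orb l z j).
Proof. by move=> zx k; rewrite -orb_shift. Qed.

Lemma bounded_coded l z : (forall k, 40 <= cabs (l k)) -> (forall k, cabs (orb l z k) <= 11 / 10) ->
  coded l (fun k => 0 <= complex.Re (orb l z k)) z.
Proof.
move=> l40 zb k; split => //; apply: near_sgc.
by apply: (fquad_inv_near (l40 k)); exact: zb k.+1.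
Qed.

Lemma coded_ge l x z k : (forall k, 40 <= cabs (l k)) -> coded l x z -> 9 / 10 <= cabs (orb l z k).
Proof.
move=> l40 zx; have /andP[] := norm_le_of_sqr (fquad_inv_near (l40 k) (zx k.+1).1).
by [].
Qed.

(** Seen backwards in time, each of the [j] common symbols from time [k] on contracts by 32; the 3
    bounds the diameter 11/5 of the disc. *)
Lemma coded_contract l x y z w k j : (forall k, 40 <= cabs (l k)) ->
  coded l x z -> coded l y w -> agree (k + j) x y ->
  cabs (orb l z k - orb l w k) <= 3 * 32^-1 ^+ j.
Proof.
move=> l40 zx wy; elim: j k => [|j IH] k xy.
  rewrite expr0; have := cabsB (orb l z k) (orb l w k).
  by have := (zx k).1; have := (wy k).1; lra.
have xyk : x k = y k by apply: xy; rewrite addnS ltnS leq_addr.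
have := (wy k).2; rewrite -xyk => wk.
have := fquad_contract (l40 k) (zx k).2 wk.
have := IH k.+1; rewrite addSnnS exprS => /(_ xy) /=; lra.
Qed.

Lemma coded_inj l x z w : (forall k, 40 <= cabs (l k)) ->
  coded l x z -> coded l x w -> z = w.
Proof.
move=> l40 zx wx; apply/eqP; rewrite -subr_eq0; apply/negPn/negP => zw.
have zw0 : 0 < cabs (z - w) by rewrite cabs_gt0.
have ln32 : 0 < ln (32 : R) by rewrite ln_gt0// ltr1n.
have [N /(_ N (leqnn _)) NP] := expR_small (ln 3) ln32 (divr_gt0 zw0 (ltr0n R 2)).
have := @coded_contract l x x z w 0 N l40 zx wx (fun _ _ => erefl) => /=.
move: NP; rewrite expRB lnK ?posrE// expRM_natl lnK ?posrE// exprVn; lra.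
Qed.

Lemma branch_coded l x (z : nat -> C) : (forall k, 40 <= cabs (l k)) ->
  (forall k, cabs (z k) <= 11 / 10 /\ z k = branch (l k) (x k) (z k.+1)) ->
  coded l x (z 0%N).
Proof.
move=> l40 zP.
have t0 k : l k != 0 by rewrite -cabs_gt0 (lt_le_trans _ (l40 k)).
have E k : orb l (z 0%N) k = z k.
  by elim: k => //= k ->; rewrite {1}(zP k).2 fquad_branch.
by move=> k; rewrite E {2}(zP k).2; split; [exact: (zP k).1|exact: (branch_near _ _ (zP k.+1).1).1].
Qed.

Lemma branch_contract tau b z w : 40 <= cabs tau -> cabs z <= 11 / 10 -> cabs w <= 11 / 10 ->
  32 * cabs (branch tau b z - branch tau b w) <= cabs (z - w).
Proof.
move=> t40 z1 w1; have t0 : tau != 0 by rewrite -cabs_gt0 (lt_le_trans _ t40).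
have := fquad_contract t40 (branch_near b t40 z1).1 (branch_near b t40 w1).1.
by rewrite !fquad_branch.
Qed.

Fixpoint pullback l x n : C :=
  if n is m.+1 then branch (l 0%N) (x 0%N) (pullback (fun k => l k.+1) (fun k => x k.+1) m)
  else 1.

Lemma pullback_bound l x n : (forall k, 40 <= cabs (l k)) -> cabs (pullback l x n) <= 11 / 10.
Proof.
elim: n l x => [|n IH] l x l40 /=; first by rewrite cabs1; lra.
by apply: (branch_near _ (l40 0%N) _).2; apply: IH => k.
Qed.

Lemma pullbackS l x n : (forall k, 40 <= cabs (l k)) ->
  cabs (pullback l x n.+1 - pullback l x n) <= 3 * 32^-1 ^+ n.
Proof.
elim: n l x => [|n IH] l x l40.
  rewrite expr0; have := cabsB (pullback l x 1) (pullback l x 0).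
  have := @pullback_bound l x 1 l40; have := @pullback_bound l x 0 l40; lra.
have l40' k : 40 <= cabs (l k.+1) by exact: l40.
have := branch_contract (x 0%N) (l40 0%N) (@pullback_bound _ (fun k => x k.+1) n.+1 l40')
  (@pullback_bound _ (fun k => x k.+1) n l40').
have := IH _ (fun k => x k.+1) l40'; rewrite exprS /=; lra.
Qed.

(** The pullbacks converge for every shift of [l] and [x] at once. Passing to the limit in [uS]
    shows that consecutive limits [z k], [z k.+1] are related by the inverse branch, so they form an
    orbit. *)
Lemma coded_exists l x : (forall k, 40 <= cabs (l k)) -> exists z, coded l x z.
Proof.
move=> l40.
have lk40 k j : 40 <= cabs (l (k + j)%N) by exact: l40.
pose u k n := pullback (fun j => l (k + j)%N) (fun j => x (k + j)%N) n.
have uS k n : u k n.+1 = branch (l k) (x k) (u k.+1 n).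
  rewrite /u /= addn0; congr (branch _ _ (pullback _ _ _)); apply/funext => j;
  by rewrite addSnnS.
have q01 : 0 < (32^-1 : R) < 1 by lra.
have /choice[z zP] k := fast_cauchy (ler0n R 3) q01 (fun n => @pullbackS _ (fun j => x (k + j)%N) n (lk40 k)).
set A := 2 * _ in zP.
have A0 : 0 < A by rewrite /A mulr_gt0// divr_gt0//; lra.
have small (e : R) : 0 < e -> exists n, A * 32^-1 ^+ n < e.
  move=> e0; have ln32 : 0 < ln (32 : R) by rewrite ln_gt0// ltr1n.
  have [N /(_ N (leqnn _)) NP] := expR_small (ln A) ln32 (divr_gt0 e0 (ltr0n R 2)).
  exists N; move: NP; rewrite expRB lnK ?posrE// expRM_natl lnK ?posrE// exprVn; lra.
have zb k : cabs (z k) <= 11 / 10.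
  apply/ler_addgt0Pr => e e0; have [n nP] := small e e0.
  have := cabs_subr_ge (z k) (u k n); have := zP k n.
  have := @pullback_bound _ (fun j => x (k + j)%N) n (lk40 k); rewrite -/(u k n); lra.
exists (z 0%N); apply: branch_coded => // k; split => //.
apply/eqP; rewrite -subr_eq0; apply/negPn/negP; rewrite -cabs_gt0 => zb0.
have [n nP] := small _ (divr_gt0 zb0 (ltr0n R 2)).
have h1 := zP k n.+1; have h2 := zP k.+1 n; rewrite -/(u _ _) in h1 h2.
have h3 := branch_contract (x k) (l40 k) (zb k.+1)
  (@pullback_bound _ (fun j => x (k.+1 + j)%N) n (lk40 k.+1)).
rewrite -/(u _ _) -uS in h3.
have := cabsB (z k - u k n.+1) (branch (l k) (x k) (z k.+1) - u k n.+1).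
rewrite opprB addrA subrK.
have : A * 32^-1 ^+ n.+1 <= A * 32^-1 ^+ n.
  rewrite exprS mulrCA ler_piMl//; first by rewrite mulr_ge0 ?exprn_ge0// ltW.
  by lra.
lra.
Qed.

End quadratic_maps.

(** * The spherical metric *)

Section sine_bounds.
Context {R : realType}.
Implicit Types x : R.

Lemma sin_mvt x : 0 < x -> exists2 xi, 0 < xi < x & sin x = cos xi * x.
Proof.
move=> x0.
have [|xi xi0 E] := @MVT R sin cos 0 x x0 (fun y _ => is_derive_sin y).
  exact/continuous_subspaceT/continuous_sin.
by exists xi; [move: xi0; rewrite in_itv|move: E; rewrite sin0 !subr0].
Qed.

Lemma sin_le_id x : 0 <= x -> sin x <= x.
Proof.
rewrite le_eqVlt => /orP[/eqP <-|x0]; first by rewrite sin0.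
have [xi _ ->] := sin_mvt x0; rewrite ger_pMl//; exact: cos_le1.
Qed.

Lemma sin_ge_mul_cos x : 0 <= x <= pi -> x * cos x <= sin x.
Proof.
move=> /andP[]; rewrite le_eqVlt => /orP[/eqP <-|x0 xpi]; first by rewrite sin0 mul0r.
have [xi /andP[xi0 xix] ->] := sin_mvt x0; rewrite mulrC ler_pM2r// ltW//.
by rewrite ltr_cos ?in_itv/= ?(ltW x0)// ?(ltW xi0)/= ltW// (lt_le_trans xix).
Qed.

End sine_bounds.

Section chordal.
Context {R : realType}.
Local Notation C := (Rcomplex R).
Implicit Types (p q : sphere R) (z w tau : C).

(** The Euclidean distance of the two unit vectors. It has explicit formulas in the affine
    coordinate and is comparable to [mdist]. *)
Definition chord p q : R := Num.sqrt (2 - 2 * dot3 (stereo p) (stereo q)).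

Let dot_bound p q : -1 <= dot3 (stereo p) (stereo q) <= 1.
Proof. by apply: dot3_bound; exact: dot3_stereo. Qed.

Lemma chord_ge0 p q : 0 <= chord p q. Proof. exact: sqrtr_ge0. Qed.

Lemma mdist_lepi p q : mdist p q <= pi.
Proof. exact: acos_lepi. Qed.

Lemma chord_sin p q : chord p q = 2 * sin (mdist p q / 2).
Proof.
have d0 := mdist_ge0 p q; have dpi := mdist_lepi p q.
have s0 : 0 <= sin (mdist p q / 2) by apply: sin_ge0_pi; apply/andP; split; lra.
rewrite /chord -[RHS]ger0_norm ?mulr_ge0// -sqrtr_sqr; congr Num.sqrt.
have -> : dot3 (stereo p) (stereo q) = cos (mdist p q).
  have -> : mdist p q = acos (dot3 (stereo p) (stereo q)) by [].
  by rewrite acosK// in_itv/=.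
have {1}-> : mdist p q = (mdist p q / 2) *+ 2 by rewrite -mulr_natr divfK.
by rewrite cos_mulr2n cos2sin2; ring.
Qed.

Lemma chord_le_mdist p q : chord p q <= mdist p q.
Proof.
rewrite chord_sin; have : 0 <= mdist p q / 2 by rewrite divr_ge0// mdist_ge0.
by move=> /sin_le_id; lra.
Qed.

(** With y half the spherical distance, this is y cos^2 y <= sin y. It also shows that the ratio of
    the two distances tends to 1. *)
Lemma mdist_le_chord p q : mdist p q * (1 - chord p q ^+ 2 / 4) <= chord p q.
Proof.
have d0 := mdist_ge0 p q; have dpi := mdist_lepi p q; have pi0 := pi_gt0 R.
rewrite chord_sin; set y := mdist p q / 2.
have -> : mdist p q = 2 * y by rewrite /y; lra.
have -> : 1 - (2 * sin y) ^+ 2 / 4 = cos y ^+ 2 by rewrite cos2sin2; lra.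
have yb : 0 <= y <= pi by rewrite /y; lra.
have c0 : 0 <= cos y by apply: cos_ge0_pihalf; rewrite /y; lra.
have := sin_ge_mul_cos yb; have := cos_le1 y; rewrite -mulrA => c1 h.
rewrite ler_pM2l//; apply: le_trans h; rewrite ler_wpM2l//; last nra.
by move: yb => /andP[].
Qed.

Lemma mdist_le_3chord p q : mdist p q <= 3 * chord p q.
Proof.
have := mdist_le_chord p q; have := mdist_lepi p q; have := pihalf_lt2 R.
have := chord_ge0 p q; have := mdist_ge0 p q.
(* Beyond 7/5, [mdist] is at most pi < 4 < 3 (7/5). *)
have [h|h] := leP (chord p q) (7 / 5); last lra.
move=> d0 c0 _ _; move=> h'.
have c2 : chord p q ^+ 2 <= 49 / 25 by nra.
have : mdist p q * (51 / 100) <= mdist p q * (1 - chord p q ^+ 2 / 4).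
  by rewrite ler_wpM2l//; lra.
lra.
Qed.

(** The Japanese bracket: the spherical metric has density 2 / jap^2. *)
Definition jap z : R := Num.sqrt (1 + cabs z ^+ 2).

Lemma jap_sqr z : jap z ^+ 2 = 1 + cabs z ^+ 2.
Proof. by rewrite sqr_sqrtr// addr_ge0// sqr_ge0. Qed.

Lemma jap_ge1 z : 1 <= jap z.
Proof. by rewrite -ler_sqr ?nnegrE ?sqrtr_ge0// jap_sqr expr1n lerDl sqr_ge0. Qed.

Lemma jap_gt0 z : 0 < jap z. Proof. exact: lt_le_trans (jap_ge1 z). Qed.

Lemma jap_ge z : cabs z <= jap z.
Proof. by rewrite -ler_sqr ?nnegrE ?sqrtr_ge0 ?cabs_ge0// jap_sqr lerDr. Qed.

Lemma jap_le z : jap z <= 1 + cabs z.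
Proof.
rewrite -ler_sqr ?nnegrE ?sqrtr_ge0 ?addr_ge0 ?cabs_ge0//.
by rewrite jap_sqr; have := cabs_ge0 z; nra.
Qed.

Let den_gt0 (a b : R) : 0 < 1 + a ^+ 2 + b ^+ 2.
Proof. by rewrite -addrA ltr_pwDl// addr_ge0// sqr_ge0. Qed.

Lemma chord_SomeE z w : chord (Some z) (Some w) = 2 * cabs (z - w) / (jap z * jap w).
Proof.
rewrite /chord -[RHS]ger0_norm; last first.
  by rewrite divr_ge0 ?mulr_ge0 ?cabs_ge0// ltW// jap_gt0.
rewrite -sqrtr_sqr; congr Num.sqrt.
rewrite expr_div_n !exprMn !jap_sqr !cabs_sqr ReB ImB !addrA.
case: z w => [a b] [c d] /=; rewrite /dot3/=.
have /lt0r_neq0 h1 := den_gt0 a b; have /lt0r_neq0 h2 := den_gt0 c d.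
by field; apply/andP.
Qed.

Lemma chord_NoneE z : chord None (Some z) = 2 / jap z.
Proof.
rewrite /chord -[RHS]ger0_norm; last by rewrite divr_ge0// ltW// jap_gt0.
rewrite -sqrtr_sqr; congr Num.sqrt.
rewrite expr_div_n !jap_sqr !cabs_sqr !addrA.
case: z => [a b] /=; rewrite /dot3/=.
have /lt0r_neq0 h1 := den_gt0 a b.
by field.
Qed.

Lemma chordC p q : chord p q = chord q p.
Proof. by rewrite /chord dot3C. Qed.

Lemma chord_xx p : chord p p = 0.
Proof. by rewrite /chord dot3_stereo mulr1 subrr sqrtr0. Qed.

Lemma cabs_add_le_jap z w : cabs (z + w) <= jap z * jap w.
Proof.
apply: le_trans (cabsD _ _) _; rewrite -ler_sqr ?nnegrE ?addr_ge0 ?mulr_ge0 ?cabs_ge0 ?sqrtr_ge0//.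
rewrite exprMn !jap_sqr; have := sqr_ge0 (1 - cabs z * cabs w); nra.
Qed.

Lemma jap_sqr_le_fquad tau z : 40 <= cabs tau -> jap z ^+ 2 <= 3 * jap (fquad tau z).
Proof.
move=> t40; rewrite jap_sqr -cabsX.
have E : cabs (fquad tau z - 1) = cabs tau / 2 * cabs (z ^+ 2 - 1).
  by rewrite /fquad addrK !cabsM cabsV cabs_nat.
have h1 := cabsB (fquad tau z) 1; rewrite cabs1 E in h1.
have h2 := cabsD (z ^+ 2 - 1) 1; rewrite subrK cabs1 in h2.
have := jap_ge (fquad tau z); have := jap_ge1 (fquad tau z).
have := cabs_ge0 (z ^+ 2 - 1); nra.
Qed.

(** The factor |z + w|, unbounded near infinity, is absorbed by the brackets: |z + w| <= jap z * jap
    w by Cauchy-Schwarz, and jap^2 is at most three times the bracket of the image. Linearity in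
    |tau| gives one Lipschitz constant for a bounded sequence. *)
Lemma chord_quad tau p q : 40 <= cabs tau ->
  chord (quad tau p) (quad tau q) <= 5 * cabs tau * chord p q.
Proof.
move=> t40.
have none z : chord None (Some (fquad tau z)) <= 5 * cabs tau * chord None (Some z).
  rewrite !chord_NoneE.
  have h := jap_sqr_le_fquad z t40; have j1 := jap_ge1 z; have j0 := jap_gt0 z.
  have f0 := jap_gt0 (fquad tau z).
  have -> : 5 * cabs tau * (2 / jap z) = 10 * cabs tau / jap z by ring.
  rewrite ler_pdivrMr// [leRHS]mulrAC ler_pdivlMr//; nra.
case: p q => [z|] [w|]; rewrite /= -?/(fquad tau _) //.
- rewrite !chord_SomeE norm_fquad_sub.
  have hz := jap_sqr_le_fquad z t40; have hw := jap_sqr_le_fquad w t40.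
  have z0 := jap_gt0 z; have w0 := jap_gt0 w.
  have fz0 := jap_gt0 (fquad tau z); have fw0 := jap_gt0 (fquad tau w).
  set D := jap z * jap w; have D0 : 0 < D by rewrite mulr_gt0.
  rewrite [leRHS]mulrA ler_pdivrMr ?mulr_gt0// [leRHS]mulrAC ler_pdivlMr//.
  have h : cabs (z + w) * D <= 9 * (jap (fquad tau z) * jap (fquad tau w)).
    apply: (@le_trans _ _ (D * D)).
      by rewrite ler_wpM2r ?cabs_add_le_jap// ltW.
    have -> : D * D = jap z ^+ 2 * jap w ^+ 2 by rewrite /D; ring.
    have -> : 9 * (jap (fquad tau z) * jap (fquad tau w)) =
      (3 * jap (fquad tau z)) * (3 * jap (fquad tau w)) by ring.
    by apply: ler_pM; rewrite ?sqr_ge0.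
  have tz : 0 <= cabs tau * cabs (z - w) by rewrite mulr_ge0 ?cabs_ge0.
  have := ler_wpM2l tz h.
  have : 0 <= cabs tau * cabs (z - w) * (jap (fquad tau z) * jap (fquad tau w)).
    by rewrite mulr_ge0// ltW// mulr_gt0.
  lra.
- by rewrite !(chordC (Some _)); exact: none.
- by rewrite chord_xx mulr_ge0 ?mulr_ge0 ?cabs_ge0 ?chord_ge0.
Qed.

Lemma mdist_quad tau p q : 40 <= cabs tau ->
  mdist (quad tau p) (quad tau q) <= 15 * cabs tau * mdist p q.
Proof.
move=> t40; apply: le_trans (mdist_le_3chord _ _) _.
have := chord_quad p q t40.
have : 5 * cabs tau * chord p q <= 5 * cabs tau * mdist p q.
  by rewrite ler_wpM2l ?chord_le_mdist// mulr_ge0 ?cabs_ge0.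
lra.
Qed.

Lemma mdist_None_le z : mdist (None : sphere R) (Some z) <= 6 / jap z.
Proof.
by apply: le_trans (mdist_le_3chord _ _) _; rewrite chord_NoneE; lra.
Qed.

Lemma mdist_Some_le z w : mdist (Some z : sphere R) (Some w) <= 6 * cabs (z - w).
Proof.
apply: le_trans (mdist_le_3chord _ _) _; rewrite chord_SomeE.
have : 2 * cabs (z - w) / (jap z * jap w) <= 2 * cabs (z - w).
  rewrite ler_pdivrMr ?mulr_gt0 ?jap_gt0// ler_peMr ?mulr_ge0 ?cabs_ge0//.
  by rewrite mulr_ege1 ?jap_ge1.
lra.
Qed.

Lemma mdist_Some_ge z w : cabs z <= 11 / 10 -> cabs w <= 11 / 10 ->
  cabs (z - w) <= 3 * mdist (Some z : sphere R) (Some w).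
Proof.
move=> z1 w1; have := chord_le_mdist (Some z : sphere R) (Some w).
rewrite chord_SomeE; set d := mdist _ _.
have hz := jap_le z; have hw := jap_le w.
have jb v : cabs v <= 11 / 10 -> jap v <= 3 / 2.
  move=> v1; rewrite -ler_sqr ?nnegrE ?sqrtr_ge0// jap_sqr; have := cabs_ge0 v; nra.
have {}hz := jb _ z1; have {}hw := jb _ w1.
have z0 := jap_gt0 z; have w0 := jap_gt0 w.
rewrite ler_pdivrMr ?mulr_gt0// => h.
have d0 : 0 <= d by exact: mdist_ge0.
have : d * (jap z * jap w) <= d * (9 / 4) by rewrite ler_wpM2l//; nra.
lra.
Qed.

Lemma near_Some z (e : R) : 0 < e -> exists2 d, 0 < d &
  forall q, mdist (Some z : sphere R) q < d -> exists2 w, q = Some w & cabs (z - w) < e.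
Proof.
move=> e0; pose B := 1 + cabs z; have B1 : 1 <= B by rewrite lerDl cabs_ge0.
have B0 : 0 < B by apply: lt_le_trans B1.
(* The first bound excludes infinity and absorbs the growth of [jap w] in |z - w|; the second leaves
   |z - w| < e. *)
pose d := Num.min B^-1 (e / B ^+ 2).
have d0 : 0 < d by rewrite lt_min invr_gt0 B0 divr_gt0// exprn_gt0.
have dB : d * B <= 1 by rewrite -ler_pdivlMr// div1r ge_min lexx.
have dB2 : d * B ^+ 2 <= e by rewrite -ler_pdivlMr ?exprn_gt0// ge_min lexx orbT.
exists d => // -[w|] /(le_lt_trans (chord_le_mdist _ _)).
  rewrite chord_SomeE => h; exists w => //; move: h.
  rewrite ltr_pdivrMr ?mulr_gt0 ?jap_gt0// => h.
  have jz : jap z <= B := jap_le z.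
  have jw : jap w <= B + cabs (z - w).
    apply: le_trans (jap_le w) _; rewrite /B -addrA lerD2l.
    by have := cabsB z (z - w); rewrite subKr; lra.
  have : jap z * jap w <= B * (B + cabs (z - w)).
    by apply: ler_pM; rewrite ?(ltW (jap_gt0 _)).
  have z0 := cabs_ge0 (z - w).
  have : d * B * cabs (z - w) <= cabs (z - w) by rewrite ler_piMl.
  nra.
rewrite chordC chord_NoneE ltr_pdivrMr ?jap_gt0//.
have : d * jap z <= d * B by rewrite ler_wpM2l ?jap_le// ltW.
lra.
Qed.

End chordal.

(** * The coding of the Julia set *)

Section coding_of_quad.
Context {R : realType}.
Local Notation C := (Rcomplex R).
Implicit Types (z w : C) (l : nat -> C) (x y : nat -> bool).

Lemma ln_sub_le (a b : R) : 0 < a -> 0 < b -> ln a - ln b <= (a - b) / b.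
Proof.
move=> a0 b0; rewrite -ler_expR expRB !lnK ?posrE//.
apply: le_trans (expR_ge1Dx _); rewrite mulrBl divff ?gt_eqF//; lra.
Qed.

Lemma geometric_backward_le n (q : R) : 0 < q < 1 ->
  \sum_(0 <= k < n) q ^+ (n - k) <= q / (1 - q).
Proof.
move=> /andP[q0 q1]; have q10 : 0 < 1 - q by rewrite subr_gt0.
elim: n => [|n IH]; first by rewrite big_geq// divr_ge0 ?ltW.
rewrite big_nat_recr//= subSnn expr1.
have -> : \sum_(0 <= k < n) q ^+ (n.+1 - k) = q * \sum_(0 <= k < n) q ^+ (n - k).
  by rewrite mulr_sumr; apply: eq_big_nat => k /andP[_ kn]; rewrite subSn ?exprS// ltnW.
apply: (@le_trans _ _ (q * (q / (1 - q)) + q)); first by rewrite lerD2r ler_pM2l.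
by rewrite le_eqVlt; apply/orP/or_introl/eqP; field; exact: lt0r_neq0.
Qed.

(** Source of bounded distortion: the differences decay geometrically backwards from time [n], with
    total at most 4/31. The one-sided form lets each direction be proved from its own upper bound on
    differences. *)
Lemma sum_ln_le (u a b : nat -> R) n : (forall k, 0 < u k) ->
  (forall k, (k < n)%N -> 7 / 8 <= a k /\ 7 / 8 <= b k) ->
  (forall k, (k < n)%N -> a k - b k <= 3 * 32^-1 ^+ (n - k)) ->
  \sum_(0 <= k < n) ln (u k * a k) <= \sum_(0 <= k < n) ln (u k * b k) + 1.
Proof.
move=> u0 ab d; rewrite -lerBlDl -sumrB.
apply: (@le_trans _ _ (\sum_(0 <= k < n) 4 * 32^-1 ^+ (n - k))).
  apply: ler_sum_nat => k /andP[_ kn]; have [ak bk] := ab k kn.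
  have a0 : 0 < a k by apply: lt_le_trans ak.
  have b0 : 0 < b k by apply: lt_le_trans bk.
  rewrite !lnM ?posrE// opprD addrACA subrr add0r.
  apply: le_trans (ln_sub_le a0 b0) _; rewrite ler_pdivrMr//.
  have := d k kn; have : 0 <= (32^-1 : R) ^+ (n - k) by rewrite exprn_ge0.
  nra.
have q01 : 0 < (32^-1 : R) < 1 by lra.
have q31 : (32^-1 : R) / (1 - 32^-1) = 31^-1.
  by apply: (canLR (mulfK _)); lra.
rewrite -mulr_sumr; have := geometric_backward_le n q01; rewrite q31; lra.
Qed.

Definition code_point l x : C := xget 0 [set z | coded l x z].

Lemma code_pointP l x : (forall k, 40 <= cabs (l k)) -> coded l x (code_point l x).
Proof. by move=> l40; apply: (@xgetPex _ 0 [set z | coded l x z]); exact: coded_exists. Qed.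

(** Since [fquad tau] has derivative tau z, this is log |(f^n)'(z)| for the planar metric. *)
Definition orb_lexp l z n : R := \sum_(0 <= k < n) ln (cabs (l k) * cabs (orb l z k)).

(** An exact substitute for the mean value theorem: the difference quotient of a quadratic map is
    its derivative at the midpoint. *)
Lemma orb_sub_prod l z w n : cabs (orb l z n - orb l w n) =
  cabs (z - w) * \prod_(0 <= k < n) (cabs (l k) * (cabs (orb l z k + orb l w k) / 2)).
Proof.
elim: n => [|n IH]; first by rewrite big_geq// mulr1.
rewrite big_nat_recr//= norm_fquad_sub IH; ring.
Qed.

Section fixed_sequence.
Variables (l : nat -> C) (M : R).
Hypotheses (l40 : forall k, 40 <= cabs (l k)) (lM : forall k, cabs (l k) <= M).

Let l0 k : 0 < cabs (l k). Proof. exact: lt_le_trans (l40 k). Qed.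

Lemma orb_lexpS_lo x z n : coded l x z -> orb_lexp l z n + ln 36 <= orb_lexp l z n.+1.
Proof.
move=> zx; rewrite /orb_lexp big_nat_recr//= lerD2l.
have z9 := coded_ge n l40 zx; have z0 : 0 < cabs (orb l z n) by apply: lt_le_trans z9.
rewrite ler_ln ?posrE ?mulr_gt0//; have := l40 n; nra.
Qed.

Lemma orb_lexpS_hi x z n : coded l x z -> orb_lexp l z n.+1 <= orb_lexp l z n + ln (2 * M).
Proof.
move=> zx; rewrite /orb_lexp big_nat_recr//= lerD2l.
have z9 := coded_ge n l40 zx; have z0 : 0 < cabs (orb l z n) by apply: lt_le_trans z9.
have M0 : 0 < M by apply: lt_le_trans (lM 0%N).
rewrite ler_ln ?posrE ?mulr_gt0//; have := (zx n).1; have := lM n; have := l0 n; nra.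
Qed.

Lemma coded_avg_ge x y z w k : coded l x z -> coded l y w -> x k = y k ->
  7 / 8 <= cabs (orb l z k + orb l w k) / 2.
Proof.
move=> zx wy xy; have := (wy k).2; rewrite -xy => wk.
have := norm_addl_sgc (zx k).2 wk; lra.
Qed.

Lemma orb_lexp_distortion x y z w n : coded l x z -> coded l y w -> agree n x y ->
  orb_lexp l z n <= orb_lexp l w n + 1.
Proof.
move=> zx wy xy; apply: sum_ln_le => //.
  move=> k kn; have := coded_ge k l40 zx; have := coded_ge k l40 wy; lra.
move=> k kn; have := coded_contract (k := k) (j := (n - k)%N) l40 zx wy.
rewrite subnKC 1?ltnW// => /(_ xy); have := cabs_subr_ge (orb l z k) (orb l w k); lra.
Qed.

(** [S] is the logarithm of the exact expansion in [orb_sub_prod]; midpoints are as close to the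
    orbit as the two orbits are to each other, so [S] is within 1 of [orb_lexp l z n]. *)
Lemma orb_dist x y z w n : coded l x z -> coded l y w -> agree n x y ->
  cabs (z - w) <= expR (1 - orb_lexp l z n) * cabs (orb l z n - orb l w n) /\
  expR (- 1 - orb_lexp l z n) * cabs (orb l z n - orb l w n) <= cabs (z - w).
Proof.
move=> zx wy xy.
pose S := \sum_(0 <= k < n) ln (cabs (l k) * (cabs (orb l z k + orb l w k) / 2)).
have avg k : (k < n)%N -> 7 / 8 <= cabs (orb l z k + orb l w k) / 2.
  by move=> kn; apply: coded_avg_ge zx wy _; exact: xy.
have near k : (k < n)%N -> cabs (orb l z k - orb l w k) <= 3 * 32^-1 ^+ (n - k).
  by move=> kn; apply: coded_contract l40 zx wy _; rewrite subnKC// ltnW.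
have E : cabs (orb l z n - orb l w n) = cabs (z - w) * expR S.
  rewrite orb_sub_prod /S expR_sum; congr (_ * _); apply: eq_big_nat => k /andP[_ kn].
  rewrite lnK// posrE mulr_gt0//; exact: lt_le_trans (avg k kn).
have ab k : (k < n)%N -> 7 / 8 <= cabs (orb l z k + orb l w k) / 2 /\ 7 / 8 <= cabs (orb l z k).
  by move=> kn; split; [exact: avg|have := coded_ge k l40 zx; lra].
have h1 : S <= orb_lexp l z n + 1.
  apply: sum_ln_le => // k kn; have := near k kn.
  have := cabsB (2 * orb l z k) (orb l z k - orb l w k).
  have -> : 2 * orb l z k - (orb l z k - orb l w k) = orb l z k + orb l w k by ring.
  rewrite cabsM cabs_nat; have := cabs_ge0 (orb l z k - orb l w k); lra.
have h2 : orb_lexp l z n <= S + 1.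
  apply: sum_ln_le => // k kn; first by have [] := ab k kn.
  have := near k kn; have := cabsD (orb l z k + orb l w k) (orb l z k - orb l w k).
  have -> : orb l z k + orb l w k + (orb l z k - orb l w k) = 2 * orb l z k by ring.
  rewrite cabsM cabs_nat; have := cabs_ge0 (orb l z k - orb l w k); lra.
rewrite E; have zw0 := cabs_ge0 (z - w); split.
  rewrite mulrCA -expRD ler_peMr// leNgt expR_lt1 -leNgt; lra.
rewrite mulrCA -expRD ler_piMr// expR_le1; lra.
Qed.

Local Notation p := (fun x => Some (code_point l x) : sphere R).
Local Notation K := (1 + ln 14 : R).

(** Origin of 14: it exceeds 6 (11/5), from the bound 6 |z - w| for the spherical distance; the
    lower estimate needs only (7/4) / 3 >= 1/14. *)
Lemma quad_coding_mdist_le n x y : agree n x y ->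
  mdist (p x) (p y) <= expR (K - orb_lexp l (code_point l x) n).
Proof.
move=> xy; have zx := code_pointP x l40; have wy := code_pointP y l40.
apply: le_trans (mdist_Some_le _ _) _.
have [h _] := orb_dist zx wy xy; have := expR_ge0 (1 - orb_lexp l (code_point l x) n) => e0.
rewrite addrAC expRD lnK ?posrE//.
have := cabsB (orb l (code_point l x) n) (orb l (code_point l y) n).
have := (zx n).1; have := (wy n).1; nra.
Qed.

Lemma quad_coding_mdist_ge n x y : agree n x y -> x n != y n ->
  expR (- K - orb_lexp l (code_point l x) n) <= mdist (p x) (p y).
Proof.
move=> xy xyn; have zx := code_pointP x l40; have wy := code_pointP y l40.
have [_ h] := orb_dist zx wy xy; have := expR_ge0 (- 1 - orb_lexp l (code_point l x) n) => e0.
rewrite opprD addrAC expRD expRN lnK ?posrE//.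
have := norm_sub_sgc xyn (zx n).2 (wy n).2.
have := mdist_Some_ge (zx 0%N).1 (wy 0%N).1; rewrite /=; nra.
Qed.

(** At time [n] the two points have the same code for the shifted maps, hence they coincide. *)
Lemma quad_coding_tail n N x y : (n <= N)%N -> (forall k, (n <= k)%N -> x k = y k) ->
  orb_lexp l (code_point l x) N - orb_lexp l (code_point l x) n =
  orb_lexp l (code_point l y) N - orb_lexp l (code_point l y) n.
Proof.
move=> nN xy; have zx := code_pointP x l40; have wy := code_pointP y l40.
have E : orb l (code_point l x) n = orb l (code_point l y) n.
  apply: (@coded_inj _ (shift_seq n l) (fun k => x (n + k)%N)) => [k||].
  - exact: l40.
  - exact: coded_shift.
  - have -> : (fun k => x (n + k)%N) = (fun k => y (n + k)%N).
      by apply/funext => k; rewrite xy// leq_addr.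
    exact: coded_shift.
rewrite /orb_lexp !(big_cat_nat (leq0n n) nN)/= !(addrC (\sum_(0 <= k < n) _)) !addrK.
by apply: eq_big_nat => k /andP[nk _]; rewrite -(subnKC nk) !orb_shift E.
Qed.

Definition quad_coding : coding (sphere R).
Proof.
refine (@Coding R (sphere R) (fun x => Some (code_point l x))
  (fun n x => orb_lexp l (code_point l x) n) (ln 36) (ln (2 * M)) K _ _ _ _ _ _ _ _ _).
- by rewrite ln_gt0// ltr1n.
- by rewrite addr_ge0// ln_ge0// ler1n.
- by move=> x; rewrite /orb_lexp big_geq.
- by move=> n x; exact: orb_lexpS_lo (code_pointP x l40).
- by move=> n x; exact: orb_lexpS_hi (code_pointP x l40).
- by move=> n N x y; exact: quad_coding_tail.
- move=> n x y xy; apply: le_trans (orb_lexp_distortion (code_pointP x l40) (code_pointP y l40) xy) _.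
  by rewrite lerD2l lerDl ln_ge0// ler1n.
- exact: quad_coding_mdist_le.
- exact: quad_coding_mdist_ge.
Defined.

End fixed_sequence.

End coding_of_quad.

(** * Identification of the Julia set with the coded set *)

Section julia.
Context {R : realType}.
Local Notation C := (Rcomplex R).
Implicit Types (z w : C) (l : nat -> C) (x y : nat -> bool) (p q : sphere R).

Lemma compact_cvgP (U : set (sphere R)) (F : nat -> sphere R -> sphere R) g :
  {family compactly_in U, F @ \oo --> g} <->
  forall A, A `<=` U -> compact A -> forall e, 0 < e ->
    exists N, forall n, (N <= n)%N -> forall q, A q -> mdist (g q) (F n q) < e.
Proof.
split.
  move=> /fam_cvgP cvF A AU cA e e0.
  have /cvF /(_ [set h | forall q, A q -> mdist (g q) (h q) < e]) : compactly_in U A by split.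
  case.
    apply/uniform_nbhs; exists [set pq | mdist pq.1 pq.2 < e]; split => //.
    rewrite -entourage_ballE; exists e => //= -[a b] /=; by rewrite ballEmdist.
  by move=> N _ NP; exists N => n /NP.
move=> cvF; apply/fam_cvgP => A [AU cA] P /uniform_nbhs[E [entE EP]].
move: entE; rewrite -entourage_ballE => -[e /= e0 eE].
have [N NP] := cvF A AU cA e e0; exists N => // n /= Nn; apply: EP => q Aq.
by apply: eE; rewrite /= ballEmdist; exact: NP.
Qed.

(** The growth factor is always at least 2, so that the latest block fills half of its end level,
    and it is unbounded, so that the blocks become negligible before the next one starts. *)
Lemma sparse_sequence (P : nat -> nat -> Prop) :
  (forall j N, exists2 n, (N <= n)%N & P j n) ->
  exists nn : nat -> nat, (forall j, (j.+2 * nn j < nn j.+1)%N) /\ forall j, P j (nn j).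
Proof.
move=> PP.
have step jN : exists n, (jN.2 <= n)%N /\ P jN.1 n.
  by have [n Nn Pn] := PP jN.1 jN.2; exists n.
have [nx nxP] := choice step.
pose nn := fix nn j := if j is i.+1 then nx (j, (i.+2 * nn i).+1) else nx (0%N, 0%N).
exists nn; split=> [j|[|j]].
- exact: (nxP (j.+1, (j.+2 * nn j).+1)).1.
- exact: (nxP (0%N, 0%N)).2.
- exact: (nxP (j.+1, (j.+2 * nn j).+1)).2.
Qed.

Lemma sparse_homo (nn : nat -> nat) : (forall j, (j.+2 * nn j < nn j.+1)%N) ->
  {homo nn : i j / (i < j)%N}.
Proof.
move=> nnS; apply: homo_ltn => [j i k|j]; first exact: ltn_trans.
by apply: leq_ltn_trans (nnS j); rewrite leq_pmull.
Qed.

Lemma homo_ltn_ge (k : nat -> nat) : {homo k : m n / (m < n)%N} -> forall m, (m <= k m)%N.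
Proof. by move=> kh; elim=> // m IH; apply: leq_ltn_trans IH (kh _ _ (ltnSn m)). Qed.

Section fixed_sequence.
Variables (l : nat -> C) (M : R).
Hypotheses (l40 : forall k, 40 <= cabs (l k)) (lM : forall k, cabs (l k) <= M).

Lemma iter_quad_lipschitz n : exists2 A, 0 < A &
  forall p q, mdist (iter_seq quad l n p) (iter_seq quad l n q) <= A * mdist p q.
Proof.
elim: n => [|n [A A0 IH]]; first by exists 1 => // p q; rewrite mul1r.
have l0 : 0 < cabs (l n) by apply: lt_le_trans (l40 n).
exists (15 * cabs (l n) * A); first by rewrite !mulr_gt0.
move=> p q /=; apply: le_trans (mdist_quad _ _ (l40 n)) _.
by rewrite -[leRHS]mulrA ler_wpM2l ?mulr_ge0 ?cabs_ge0.
Qed.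

Definition far (r : R) q : Prop := if q is Some z then r < cabs z else True.

Lemma far_near r q : 0 < r -> far r q ->
  exists2 d, 0 < d & forall q', mdist q q' < d -> far r q'.
Proof.
move=> r0; case: q => [z|] /= zq.
  have [|d d0 dP] := @near_Some _ z (cabs z - r); first by rewrite subr_gt0.
  exists d => // q' /dP[w -> zw] /=; have := cabs_subr_ge z w; lra.
have r1 : 0 < 1 + r by lra.
exists (2 / (1 + r)); first by rewrite divr_gt0.
move=> [w|]//= /(le_lt_trans (chord_le_mdist _ _)); rewrite chord_NoneE.
rewrite ltr_pM2l// ltf_pV2 ?posrE ?jap_gt0// => h.
have := jap_le w; lra.
Qed.

Lemma far_quad r tau q : 40 <= cabs tau -> 11 / 10 <= r -> far r q -> far (2 * r) (quad tau q).
Proof.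
move=> t40 r1; case: q => [z|] //= zr; rewrite -/(fquad tau z).
have := @fquad_escape _ tau z t40; lra.
Qed.

Lemma far_iter m q : far (11 / 10) (iter_seq quad l m q) ->
  forall j, far (11 / 10 * 2 ^+ j) (iter_seq quad l (m + j) q).
Proof.
move=> mq; elim=> [|j IH]; first by rewrite addn0 expr0 mulr1.
rewrite addnS exprS mulrCA; apply: far_quad IH => //.
by rewrite ler_peMr ?exprn_ege1//; lra.
Qed.

Lemma far_mdist (r : R) q : 0 < r -> far r q -> mdist (None : sphere R) q <= 6 / r.
Proof.
move=> r0; case: q => [z|] /= zr; last by rewrite mdistxx divr_ge0// ltW.
apply: le_trans (mdist_None_le z) _; rewrite ler_pM2l//.
by rewrite lef_pV2 ?posrE ?jap_gt0// (le_trans (ltW zr))// jap_ge.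
Qed.

Definition escapes_by m : set (sphere R) := [set q | far (11 / 10) (iter_seq quad l m q)].

Lemma escapes_by_open m : open (escapes_by m).
Proof.
rewrite openE => q mq; have [|d d0 dP] := far_near _ mq; first by lra.
have [A A0 AP] := iter_quad_lipschitz m.
rewrite /interior -nbhs_ballE; exists (d / A) => /=; first by rewrite divr_gt0.
move=> q'; rewrite ballEmdist/= => qq'; apply: dP; apply: le_lt_trans (AP _ _) _.
by rewrite mulrC -ltr_pdivlMr.
Qed.

(** A sequence of indices either takes one value infinitely often, giving a constant subsequence, or
    tends to infinity; then escape doubles the modulus at each step and the limit is infinity,
    uniformly. *)
Lemma escapes_by_normal m : normal_on (iter_seq quad l) (escapes_by m).
Proof.
move=> u; have [[c cP]|no] := pselect (exists c, forall N, exists2 n, (N <= n)%N & u n = c).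
  have [k [k_sparse kP]] := @sparse_sequence (fun _ n => u n = c) (fun _ => cP).
  exists k, (iter_seq quad l c); split; first exact: sparse_homo.
  apply/compact_cvgP => A _ _ e e0; exists 0 => n _ q _.
  by rewrite kP mdistxx.
have u_infty B : exists N, forall n, (N <= n)%N -> (B <= u n)%N.
  elim: B => [|B [N NP]]; first by exists 0.
  have : ~ (forall N, exists2 n, (N <= n)%N & u n = B) by move=> h; apply: no; exists B.
  move=> /existsNP[N' N'P]; exists (maxn N N') => n; rewrite geq_max => /andP[Nn N'n].
  rewrite ltn_neqAle NP// andbT eq_sym; apply/negP => /eqP uB; apply: N'P; by exists n.
exists id, (fun=> None : sphere R); split => //.
apply/compact_cvgP => A AU _ e e0.
have ln2 : 0 < ln (2 : R) by rewrite ln_gt0// ltr1n.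
have [j0 jP] := expR_small (ln 12) ln2 e0.
have [N NP] := u_infty (m + j0)%N; exists N => n Nn q Aq.
have un : u n = (m + (u n - m))%N by rewrite subnKC// (leq_trans _ (NP n Nn))// leq_addr.
have ju : (j0 <= u n - m)%N by rewrite leq_subRL ?NP// (leq_trans _ (NP n Nn))// leq_addr.
have := far_iter (AU _ Aq) (u n - m); rewrite -un => /far_mdist h.
apply: le_lt_trans (h _) _; first by rewrite mulr_gt0// ?exprn_gt0//; lra.
apply: lt_le_trans (jP _ ju); rewrite expRB expRM_natl !lnK ?posrE//.
rewrite invfM mulrA ltr_pM2r ?invr_gt0 ?exprn_gt0//; lra.
Qed.

Lemma flip_symbol x j : exists y,
  agree j x y /\ 1 / 2 <= mdist (Some (orb l (code_point l x) j) : sphere R) (Some (orb l (code_point l y) j)).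
Proof.
exists (fun k => if k == j then ~~ x k else x k); split.
  by move=> k kj; rewrite ltn_eqF.
set y := fun k => _.
have zx := code_pointP x l40; have wy := code_pointP y l40.
have xy : x j != y j by rewrite /y eqxx; case: (x j).
have := norm_sub_sgc xy (zx j).2 (wy j).2.
have := mdist_Some_ge (zx j).1 (wy j).1; lra.
Qed.

(** Normality is tested on compact subsets; rectangles are compact neighbourhoods of the finite
    points, as images of products of segments. *)
Definition rectangle z (r : R) : set (sphere R) :=
  [set q | exists2 w, q = Some w & `|complex.Re z - complex.Re w| <= r /\
                                   `|complex.Im z - complex.Im w| <= r].

Lemma rectangle_compact z (r : R) : compact (rectangle z r).
Proof.
pose f (ab : R * R) : sphere R := Some (Complex ab.1 ab.2).
have -> : rectangle z r =
  f @` (`[complex.Re z - r, complex.Re z + r] `*` `[complex.Im z - r, complex.Im z + r]).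
  apply/seteqP; split => [_ [[a b] -> /= [ha hb]]|_ [[a b] /= [ha hb] <-]].
    exists (a, b) => //=; rewrite !in_itv/=; move: ha hb; rewrite !ler_norml => /andP[? ?] /andP[? ?].
    by split; apply/andP; split; lra.
  exists (Complex a b) => //=; move: ha hb; rewrite !in_itv/= => /andP[? ?] /andP[? ?].
  by rewrite !ler_norml; split; apply/andP; split; lra.
apply: continuous_compact; last by apply: compact_setX; exact: segment_compact.
apply: continuous_subspaceT => -[a b]; apply/metricType_numDomainType.cvgrPdist_lt => e e0.
have e24 : 0 < e / 24 by rewrite divr_gt0.
exists (ball a (e / 24), ball b (e / 24)); first by split; exact: nbhsx_ballx.
move=> [a' b'] /= [aa' bb']; apply: le_lt_trans (mdist_Some_le _ _) _.
have := cabs_le_ReIm (Complex a b - Complex a' b' : C); rewrite ReB ImB/=.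
move: aa' bb'; rewrite /ball/= => aa' bb'; lra.
Qed.

(** Sensitive dependence: flipping a late symbol gives a point [w] very near [z] whose image at that
    time is 1/2 away. A uniform limit [g] forbids this, because one fixed iterate, being Lipschitz,
    shows that [g] almost agrees at [z] and [w]. *)
Lemma code_point_in_julia x : julia_set quad l (Some (code_point l x)).
Proof.
move=> [U [oU Ux] nU]; have zx := code_pointP x l40; set z := code_point l x in Ux zx.
have [d d0 dU] : exists2 d, 0 < d & forall q, mdist (Some z : sphere R) q < d -> U q.
  have : nbhs (Some z : sphere R) U by exact: open_nbhs_nbhs.
  rewrite -nbhs_ballE => -[d /= d0 dU]; exists d => // q zq; exact: dU.
have [k [g [k_homo]]] := nU id.
move=> /compact_cvgP cvF.
have AU : rectangle z (d / 24) `<=` U.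
  move=> _ [w -> [h1 h2]]; apply: dU; apply: le_lt_trans (mdist_Some_le _ _) _.
  by have := cabs_le_ReIm (z - w); rewrite ReB ImB; lra.
(* The final triangle inequalities use four errors of 1/20 and one of 1/100, in total less than
   1/2. *)
have e20 : 0 < (1 / 20 : R) by lra.
have [N NP] := cvF _ AU (@rectangle_compact z (d / 24)) _ e20.
have [B B0 BP] := iter_quad_lipschitz (k N).
(* As [mdist] is at most 6 |z - w|, |z - w| <= 1 / (600 B) keeps the images under the fixed iterate
   within 1/100. *)
have [c c0 cE] : exists2 c : R, 0 < c & c = 1 / 600 by exists (1 / 600); lra.
pose e := Num.min (d / 24) (c / B).
have e0 : 0 < e by rewrite lt_min !divr_gt0.
have ln32 : 0 < ln (32 : R) by rewrite ln_gt0// ltr1n.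
have [j0 jP] := expR_small (ln 3) ln32 e0.
pose n := maxn N j0; pose j := k n.
have jj0 : (j0 <= j)%N by apply: leq_trans (homo_ltn_ge k_homo n); exact: leq_maxr.
have [y [xy far_xy]] := flip_symbol x j.
have wy := code_pointP y l40; set w := code_point l y in wy far_xy.
have zw : cabs (z - w) <= e.
  have := coded_contract (k := 0) (j := j) l40 zx wy xy => /=.
  have := jP j jj0; rewrite expRB expRM_natl !lnK ?posrE// -exprVn; lra.
have [ed eB] : e <= d / 24 /\ e * B <= c.
  by split; [rewrite ge_min lexx|rewrite -ler_pdivlMr// ge_min lexx orbT].
have Aw : rectangle z (d / 24) (Some w).
  exists w => //; have := cabs_ge_Re (z - w); have := cabs_ge_Im (z - w).
  by rewrite ReB ImB; lra.
have Az : rectangle z (d / 24) (Some z).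
  by exists z => //; rewrite !subrr normr0; split; rewrite divr_ge0// ltW.
have nN : (N <= n)%N by exact: leq_maxl.
have h1 := NP N (leqnn _) _ Aw; have h2 := NP N (leqnn _) _ Az.
have h3 := NP n nN _ Aw; have h4 := NP n nN _ Az.
have h5 := BP (Some z) (Some w).
have h6 := mdist_Some_le z w.
have h7 : B * mdist (Some z : sphere R) (Some w) <= 1 / 100.
  have : B * mdist (Some z : sphere R) (Some w) <= B * (6 * e) by rewrite ler_wpM2l ?(ltW B0)//; lra.
  lra.
rewrite -/j !iter_quad in h3 h4; rewrite !iter_quad in h1 h2 h5.
have t1 := metric_triangle (Some (orb l z j) : sphere R) (g (Some z)) (Some (orb l w j)).
have t2 := metric_triangle (g (Some z)) (g (Some w)) (Some (orb l w j)).
have t3 := metric_triangle (g (Some z)) (Some (orb l z (k N)) : sphere R) (g (Some w)).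
have t4 := metric_triangle (Some (orb l z (k N)) : sphere R) (Some (orb l w (k N))) (g (Some w)).
rewrite (metric_sym _ (g (Some z))) in t1.
rewrite (metric_sym (Some (orb l w (k N)) : sphere R)) in t4.
lra.
Qed.

(** The sets [escapes_by m] are open and normal, so a point of the Julia set has a bounded orbit,
    and the signs of its real parts code it. *)
Lemma julia_setE : julia_set quad l = range (point_of (quad_coding l40 lM)).
Proof.
apply/seteqP; split=> [q jq|_ [x _ <-]]; last exact: code_point_in_julia.
have nescape m : ~ escapes_by m q.
  move=> mq; apply: jq; exists (escapes_by m); last exact: escapes_by_normal.
  by split => //; exact: escapes_by_open.
case: q jq nescape => [z|] jq nescape; last by have := nescape 0%N; case.
have zb k : cabs (orb l z k) <= 11 / 10.
  by rewrite leNgt; apply/negP => h; apply: (nescape k); rewrite /escapes_by/= iter_quad.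
have zx := bounded_coded l40 zb.
eexists; first exact: I.
by congr Some; exact: coded_inj l40 (code_pointP _ l40) zx.
Qed.

End fixed_sequence.
End julia.

(** * Spherical derivatives and hyperbolicity *)

Section spherical_derivative.
Context {R : realType}.
Local Notation C := (Rcomplex R).
Implicit Types (z w : C) (p q : sphere R).

(** The value 1 on the diagonal makes the ratio continuous there, so limits of [mdist] quotients
    reduce to chords. *)
Definition mdist_chord_ratio p q : R := if p == q then 1 else mdist p q / chord p q.

Lemma chord_gt0 p q : p != q -> 0 < chord p q.
Proof.
move=> pq; have : 0 < mdist p q by rewrite mdist_gt0.
have := mdist_le_3chord p q; lra.
Qed.

Lemma mdistE_chord p q : mdist p q = chord p q * mdist_chord_ratio p q.
Proof.
rewrite /mdist_chord_ratio; have [->|pq] := eqVneq p q.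
  by rewrite chord_xx mdistxx mul0r.
by rewrite mulrCA divff ?mulr1// gt_eqF// chord_gt0.
Qed.

Lemma mdist_chord_ratio_near1 p q : mdist p q <= 1 ->
  `|1 - mdist_chord_ratio p q| <= mdist p q.
Proof.
move=> d1; rewrite /mdist_chord_ratio; have [->|pq] := eqVneq p q.
  by rewrite subrr normr0 mdistxx.
have c0 := chord_gt0 pq; have cd := chord_le_mdist p q; have h := mdist_le_chord p q.
have r1 : 1 <= mdist p q / chord p q by rewrite ler_pdivlMr ?mul1r.
rewrite ler0_norm ?subr_le0// opprB lerBlDr ler_pdivrMr//; nra.
Qed.

(** Finite points are not isolated, so the [lim] in [spherical_deriv] is determined by a
    convergence. *)
Lemma dnbhs_sphere_proper z : ProperFilter ((Some z : sphere R)^').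
Proof.
apply: Build_ProperFilter_ex => P /nbhs_ballP[e /= e0 eP].
pose w : C := z + Complex (e / 12) 0.
have zw : z - w = - Complex (e / 12) 0 by rewrite /w opprD addrA subrr add0r.
have e12 : 0 < e / 12 by rewrite divr_gt0.
exists (Some w); apply: (eP (Some w)).
  rewrite ballEmdist/=; apply: le_lt_trans (mdist_Some_le _ _) _.
  rewrite zw cabsN; have := cabs_le_ReIm (Complex (e / 12) 0).
  by rewrite /= normr0 gtr0_norm//; lra.
apply/eqP => -[] /eqP; rewrite -subr_eq0 -opprB zw opprK => /eqP[] /eqP.
by rewrite gt_eqF.
Qed.

Definition affine_part q : C := if q is Some z then z else 0.

Section fixed_sequence.
Variables (l : nat -> C).
Hypotheses (l40 : forall k, 40 <= cabs (l k)).

Lemma iter_quad_near n p (e : R) : 0 < e ->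
  \forall q \near p, mdist (iter_seq quad l n q) (iter_seq quad l n p) < e.
Proof.
move=> e0; have [A A0 AP] := iter_quad_lipschitz l40 n.
apply/nbhs_ballP; exists (e / A) => /=; first by rewrite divr_gt0.
move=> q; rewrite ballEmdist/= => pq; apply: le_lt_trans (AP _ _) _.
by rewrite metric_sym mulrC -ltr_pdivlMr.
Qed.

Lemma orb_near n p z (e : R) : p = Some z -> 0 < e -> \forall q \near p,
  [/\ exists w, q = Some w & cabs (orb l z n - orb l (affine_part q) n) < e].
Proof.
move=> pz e0; have [d d0 dP] := near_Some (orb l z n) e0.
have [d' d'0 d'P] := near_Some z (@ltr01 R).
have h1 := iter_quad_near n p d0.
have h2 := iter_quad_near 0 p d'0.
apply: filterS2 h1 h2 => q /= + zq; rewrite pz metric_sym in zq *.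
have [w -> _] := d'P _ zq; rewrite !iter_quad metric_sym => /dP[_ [<-]] zw.
by split => //; exists w.
Qed.

Lemma jap_lip z w : jap z <= jap w + cabs (z - w).
Proof.
rewrite -ler_sqr ?nnegrE ?addr_ge0 ?sqrtr_ge0 ?cabs_ge0// sqrrD !jap_sqr.
have zw : cabs z <= cabs w + cabs (z - w) by have := cabsD w (z - w); rewrite addrC subrK.
have := jap_ge w; have := cabs_ge0 w; have := cabs_ge0 z; have := cabs_ge0 (z - w).
rewrite mulr2n; nra.
Qed.

Lemma jap_orb_cvg n p z : p = Some z -> jap (orb l (affine_part q) n) @[q --> nbhs p] -->
  jap (orb l z n).
Proof.
move=> pz; apply/cvgrPdist_lt => e e0; apply: filterS (orb_near n pz e0) => q [_].
set a := orb l z n; set b := orb l _ n => ab; rewrite ltr_norml.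
have := jap_lip a b; have := jap_lip b a; rewrite (cabsBC b a); lra.
Qed.

Lemma avg_orb_cvg n p z : p = Some z ->
  cabs (orb l (affine_part q) n + orb l z n) / 2 @[q --> nbhs p] -->
  cabs (orb l z n).
Proof.
move=> pz; apply/cvgrPdist_lt => e e0; apply: filterS (orb_near n pz e0) => q [_].
set a := orb l z n; set b := orb l _ n => ab; rewrite ltr_norml.
have := cabsB (2 * a) (a - b); have := cabsD (b + a) (a - b).
have -> : 2 * a - (a - b) = b + a by ring.
have -> : b + a + (a - b) = 2 * a by ring.
rewrite cabsM cabs_nat; have := cabs_ge0 (a - b); lra.
Qed.

Lemma prod_orb_cvg n p z : p = Some z ->
  \prod_(0 <= k < n) (cabs (l k) * (cabs (orb l (affine_part q) k + orb l z k) / 2))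
    @[q --> nbhs p] -->
  \prod_(0 <= k < n) (cabs (l k) * cabs (orb l z k)).
Proof.
move=> pz; elim: n => [|n IH].
  rewrite big_geq// (_ : (fun _ => _) = cst 1); first exact: cvg_cst.
  by apply/funext => q; rewrite big_geq.
rewrite big_nat_recr//=.
rewrite (_ : (fun q => _) = (fun q => \prod_(0 <= k < n) (cabs (l k) *
   (cabs (orb l (affine_part q) k + orb l z k) / 2)) *
   (cabs (l n) * (cabs (orb l (affine_part q) n + orb l z n) / 2)))); last first.
  by apply/funext => q; rewrite big_nat_recr.
apply: cvgM => //; apply: cvgM; first exact: cvg_cst.
exact: avg_orb_cvg pz.
Qed.

Lemma ratio_cvg n p :
  mdist_chord_ratio (iter_seq quad l n q) (iter_seq quad l n p) @[q --> nbhs p] --> (1 : R).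
Proof.
apply/cvgrPdist_lt => e e0.
have m0 : 0 < Num.min 1 e by rewrite lt_min ltr01.
apply: filterS (iter_quad_near n p m0) => q /=; rewrite lt_min => /andP[h1 he].
apply: le_lt_trans he; exact/mdist_chord_ratio_near1/ltW.
Qed.

(** Chords turn the difference quotient into the explicit product of [orb_sub_prod] and a quotient
    of brackets, which expresses the change from the planar to the spherical metric; the ratios of
    distance to chord tend to 1. *)
Lemma spherical_deriv_iter n z : (forall k, orb l z k != 0) ->
  spherical_deriv (iter_seq quad l n) (Some z) =
  \prod_(0 <= k < n) (cabs (l k) * cabs (orb l z k)) * (jap z * jap z / (jap (orb l z n) * jap (orb l z n))).
Proof.
move=> z0; apply/cvg_lim => //; first exact: dnbhs_sphere_proper.
pose ch q := \prod_(0 <= k < n) (cabs (l k) * (cabs (orb l (affine_part q) k + orb l z k) / 2))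
  * (jap (orb l (affine_part q) 0) * jap z / (jap (orb l (affine_part q) n) * jap (orb l z n))).
have [p pz] : exists p : sphere R, p = Some z by exists (Some z).
rewrite -[Some z]pz; pose f q := ch q * (mdist_chord_ratio (iter_seq quad l n q) (iter_seq quad l n p)
  / mdist_chord_ratio (iter_seq quad l 0 q) (iter_seq quad l 0 p)).
have fcvg : f @ nbhs p --> \prod_(0 <= k < n) (cabs (l k) * cabs (orb l z k)) *
    (jap z * jap z / (jap (orb l z n) * jap (orb l z n))).
  set A : R := \prod_(0 <= k < n) _ * _.
  have -> : A = A * (1 / 1) by rewrite divr1 mulr1.
  apply: cvgM; last first.
    by apply: cvgM; [exact: ratio_cvg|apply: cvgV; [rewrite oner_eq0|exact: ratio_cvg]].
  rewrite /A; apply: cvgM; first exact: prod_orb_cvg pz.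
  apply: cvgM; first by apply: cvgM; [exact: (@jap_orb_cvg 0 p z pz)|exact: cvg_cst].
  apply: cvgV; first by rewrite mulf_neq0// gt_eqF// jap_gt0.
  by apply: cvgM; [exact: (@jap_orb_cvg n p z pz)|exact: cvg_cst].
have fcvg' : f @ p^' --> \prod_(0 <= k < n) (cabs (l k) * cabs (orb l z k)) *
    (jap z * jap z / (jap (orb l z n) * jap (orb l z n))).
  by apply: cvg_trans fcvg; apply: cvg_app; exact: cvg_within.
apply: (cvg_trans _ fcvg'); apply: near_eq_cvg.
rewrite near_withinE; apply: filterS (orb_near 0 pz ltr01) => q [[w ->] _] wz.
rewrite pz in wz *; rewrite /f /ch pz !iter_quad/= [mdist _ _]mdistE_chord [X in _ = _ / X]mdistE_chord.
have wz0 : 0 < cabs (w - z).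
  by rewrite cabs_gt0 subr_eq0; apply: contra wz => /eqP ->.
rewrite !chord_SomeE (orb_sub_prod l w z n).
have := jap_gt0 w; have := jap_gt0 z; have := jap_gt0 (orb l w n); have := jap_gt0 (orb l z n).
have : mdist_chord_ratio (Some w : sphere R) (Some z) != 0.
  rewrite /mdist_chord_ratio (negbTE wz) mulf_neq0 ?invr_eq0// gt_eqF ?chord_gt0//.
  by rewrite mdist_gt0.
set r1 := mdist_chord_ratio (Some w) _; set r2 := mdist_chord_ratio _ _.
set P := \prod_(0 <= k < n) _; move: r1 r2 P => r1 r2 P.
move=> r10 /gt_eqF/negbT j1 /gt_eqF/negbT j2 /gt_eqF/negbT j3 /gt_eqF/negbT j4.
by field; rewrite r10 j1 j2 j3 j4 gt_eqF.
Qed.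

End fixed_sequence.

Lemma quad_uniformly_hyperbolic (l : nat -> C) (M : R) : (forall k, 40 <= cabs (l k)) ->
  (forall k, cabs (l k) <= M) -> uniformly_hyperbolic quad l.
Proof.
move=> l40 lM; split.
  have M0 : 0 < M by apply: lt_le_trans (lM 0%N); apply: lt_le_trans (l40 0%N).
  move=> p E; rewrite -entourage_ballE => -[e /= e0 eE].
  apply/nbhs_ballP; exists (e / (15 * M)) => /=; first by rewrite divr_gt0// mulr_gt0.
  move=> q; rewrite ballEmdist/= => pq j _; apply: eE; rewrite /= ballEmdist/=.
  apply: le_lt_trans (mdist_quad _ _ (l40 j)) _.
  apply: (@le_lt_trans _ _ (15 * M * mdist p q)).
    by rewrite ler_wpM2r ?mdist_ge0// ler_pM2l.
  by rewrite mulrC -ltr_pdivlMr// mulr_gt0.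
(* 36 is 40 (9/10); the brackets contribute at least 1/4, as jap z >= 1 and jap^2 <= 1 + (11/10)^2
   on the Julia set. *)
exists (1 / 4), 36; split => //; [by rewrite ltr1n|].
move=> j q n; have lj40 k : 40 <= cabs (shift_seq j l k) by exact: l40.
have ljM k : cabs (shift_seq j l k) <= M by exact: lM.
rewrite (julia_setE lj40 ljM) => -[x _ <-] n1 /=.
have zx := code_pointP x lj40; set z := code_point _ _ in zx *.
have z9 k := coded_ge k lj40 zx.
rewrite spherical_deriv_iter//; last first.
  by move=> k; rewrite -cabs_gt0; apply: lt_le_trans (z9 k).
rewrite mulrC; apply: ler_pM; [by rewrite exprn_ge0|by lra| |].
  elim: n {n1} => [|n IH]; first by rewrite expr0 big_geq.
  rewrite exprSr big_nat_recr//=; apply: ler_pM => //.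
  have := z9 n; have := lj40 n; have := cabs_ge0 (orb (shift_seq j l) z n); nra.
have := jap_ge1 z; have := jap_gt0 (orb (shift_seq j l) z n) => j0 z1.
rewrite ler_pdivlMr ?mulr_gt0// -!expr2 jap_sqr.
have := (zx n).1; have := cabs_ge0 (orb (shift_seq j l) z n); nra.
Qed.

End spherical_derivative.

(** * Perturbation of the dimensions along sparse blocks *)

Section thresholds.
Context {R : realType} {T : metricType R} (c : coding T).
Implicit Types (s u C : R).

Local Notation L := (lexp c).
Local Notation a := (lexp_lo c).
Local Notation b := (lexp_hi c).
Local Notation A := (range (point_of c)).

Lemma Zsum0 n : Zsum c 0 n = 2 ^+ n.
Proof.
rewrite /Zsum (eq_bigr (fun=> 1)) => [|w _]; last by rewrite mul0r oppr0 expR0.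
by rewrite big_const_seq count_predT size_words iter_addr_0 natrX.
Qed.

Lemma expR_ln2 n : expR (n%:R * ln 2) = 2 ^+ n :> R.
Proof. by rewrite expRM_natl lnK// posrE. Qed.

(** Crude bounds from Z_n(0) = 2^n and n a <= L <= n b. They make the dimensions of the coded set
    positive and finite. *)
Definition dim_lo : R := ln 2 / b.
Definition dim_hi : R := ln 2 / a.

Lemma dim_lo_gt0 : 0 < dim_lo.
Proof. by rewrite divr_gt0 ?lexp_hi_gt0// ln_gt0// ltr1n. Qed.

Lemma dim_hi_ge0 : 0 <= dim_hi.
Proof. by rewrite divr_ge0 ?ln_ge0 ?ler1n// ltW// lexp_lo_gt0. Qed.

Lemma Zsum_dim_lo n : 1 <= Zsum c dim_lo n.
Proof.
have b0 := lexp_hi_gt0 c.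
apply: le_trans (Zsum_decay_hi c n (ltW dim_lo_gt0)); rewrite Zsum0 subr0 -expR_ln2 -expRD.
have -> : - (dim_lo * (n%:R * b)) + n%:R * ln 2 = 0.
  by rewrite /dim_lo; field; exact: lt0r_neq0.
by rewrite expR0.
Qed.

Lemma Zsum_dim_hi n : Zsum c dim_hi n <= 1.
Proof.
have a0 := lexp_lo_gt0 c.
apply: le_trans (Zsum_decay c n dim_hi_ge0) _; rewrite Zsum0 subr0 -expR_ln2 -expRD.
have -> : - (dim_hi * (n%:R * a)) + n%:R * ln 2 = 0.
  by rewrite /dim_hi; field; exact: lt0r_neq0.
by rewrite expR0.
Qed.

Definition coding_HD : R := fine (hausdorff_dim A).
Definition coding_PD : R := fine (packing_dim A).

Lemma coding_HDE : hausdorff_dim A = coding_HD%:E.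
Proof.
have : (hausdorff_dim A <= dim_hi%:E)%E.
  apply: (@hausdorff_dim_le _ _ _ 1) dim_hi_ge0 _ => N.
  by exists N => //; exact: Zsum_dim_hi.
rewrite /coding_HD; have := hausdorff_dim_ge0 A.
by case: (hausdorff_dim A).
Qed.

Lemma coding_PDE : packing_dim A = coding_PD%:E.
Proof.
have : (packing_dim A <= dim_hi%:E)%E.
  by apply: (@packing_dim_le _ _ _ 1) dim_hi_ge0 _ => n; exact: Zsum_dim_hi.
rewrite /coding_PD; have := packing_dim_ge0 A.
by case: (packing_dim A).
Qed.

Lemma coding_HD_le u C : 0 <= u ->
  (forall N, exists2 n, (N <= n)%N & Zsum c u n <= C) -> coding_HD <= u.
Proof. by move=> u0 ZC; rewrite -lee_fin -coding_HDE; exact: hausdorff_dim_le ZC. Qed.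

Lemma coding_HD_ge u C N : 0 < C -> (forall n, (N <= n)%N -> C <= Zsum c u n) ->
  0 < u -> u <= coding_HD.
Proof.
move=> C0 ZC u0; rewrite -lee_fin -coding_HDE.
(* The second term takes care of the finitely many levels below [N]. *)
apply: (@hausdorff_dim_ge _ _ _ (Num.min C (expR (- (u * (N%:R * b)))))) => //.
  by rewrite lt_min C0 expR_gt0.
move=> n; rewrite ge_min; have [/ZC ->//|nN] := leqP N n; apply/orP; right.
apply: le_trans (Zsum_decay_hi c n (ltW u0)); rewrite subr0 Zsum0.
have b0 := lexp_hi_gt0 c.
apply: (@le_trans _ _ (expR (- (u * (n%:R * b))))).
  by rewrite ler_expR lerN2 ler_pM2l// ler_pM2r// ler_nat ltnW.
by rewrite ler_peMr ?expR_ge0// exprn_ege1// ler1n.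
Qed.

Lemma coding_PD_ge u C : 0 < C ->
  (forall N, exists2 n, (N <= n)%N & C <= Zsum c u n) -> u <= coding_PD.
Proof. by move=> C0 ZC; rewrite -lee_fin -coding_PDE; exact: packing_dim_ge ZC. Qed.

Lemma coding_PD_le u C N : (forall n, (N <= n)%N -> Zsum c u n <= C) ->
  0 <= u -> coding_PD <= u.
Proof.
move=> ZC u0; rewrite -lee_fin -coding_PDE.
apply: (@packing_dim_le _ _ _ (Num.max C (2 ^+ N))) => //.
move=> n; rewrite le_max; have [/ZC ->//|nN] := leqP N n; apply/orP; right.
apply: le_trans (Zsum_mono c n u0) _; rewrite Zsum0.
by rewrite ler_weXn2l ?ler1n// ltnW.
Qed.

(** This and the next three lemmas are the converses of the preceding bounds, by contraposition and
    with the constant 1. *)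
Lemma coding_HD_lt u : coding_HD < u -> forall N, exists2 n, (N <= n)%N & Zsum c u n <= 1.
Proof.
move=> su N; apply: contrapT => no.
have u0 : 0 < u by apply: le_lt_trans su; rewrite -lee_fin -coding_HDE hausdorff_dim_ge0.
suff : u <= coding_HD by rewrite leNgt su.
apply: (@coding_HD_ge u 1 N) => // n Nn.
 rewrite leNgt; apply/negP => Z1; apply: no; exists n => //; exact: ltW.
Qed.

Lemma coding_HD_gt u : 0 <= u -> u < coding_HD ->
  exists N, forall n, (N <= n)%N -> 1 <= Zsum c u n.
Proof.
move=> u0 us; apply: contrapT => no.
have : coding_HD <= u.
  apply: (coding_HD_le (C := 1)) => // N; apply: contrapT => noN; apply: no; exists N => n Nn.
  by rewrite leNgt; apply/negP => Z1; apply: noN; exists n => //; exact: ltW.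
by rewrite leNgt us.
Qed.

Lemma coding_PD_lt u : coding_PD < u ->
  exists N, forall n, (N <= n)%N -> Zsum c u n <= 1.
Proof.
move=> us; apply: contrapT => no.
have : u <= coding_PD.
  apply: (coding_PD_ge (C := 1)) => // N; apply: contrapT => noN; apply: no; exists N => n Nn.
  by rewrite leNgt; apply/negP => Z1; apply: noN; exists n => //; exact: ltW.
by rewrite leNgt us.
Qed.

Lemma coding_PD_gt u : u < coding_PD -> forall N, exists2 n, (N <= n)%N & 1 <= Zsum c u n.
Proof.
(* A negative [u] occurs when a small dimension is lowered to choose the levels; then already Z_n(0)
   >= 1 suffices. *)
move=> su N; have [u0|u0] := ltP u 0.
  exists N => //; apply: le_trans (Zsum_mono c N (ltW u0)).
  by rewrite Zsum0 exprn_ege1// ler1n.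
apply: contrapT => no.
suff : coding_PD <= u by rewrite leNgt su.
apply: (@coding_PD_le u 1 N) => // n Nn.
 rewrite leNgt; apply/negP => Z1; apply: no; exists n => //; exact: ltW.
Qed.

Lemma coding_HD_gt0 : 0 < coding_HD.
Proof.
apply: (lt_le_trans dim_lo_gt0).
by apply: (@coding_HD_ge _ 1 0) dim_lo_gt0 => // n _; exact: Zsum_dim_lo.
Qed.

Lemma coding_PD_gt0 : 0 < coding_PD.
Proof.
apply: (lt_le_trans dim_lo_gt0).
by apply: (@coding_PD_ge _ 1) => // N; exists N => //; exact: Zsum_dim_lo.
Qed.

End thresholds.

(** * Density of the sparse blocks at the chosen levels *)

Section sparse_blocks.
Variables (R : realType) (nn : nat -> nat).
Hypothesis nnS : forall j, (j.+2 * nn j < nn j.+1)%N.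

Let nn_lt j : (nn j < nn j.+1)%N. Proof. exact: sparse_homo nnS _ _ (ltnSn j). Qed.

Let nn_mono : {homo nn : i j / (i <= j)%N}.
Proof. exact: ltnW_homo (sparse_homo nnS). Qed.

Definition block (k : nat) : R :=
  (`[< exists j, (nn j.*2 <= k)%N /\ (k < nn j.*2.+1)%N >])%:R.

Definition block_count (n : nat) : R := \sum_(0 <= k < n) block k.

Lemma block_ge0 k : 0 <= block k. Proof. exact: ler0n. Qed.

Lemma block_le1 k : block k <= 1.
Proof. by rewrite /block; case: asbool; rewrite ?ler01. Qed.

Lemma block_count_ge0 n : 0 <= block_count n.
Proof. by apply: sumr_ge0 => k _; exact: block_ge0. Qed.

Lemma block_count_le n : block_count n <= n%:R.
Proof.
rewrite /block_count big_mkord -[n in n%:R]card_ord -sumr_const.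
by apply: ler_sum => k _; exact: block_le1.
Qed.

(** The last block alone suffices: it starts at [nn j.*2], below half of the level. *)
Lemma block_count_full j : (nn j.*2.+1)%:R / 2 <= block_count (nn j.*2.+1).
Proof.
rewrite /block_count (big_cat_nat (leq0n _) (ltnW (nn_lt j.*2)))/=.
have -> : \sum_(nn j.*2 <= k < nn j.*2.+1) block k = (nn j.*2.+1)%:R - (nn j.*2)%:R.
  transitivity (\sum_(nn j.*2 <= k < nn j.*2.+1) (1 : R)).
    by apply: eq_big_nat => k /andP[h1 h2]; rewrite /block asboolT//; exists j.
  by rewrite sumr_const_nat natrB// ltnW.
have := block_count_ge0 (nn j.*2); rewrite /block_count.
have : (2 * (nn j.*2)%:R <= (nn j.*2.+1)%:R :> R).
  rewrite -natrM ler_nat; apply: leq_trans (ltnW (nnS j.*2)).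
  by rewrite leq_mul2r orbT.
lra.
Qed.

(** All block indices below this level lie below [nn j.*2.+1], which is smaller by a factor 2 j +
    3. *)
Lemma block_count_empty j : j%:R * block_count (nn j.*2.+2) <= (nn j.*2.+2)%:R.
Proof.
rewrite /block_count (big_cat_nat (leq0n _) (ltnW (nn_lt j.*2.+1)))/=.
rewrite [X in _ + X]big_nat_cond [X in _ + X]big1 ?addr0//.
  apply: (@le_trans _ _ (j%:R * (nn j.*2.+1)%:R)).
    by rewrite ler_wpM2l//; exact: block_count_le.
  rewrite -natrM ler_nat; apply: leq_trans (ltnW (nnS j.*2.+1)).
  by rewrite leq_mul2r; apply/orP; right; lia.
move=> k /andP[/andP[h1 h2] _]; rewrite /block asboolF// => -[i [ik ki]].
have [ij|ji] := leqP i j.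
  have : (nn i.*2.+1 <= nn j.*2.+1)%N by apply: nn_mono; rewrite ltnS leq_double.
  by rewrite leqNgt (leq_ltn_trans h1 ki).
have : (nn j.*2.+2 <= nn i.*2)%N by apply: nn_mono; rewrite -doubleS leq_double.
by rewrite leqNgt (leq_ltn_trans ik h2).
Qed.

End sparse_blocks.

(** * Effect of added expansion on the two dimensions *)

Section perturbation.
Context {R : realType} {T : metricType R}.
Implicit Types (c d : coding T) (u k K B : R) (N : nat -> R).

(** Passing from [c] to [d] adds expansion. The order matters: a weakening of [c] to [d] is
    expressed as [expands d c]. *)
Definition expands c d k K B N := forall n x,
  lexp c n x + k * N n - B <= lexp d n x <= lexp c n x + K * N n + B.

Lemma expands_Zsum_le c d k K B N u n : expands c d k K B N -> 0 <= u ->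
  Zsum d u n <= expR (u * B - u * k * N n) * Zsum c u n.
Proof.
move=> cd u0; rewrite /Zsum mulr_sumr; apply: ler_sum => w _; rewrite -expRD ler_expR.
have /andP[h _] := cd n (nth true w); have := ler_wpM2l u0 h; lra.
Qed.

Lemma expands_Zsum_ge c d k K B N u n : expands c d k K B N -> 0 <= u ->
  Zsum c u n <= expR (u * B + u * K * N n) * Zsum d u n.
Proof.
move=> cd u0; rewrite /Zsum mulr_sumr; apply: ler_sum => w _; rewrite -expRD ler_expR.
have /andP[_ h] := cd n (nth true w); have := ler_wpM2l u0 h; lra.
Qed.

Lemma small_inv (e : R) : 0 < e -> exists j0, forall j, (j0 <= j)%N -> j.+1%:R^-1 <= e.
Proof.
move=> e0; exists (Num.Def.truncn e^-1).+1 => j jj.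
rewrite invf_ple ?posrE// ?ltr0Sn//; apply: le_trans (ltW (truncnS_gt _)) _.
by rewrite ler_nat (leq_trans jj).
Qed.

Lemma nat_mul_ge (x y : R) : 0 < y -> exists j0, forall j, (j0 <= j)%N -> x <= j%:R * y.
Proof.
move=> y0; exists (Num.Def.truncn (Num.max 0 (x / y))).+1 => j jj.
rewrite -ler_pdivrMr//; apply: (@le_trans _ _ (Num.max 0 (x / y))).
  by rewrite le_max lexx orbT.
by apply: le_trans (ltW (truncnS_gt _)) _; rewrite ler_nat.
Qed.

Section HD.
Variables (c : coding T) (nn : nat -> nat).
Hypothesis nnS : forall j, (j.+2 * nn j < nn j.+1)%N.

Local Notation N := (block_count R nn).
Local Notation a := (lexp_lo c).
Local Notation b := (lexp_hi c).

Hypothesis nnP : forall j, Zsum c (coding_HD c + j.+1%:R^-1) (nn j) <= 1.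

(* Seen at the levels [nn j] with [j] odd, at least half filled by blocks. *)
Lemma HD_drop d k K B : expands c d k K B N -> 0 < k -> k <= b ->
  coding_HD d <= coding_HD c - coding_HD c * k / (8 * b).
Proof.
move=> cd k0 kb; set s := coding_HD c; have s0 : 0 < s by exact: coding_HD_gt0.
have b0 : 0 < b by exact: lexp_hi_gt0.
(* At a half-full level the gain is at least (s / 2) k (n / 2), and lowering the exponent from s + e
   to s - th costs at most 2 th b n; this [th] balances them. [k <= b] keeps s - th above s / 2. *)
set th := s * k / (8 * b); have th0 : 0 < th by rewrite divr_gt0 ?mulr_gt0.
have thb : th * b = s * k / 8 by rewrite /th; field; exact: lt0r_neq0.
have th_s : th <= s / 2.
  rewrite -(ler_pM2r b0) thb; have := ler_wpM2l (ltW s0) kb; have := mulr_gt0 s0 b0; lra.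
have [j0 j0P] := small_inv th0.
apply: (coding_HD_le (C := expR ((s - th) * B))) => [|M]; first lra.
pose j := maxn j0 M; pose n := nn j.*2.+1.
have jj : (j <= j.*2.+1)%N by lia.
exists n.
  by apply: leq_trans (leq_maxr j0 M) _; apply: leq_trans jj _; exact: homo_ltn_ge (sparse_homo nnS) _.
have e_th : (j.*2.+2%:R)^-1 <= th by apply: j0P; apply: leq_trans (leq_maxl j0 M) jj.
set e := (j.*2.+2%:R)^-1 in e_th.
have u0 : 0 <= s - th by lra.
apply: le_trans (expands_Zsum_le n cd u0) _.
have le_u : s - th <= s + e.
  have : 0 <= e by rewrite invr_ge0.
  lra.
have := Zsum_decay_hi c n le_u; rewrite -ler_pdivlMl ?expR_gt0// -expRN opprK => h.
have {}h : Zsum c (s - th) n <= expR ((s + e - (s - th)) * (n%:R * b)).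
  apply: le_trans h _; rewrite ler_piMr ?expR_ge0//; exact: (nnP j.*2.+1).
apply: le_trans (ler_wpM2l (expR_ge0 _) h) _; rewrite -expRD ler_expR.
have Nn := block_count_full R nnS j; rewrite -/n in Nn.
have h1 : s / 2 * k * (n%:R / 2) <= (s - th) * k * N n.
  apply: ler_pM => //; first by rewrite mulr_ge0 ?ltW ?divr_gt0.
  by rewrite ler_pM2r//; lra.
have h2 : (e + th) * b * n%:R <= s * k / 4 * n%:R.
  rewrite ler_wpM2r//; have : e * b <= th * b by rewrite ler_pM2r.
  lra.
lra.
Qed.

(* Seen at the levels [nn j] with [j] even, where the proportion of block indices
   tends to 0. *)
Lemma HD_stable d k K B : expands d c k K B N -> 0 <= k -> 0 <= K -> coding_HD d = coding_HD c.
Proof.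
move=> dc k0 K0; set s := coding_HD c; have s0 : 0 < s by exact: coding_HD_gt0.
have a0 : 0 < a by exact: lexp_lo_gt0.
apply/eqP; rewrite eq_le; apply/andP; split; last first.
  rewrite leNgt; apply/negP => ds; pose u := (coding_HD d + s) / 2.
  have d0 := coding_HD_gt0 d.
  have u0 : 0 < u by rewrite /u; lra.
  have us : u < s by rewrite /u; lra.
  have [M MP] := coding_HD_gt (ltW u0) us.
  have : u <= coding_HD d.
    apply: (@coding_HD_ge _ _ d u (expR (- (u * B))) M) => // [|n Mn]; first exact: expR_gt0.
    have := expands_Zsum_le n dc (ltW u0) => /(le_trans (MP n Mn)) h.
    rewrite -[leLHS]mulr1 expRN ler_pdivrMl ?expR_gt0//; apply: le_trans h _.
    rewrite ler_wpM2r ?(ltW (Zsum_gt0 _ _ _))// ler_expR gerBl.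
    by apply: mulr_ge0; [apply: mulr_ge0 => //; exact: ltW|exact: block_count_ge0].
  by rewrite /u; lra.
apply/ler_addgt0Pr => e e0; pose u := s + e.
have u0 : 0 <= u by rewrite /u; lra.
have e2 : 0 < e / 2 by rewrite divr_gt0.
have [j0 j0P] := small_inv e2.
(* For j >= j1 the change u K N_n, with N_n <= n / j, is at most the decay (e / 2) n a won by
   raising the exponent. *)
have [j1 j1P] := nat_mul_ge (u * K) (mulr_gt0 e2 a0).
apply: (coding_HD_le (C := expR (u * B))) => // M.
pose j := maxn (maxn j0 j1) M; pose n := nn j.*2.+2.
have [jj0 jj1 jM] : [/\ (j0 <= j)%N, (j1 <= j)%N & (M <= j)%N].
  by rewrite /j; split; rewrite !leq_max leqnn ?orbT.
exists n; first by apply: leq_trans (homo_ltn_ge (sparse_homo nnS) _); apply: leq_trans jM _; lia.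
apply: le_trans (expands_Zsum_ge n dc u0) _.
have ej : (j.*2.+3%:R)^-1 <= e / 2 by apply: j0P; lia.
set ee := (j.*2.+3%:R)^-1 in ej.
have ub : s + ee <= u by rewrite /u; lra.
have h := Zsum_decay c n ub.
have {}h : Zsum c u n <= expR (- ((u - (s + ee)) * (n%:R * a))).
  by apply: le_trans h _; rewrite ler_piMr ?expR_ge0//; exact: (nnP j.*2.+2).
apply: le_trans (ler_wpM2l (expR_ge0 _) h) _; rewrite -expRD ler_expR.
have na0 : 0 <= n%:R * a by rewrite mulr_ge0// ltW.
have Nn := block_count_empty R nnS j; rewrite -/n in Nn.
have h1 : u * K * N n <= j%:R * (e / 2 * a) * N n.
  by rewrite ler_wpM2r ?block_count_ge0// j1P.
have h2 : e / 2 * a * (j%:R * N n) <= e / 2 * a * n%:R.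
  by rewrite ler_wpM2l// mulr_ge0// ltW.
have h3 : e / 2 * (n%:R * a) <= (u - (s + ee)) * (n%:R * a).
  by rewrite ler_wpM2r// /u; lra.
lra.
Qed.

End HD.

Section PD.
Variables (c : coding T) (nn : nat -> nat).
Hypothesis nnS : forall j, (j.+2 * nn j < nn j.+1)%N.

Local Notation N := (block_count R nn).
Local Notation a := (lexp_lo c).
Local Notation b := (lexp_hi c).

Hypothesis nnP : forall j, 1 <= Zsum c (coding_PD c - j.+1%:R^-1) (nn j).

(** Mirror image of [HD_drop]: here [d] is the less expanding system, and at the half-full levels
    its sums exceed those of [c] enough to raise the limsup. *)
Lemma PD_rise d k K B : expands d c k K B N -> 0 < k ->
  coding_PD c + coding_PD c * k / (8 * b) <= coding_PD d.
Proof.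
move=> dc k0; set s := coding_PD c; have s0 : 0 < s by exact: coding_PD_gt0.
have b0 : 0 < b by exact: lexp_hi_gt0.
set th := s * k / (8 * b); have th0 : 0 < th by rewrite divr_gt0 ?mulr_gt0.
have thb : th * b = s * k / 8 by rewrite /th; field; exact: lt0r_neq0.
have [j0 j0P] := small_inv th0.
apply: (coding_PD_ge (C := expR (- ((s + th) * B)))) => [|M]; first exact: expR_gt0.
pose j := maxn j0 M; pose n := nn j.*2.+1.
have jj : (j <= j.*2.+1)%N by lia.
exists n.
  by apply: leq_trans (leq_maxr j0 M) _; apply: leq_trans jj _; exact: homo_ltn_ge (sparse_homo nnS) _.
have e_th : (j.*2.+2%:R)^-1 <= th by apply: j0P; apply: leq_trans (leq_maxl j0 M) jj.
set e := (j.*2.+2%:R)^-1 in e_th.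
have u0 : 0 <= s + th by lra.
have low := expands_Zsum_le n dc u0.
have le_u : s - e <= s + th.
  have : 0 <= e by rewrite invr_ge0.
  lra.
have h := Zsum_decay_hi c n le_u.
have {}h : expR (- ((s + th - (s - e)) * (n%:R * b))) <= Zsum c (s + th) n.
  by apply: le_trans h; rewrite ler_peMr ?expR_ge0//; exact: (nnP j.*2.+1).
have {}low := le_trans h low.
rewrite -ler_pdivrMl ?expR_gt0// -expRN -expRD in low; apply: le_trans low.
rewrite ler_expR.
have Nn := block_count_full R nnS j; rewrite -/n in Nn.
have h1 : s * k * (n%:R / 2) <= (s + th) * k * N n.
  apply: ler_pM => //; first by rewrite mulr_ge0 ?ltW.
  by rewrite ler_pM2r//; lra.
have h2 : (e + th) * b * n%:R <= s * k / 4 * n%:R.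
  rewrite ler_wpM2r//; have : e * b <= th * b by rewrite ler_pM2r.
  lra.
have h3 : 0 <= s * k * n%:R by rewrite !mulr_ge0// ltW.
lra.
Qed.

(** More expansion cannot raise the dimension, and the almost empty levels, where the sums hardly
    change, keep the limsup from dropping. *)
Lemma PD_stable d k K B : expands c d k K B N -> 0 <= k -> 0 <= K -> coding_PD d = coding_PD c.
Proof.
move=> cd k0 K0; set s := coding_PD c; have s0 : 0 < s by exact: coding_PD_gt0.
have a0 : 0 < a by exact: lexp_lo_gt0.
apply/eqP; rewrite eq_le; apply/andP; split.
  apply/ler_addgt0Pr => e e0; pose u := s + e.
  have u0 : 0 <= u by rewrite /u; lra.
  have su : s < u by rewrite /u; lra.
  have [M MP] := coding_PD_lt su.
  apply: (@coding_PD_le _ _ d u (expR (u * B)) M) => // n Mn.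
  apply: le_trans (expands_Zsum_le n cd u0) _.
  rewrite -[leRHS]mulr1; apply: ler_pM; rewrite ?expR_ge0 ?(ltW (Zsum_gt0 _ _ _)) ?MP//.
  rewrite ler_expR gerBl.
  by apply: mulr_ge0; [apply: mulr_ge0|exact: block_count_ge0].
rewrite leNgt; apply/negP => ds.
have d0 := coding_PD_gt0 d.
pose u := (coding_PD d + s) / 2; pose e := s - u.
have u0 : 0 <= u by rewrite /u; lra.
have us : u < s by rewrite /u; lra.
have e2 : 0 < e / 2 by rewrite /e; lra.
have [j0 j0P] := small_inv e2.
have [j1 j1P] := nat_mul_ge (u * K) (mulr_gt0 e2 a0).
suff : u <= coding_PD d by rewrite /u; lra.
apply: (coding_PD_ge (C := expR (- (u * B)))) => [|M]; first exact: expR_gt0.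
pose j := maxn (maxn j0 j1) M; pose n := nn j.*2.+2.
have [jj0 jj1 jM] : [/\ (j0 <= j)%N, (j1 <= j)%N & (M <= j)%N].
  by rewrite /j; split; rewrite !leq_max leqnn ?orbT.
exists n; first by apply: leq_trans (homo_ltn_ge (sparse_homo nnS) _); apply: leq_trans jM _; lia.
have low := expands_Zsum_ge n cd u0.
have ej : (j.*2.+3%:R)^-1 <= e / 2 by apply: j0P; lia.
set ee := (j.*2.+3%:R)^-1 in ej.
have ub : u <= s - ee by move: ej; rewrite /e; lra.
have h := Zsum_decay c n ub; rewrite -ler_pdivrMl ?expR_gt0// -expRN opprK in h.
have {}h : expR ((s - ee - u) * (n%:R * a)) <= Zsum c u n.
  by apply: le_trans h; rewrite ler_peMr ?expR_ge0//; exact: (nnP j.*2.+2).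
have {}low := le_trans h low.
rewrite -ler_pdivrMl ?expR_gt0// -expRN -expRD in low; apply: le_trans low.
rewrite ler_expR.
have na0 : 0 <= n%:R * a by rewrite mulr_ge0// ltW.
have Nn := block_count_empty R nnS j; rewrite -/n in Nn.
have h1 : u * K * N n <= j%:R * (e / 2 * a) * N n.
  by rewrite ler_wpM2r ?block_count_ge0// j1P.
have h2 : e / 2 * a * (j%:R * N n) <= e / 2 * a * n%:R.
  by rewrite ler_wpM2l// mulr_ge0// ltW.
have h3 : e / 2 * (n%:R * a) <= (s - ee - u) * (n%:R * a).
  by rewrite ler_wpM2r//; move: ej; rewrite /e; lra.
lra.
Qed.

End PD.

End perturbation.

(** * Non-differentiability *)

Section perturbed_orbits.
Context {R : realType}.
Local Notation C := (Rcomplex R).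
Implicit Types (z w tau : C) (l m : nat -> C).

Lemma scaleRC (a : R) z : a *: z = Complex a 0 * z :> C.
Proof.
case: z => u v; rewrite /GRing.scale/= /GRing.mul/=.
by congr Complex; rewrite ?mul0r ?subr0 ?addr0.
Qed.

Lemma cabsZ (a : R) z : cabs (a *: z) = `|a| * cabs z.
Proof. exact: Rcomplex_normrZ. Qed.

Lemma cabs_real (a : R) : cabs (Complex a 0 : C) = `|a|.
Proof. by rewrite -[Complex a 0]mulr1 -scaleRC cabsZ cabs1 mulr1. Qed.

(** Changing tau to (1 + a) tau moves the image z1 by a (z1 - 1), of modulus at most 21/10 a; the
    rest is the expansion by 35. *)
Lemma fquad_perturb (a : R) tau b z w : 0 <= a -> 40 <= cabs ((1 + a) *: tau : C) ->
  cabs (fquad tau z) <= 11 / 10 ->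
  cabs (z - sgc b) <= 21 / 200 -> cabs (w - sgc b) <= 21 / 200 ->
  35 * cabs (w - z) <= cabs (fquad ((1 + a) *: tau) w - fquad tau z) + 21 / 10 * a.
Proof.
move=> a0 t40 f1 zb wb; set w1 := fquad _ w; set z1 := fquad tau z in f1 *.
have E : (1 + a) *: tau / 2 * ((w - z) * (w + z)) = (w1 - z1) - Complex a 0 * (z1 - 1).
  by rewrite /w1 /z1 /fquad scalerDl scale1r scaleRC; ring.
have := cabsB (w1 - z1) (Complex a 0 * (z1 - 1)).
rewrite -E !cabsM cabsV cabs_nat cabs_real ger0_norm// => h.
have z11 : cabs (z1 - 1) <= 21 / 10 by have := cabsB z1 1; rewrite cabs1; lra.
have wz := norm_addl_sgc wb zb.
have h1 : a * cabs (z1 - 1) <= a * (21 / 10) by rewrite ler_wpM2l.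
have h2 : 35 * cabs (w - z) <= cabs ((1 + a) *: tau) / 2 * (cabs (w - z) * cabs (w + z)).
  have : 40 * (7 / 4) <= cabs ((1 + a) *: tau) * cabs (w + z) by apply: ler_pM => //; lra.
  move=> /(ler_wpM2l (cabs_ge0 (w - z))); lra.
lra.
Qed.

Section fixed_perturbation.
Variables (l m : nat -> C) (s : R) (h : nat -> R) (x : nat -> bool) (z w : C).
Hypotheses (l40 : forall k, 40 <= cabs (l k)) (m40 : forall k, 40 <= cabs (m k)).
Hypotheses (s0 : 0 <= s) (s1 : s <= 1) (h0 : forall k, 0 <= h k) (h1 : forall k, h k <= 1).
Hypothesis lm : forall k, m k = (1 + s * h k) *: l k.
Hypotheses (zx : coded l x z) (wx : coded m x w).

Let N n := \sum_(0 <= k < n) h k.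
Let delta k := cabs (orb m w k - orb l z k).

(** Summation of 35 delta_k <= delta_(k+1) + 21/10 s h_k: the shifted sum is absorbed on the left.
    The displacement is thus controlled by the number of perturbed indices, whatever their
    position. *)
Let sum_delta n : 34 * \sum_(0 <= k < n) delta k <= delta n + 21 / 10 * s * N n.
Proof.
rewrite /N; elim: n => [|n IH].
  by rewrite !big_geq// !mulr0 addr0 cabs_ge0.
rewrite !big_nat_recr//=; have sh : 0 <= s * h n by rewrite mulr_ge0.
have := @fquad_perturb (s * h n) (l n) (x n) (orb l z n) (orb m w n) sh.
rewrite -lm => /(_ (m40 n) (zx n.+1).1 (zx n).2 (wx n).2).
move: IH; rewrite /delta /=; lra.
Qed.

Let sum_delta_le n : \sum_(0 <= k < n) delta k <= 1 / 10 + s * N n / 10.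
Proof.
have := sum_delta n; have := cabsB (orb m w n) (orb l z n).
have := (zx n).1; have := (wx n).1.
have : 0 <= s * N n by rewrite mulr_ge0// /N sumr_ge0.
rewrite -/(delta n); lra.
Qed.

Let ln_ratio k : `|ln (cabs (m k) * cabs (orb m w k)) - ln (cabs (l k) * cabs (orb l z k))
  - ln (1 + s * h k)| <= 10 / 9 * delta k.
Proof.
have sh : 0 <= s * h k by rewrite mulr_ge0.
have z9 := coded_ge k l40 zx; have w9 := coded_ge k m40 wx.
have z0 : 0 < cabs (orb l z k) by apply: lt_le_trans z9.
have w0 : 0 < cabs (orb m w k) by apply: lt_le_trans w9.
have l0 : 0 < cabs (l k) by apply: lt_le_trans (l40 k).
have sh1 : 0 < 1 + s * h k by lra.
rewrite lm cabsZ (gtr0_norm sh1) -[(1 + _) * _ * _]mulrA lnM ?posrE ?mulr_gt0// !lnM ?posrE//.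
have := ln_sub_le w0 z0; have := ln_sub_le z0 w0.
have hz : forall p q : R, 9 / 10 <= q -> p <= delta k -> p / q <= 10 / 9 * delta k.
  move=> p q q9 pd; rewrite ler_pdivrMr; last lra.
  have : 0 <= delta k by exact: cabs_ge0. 
  nra.
have d1 : cabs (orb m w k) - cabs (orb l z k) <= delta k by exact: cabs_subr_ge.
have d2 : cabs (orb l z k) - cabs (orb m w k) <= delta k.
  by rewrite /delta cabsBC; exact: cabs_subr_ge.
have := hz _ _ z9 d1; have := hz _ _ w9 d2; rewrite ler_norml; lra.
Qed.

(** The multipliers contribute between s N / 2 and s N, the displacement of the orbit at most s N /
    8 + 1/4, so the gain survives. *)
Lemma orb_lexp_perturb n :
  orb_lexp l z n + s / 4 * N n - 1 <= orb_lexp m w n <= orb_lexp l z n + 2 * s * N n + 1.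
Proof.
have sN : 0 <= s * N n by rewrite mulr_ge0// /N sumr_ge0.
have D : `|orb_lexp m w n - orb_lexp l z n - \sum_(0 <= k < n) ln (1 + s * h k)|
    <= 1 / 4 + s * N n / 8.
  rewrite /orb_lexp -!sumrB; apply: le_trans (ler_norm_sum _ _ _) _.
  apply: (@le_trans _ _ (\sum_(0 <= k < n) 10 / 9 * delta k)).
    by apply: ler_sum => k _; exact: ln_ratio.
  rewrite -mulr_sumr; have := sum_delta_le n; lra.
have lo : s / 2 * N n <= \sum_(0 <= k < n) ln (1 + s * h k).
  rewrite /N mulr_sumr; apply: ler_sum => k _.
  have sh : 0 <= s * h k by rewrite mulr_ge0.
  have sh1 : s * h k <= 1 by rewrite mulr_ile1.
  have p1 : 0 < 1 + s * h k by lra.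
  have := ln_sub_le ltr01 p1; rewrite ln1.
  have : (1 - (1 + s * h k)) / (1 + s * h k) <= - (s * h k / 2).
    rewrite ler_pdivrMr//; nra.
  lra.
have hi : \sum_(0 <= k < n) ln (1 + s * h k) <= s * N n.
  rewrite /N mulr_sumr; apply: ler_sum => k _.
  have sh : 0 <= s * h k by rewrite mulr_ge0.
  have p1 : 0 < 1 + s * h k by lra.
  by have := ln_sub_le p1 ltr01; rewrite ln1 divr1; lra.
move: D; rewrite ler_norml => /andP[D1 D2]; apply/andP; split; lra.
Qed.

End fixed_perturbation.

Lemma quad_coding_expands l m (M s : R) (h : nat -> R)
    (l40 : forall k, 40 <= cabs (l k)) (lM : forall k, cabs (l k) <= M)
    (m40 : forall k, 40 <= cabs (m k)) (mM : forall k, cabs (m k) <= M) :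
  0 <= s -> s <= 1 -> (forall k, 0 <= h k) -> (forall k, h k <= 1) ->
  (forall k, m k = (1 + s * h k) *: l k) ->
  expands (quad_coding l40 lM) (quad_coding m40 mM) (s / 4) (2 * s) 1
    (fun n => \sum_(0 <= k < n) h k).
Proof.
move=> s0 s1 h0 h1 lm n x.
exact: (orb_lexp_perturb l40 m40 s0 s1 h0 h1 lm (code_pointP x l40) (code_pointP x m40)).
Qed.

End perturbed_orbits.

(** A derivative along [v] would be within k / 2 both of 0 and of a quotient that is at most - k. *)
Lemma not_differentiable_kink (R : realType) (V : normedModType R) (F : V -> R)
    (eta v : V) (t0 k : R) : 0 < t0 -> 0 < k ->
  (forall t, 0 < t < t0 -> F (t *: v + eta) <= F eta - k * t) ->
  (forall t, - t0 < t < 0 -> F (t *: v + eta) = F eta) ->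
  ~ differentiable F eta.
Proof.
move=> t00 k0 Fpos Fneg dF.
have : derivable F eta v by exact: diff_derivable.
move=> /cvg_ex[L] /cvgrPdist_lt/(_ (k / 2)); rewrite divr_gt0// => /(_ isT).
move=> /nbhs_ballP[d /= d0 dP].
pose t := Num.min d t0 / 2.
have m0 : 0 < Num.min d t0 by rewrite lt_min d0.
have t_gt0 : 0 < t by rewrite divr_gt0.
have [td tt0] : t < d /\ t < t0.
  have : t < Num.min d t0 by rewrite gtr_pMr// invf_lt1// ltr1n.
  by rewrite lt_min => /andP[].
have near r : r != 0 -> `|r| < d -> `|L - r^-1 * (F (r *: v + eta) - F eta)| < k / 2.
  move=> r0 rd; apply: (dP r) => //.
  by rewrite /ball/= sub0r normrN.
have := near t; rewrite gt_eqF// gtr0_norm// => /(_ isT td) hp.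
have := near (- t); rewrite oppr_eq0 gt_eqF// normrN gtr0_norm// => /(_ isT td).
rewrite Fneg ?subrr ?mulr0 ?subr0; last by apply/andP; split; lra.
move=> hn; have Fp : F (t *: v + eta) - F eta <= - (k * t).
  have := Fpos t; rewrite t_gt0 tt0 => /(_ isT); lra.
have q : t^-1 * (F (t *: v + eta) - F eta) <= - k.
  by rewrite ler_pdivrMl// mulrN mulrC.
move: hp hn; rewrite !ltr_norml => /andP[h1 h2] /andP[h3 h4]; lra.
Qed.

(** * The kinks of the two dimensions *)

Section main.
Context {R : realType}.
Implicit Types (eta l : linf R).

Lemma Lambda_nbhs eta : Lambda eta -> exists2 r : R, 0 < r &
  forall l, `|eta - l| < r -> forall k, 40 <= cabs (l k).
Proof.
move=> /nbhs_ballP[r /= r0 rP]; exists r => // l el k.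
by apply: ltW; apply: rP; rewrite -ball_normE.
Qed.

Lemma Lambda_ge eta k : Lambda eta -> 40 <= cabs (eta k).
Proof. by move=> /Lambda_nbhs[r r0 /(_ eta)]; rewrite subrr normr0 => /(_ r0 k). Qed.

Lemma linf_bounded eta : exists2 M : R, 0 < M & forall k, cabs (eta k) <= M.
Proof.
exists (1 + linf_norm eta).
  have := le_trans (normr_ge0 (eta 0%N)) (linf_norm_ub eta 0%N); lra.
by move=> k; apply: le_trans (linf_norm_ub eta k) _; lra.
Qed.

Lemma scaled_seq_bounded eta (h : nat -> R) : (forall k, 0 <= h k <= 1) ->
  (fun k => h k *: eta k) \in @bounded_seq R.
Proof.
move=> h01; have [M M0 eM] := linf_bounded eta; apply/asboolP; exists M => k.
apply: le_trans (eM k); rewrite [leLHS]cabsZ ger0_norm; last by case/andP: (h01 k).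
by rewrite ler_piMl ?cabs_ge0//; case/andP: (h01 k).
Qed.

Lemma julia_HDE (l : linf R) (M : R) (l40 : forall k, 40 <= cabs (l k))
  (lM : forall k, cabs (l k) <= M) : julia_HD l = coding_HD (quad_coding l40 lM).
Proof. by rewrite /julia_HD (julia_setE l40 lM). Qed.

Lemma julia_PDE (l : linf R) (M : R) (l40 : forall k, 40 <= cabs (l k))
  (lM : forall k, cabs (l k) <= M) : julia_PD l = coding_PD (quad_coding l40 lM).
Proof. by rewrite /julia_PD (julia_setE l40 lM). Qed.

Lemma Lambda_coding eta : Lambda eta -> exists c : coding (sphere R),
  [/\ julia_HD eta = coding_HD c, julia_PD eta = coding_PD c, 1 / 2 <= lexp_hi c &
  forall h : nat -> R, (forall k, h k = 0 \/ h k = 1) ->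
  exists v : linf R, exists2 t0 : R, 0 < t0 <= 1 &
  forall t, `|t| < t0 -> exists2 d : coding (sphere R),
    julia_HD (t *: v + eta) = coding_HD d /\ julia_PD (t *: v + eta) = coding_PD d &
    (0 < t -> expands c d (t / 4) (2 * t) 1 (fun n => \sum_(0 <= k < n) h k)) /\
    (t < 0 -> exists2 s, - t <= s <= 1 &
      expands d c (s / 4) (2 * s) 1 (fun n => \sum_(0 <= k < n) h k))].
Proof.
move=> Leta; have e40 k := Lambda_ge k Leta.
have [r r0 rP] := Lambda_nbhs Leta.
have [M M0 eM] := linf_bounded eta.
(* The bound is doubled so that it serves [eta] and its perturbations alike. *)
have eM2 k : cabs (eta k) <= 2 * M by have := eM k; lra.
exists (quad_coding e40 eM2); split; [exact: julia_HDE|exact: julia_PDE| |].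
  have M40 : 0 < 2 * (2 * M) by lra.
  have := ln_sub_le ltr01 M40; rewrite ln1 sub0r /= => h.
  have : (1 - 2 * (2 * M)) / (2 * (2 * M)) <= - (1 / 2).
    by have := le_trans (e40 0%N) (eM 0%N); rewrite ler_pdivrMr//; lra.
  lra.
move=> h h01.
have h0 k : 0 <= h k by case: (h01 k) => ->.
have h1 k : h k <= 1 by case: (h01 k) => ->; rewrite ?ler01.
have hb k : 0 <= h k <= 1 by rewrite h0 h1.
pose v : linf R := Linf (scaled_seq_bounded eta hb).
have v0 : 0 < 1 + `|v| by rewrite ltr_pwDl.
(* 1/2 gives s <= 1 for negative [t]; the second bound keeps [t *: v + eta] in the ball around [eta]
   where all moduli are at least 40. *)
exists v, (Num.min (1 / 2) (r / (1 + `|v|))).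
  have r1 : 0 < r / (1 + `|v|) by rewrite divr_gt0.
  by rewrite lt_min r1 ge_min andbT; apply/andP; split; [|apply/orP; left]; lra.
move=> t; rewrite lt_min => /andP[t2]; rewrite ltr_pdivlMr// => tr.
have mE k : (t *: v + eta) k = (1 + t * h k) *: eta k.
  by rewrite scalerDl scale1r -scalerA addrC.
have th k : - (1 / 2) <= t * h k <= 1 / 2.
  by move: t2; rewrite ltr_norml => /andP[? ?]; case: (h01 k) => ->; lra.
have m40 k : 40 <= cabs ((t *: v + eta) k).
  apply: rP; rewrite opprD addrCA subrr addr0 normrN normrZ.
  by apply: le_lt_trans tr; rewrite ler_wpM2l// lerDr.
have mM k : cabs ((t *: v + eta) k) <= 2 * M.
  rewrite mE cabsZ ger0_norm; last by have := th k; lra.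
  by have := th k; have := eM k; have := cabs_ge0 (eta k); nra.
exists (quad_coding m40 mM); first by split; [exact: julia_HDE|exact: julia_PDE].
have t1 : `|t| <= 1 by lra.
split=> t0.
  by apply: quad_coding_expands => //; [exact: ltW|move: t1; rewrite gtr0_norm].
move: t2; rewrite ltr0_norm// => t2; have t10 : 0 < 1 + t by lra.
have tn : t != 0 by rewrite lt_eqF.
(* Chosen so that (1 + s) (1 + t) = 1: on the blocks, [eta] is the perturbed sequence multiplied by
   1 + s. *)
exists (- t / (1 + t)).
  by apply/andP; split; [rewrite ler_pdivlMr//; nra|rewrite ler_pdivrMr//; lra].
apply: quad_coding_expands => //.
- by rewrite divr_ge0//; lra.
- by rewrite ler_pdivrMr//; lra.
move=> k; rewrite mE scalerA; case: (h01 k) => ->; first by rewrite !mulr0 addr0 mulr1 scale1r.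
rewrite !mulr1 (_ : _ * _ = 1) ?scale1r//; field; exact: lt0r_neq0.
Qed.

Lemma block01 (nn : nat -> nat) k : block R nn k = 0 \/ block R nn k = 1.
Proof. by rewrite /block; case: asbool; [right|left]. Qed.

Lemma julia_HD_not_differentiable eta : Lambda eta -> ~ differentiable (@julia_HD R) eta.
Proof.
move=> /Lambda_coding[c [HDc _ b2 dir]].
have [|nn [nnS nnP]] := @sparse_sequence (fun j n => Zsum c (coding_HD c + j.+1%:R^-1) n <= 1).
  by move=> j N; apply: coding_HD_lt; rewrite ltrDl invr_gt0 ltr0n.
have [v [t0 /andP[t00 t01] vP]] := dir _ (block01 nn).
have b0 := lexp_hi_gt0 c; have s0 := coding_HD_gt0 c.
(* 32 is 8 times 4: [HD_drop] is applied with k = t / 4. *)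
apply: (@not_differentiable_kink _ _ _ eta v t0 (coding_HD c / (32 * lexp_hi c))) => //.
- by rewrite divr_gt0// mulr_gt0.
- move=> t /andP[t_gt0 tt0]; have [|d [-> _] [/(_ t_gt0) cd _]] := vP t.
    by rewrite gtr0_norm.
  rewrite HDc; have := HD_drop nnS nnP cd; have -> : 0 < t / 4 by rewrite divr_gt0.
  move=> /(_ isT) h; apply: le_trans (h _) _; first lra.
  by rewrite lerD2l lerN2 le_eqVlt; apply/orP/or_introl/eqP; field; exact: lt0r_neq0.
- move=> t /andP[tt0 t_lt0]; have [|d [-> _] [_ /(_ t_lt0) [s /andP[ts s1] dc]]] := vP t.
    by rewrite ltr0_norm//; lra.
  by rewrite HDc; apply: (HD_stable nnS nnP dc); lra.
Qed.

Lemma julia_PD_not_differentiable eta : Lambda eta -> ~ differentiable (@julia_PD R) eta.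
Proof.
move=> /Lambda_coding[c [_ PDc b2 dir]] diff.
have [|nn [nnS nnP]] := @sparse_sequence (fun j n => 1 <= Zsum c (coding_PD c - j.+1%:R^-1) n).
  by move=> j N; apply: coding_PD_gt; rewrite ltrBlDr ltrDl invr_gt0 ltr0n.
have [v [t0 /andP[t00 t01] vP]] := dir _ (block01 nn).
have b0 := lexp_hi_gt0 c; have s0 := coding_PD_gt0 c.
(* PD rises for negative multiples of [v] and is constant for positive ones; changing both signs
   brings it to the form of the kink lemma. *)
apply: (@not_differentiable_kink _ _ (- (@julia_PD R)) eta (- v) t0
  (coding_PD c / (32 * lexp_hi c))) (differentiableN diff) => //.
- by rewrite divr_gt0// mulr_gt0.
- move=> t /andP[t_gt0 tt0]; rewrite scalerN -scaleNr.
  have t_lt0 : - t < 0 by rewrite oppr_lt0.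
  have [|d [_ E] [_ /(_ t_lt0) [s /andP[ts s1] dc]]] := vP (- t).
    by rewrite normrN gtr0_norm.
  rewrite [leLHS]/(- julia_PD _) [X in X - _]/(- julia_PD _) E PDc -opprD lerN2.
  rewrite opprK in ts.
  have h := PD_rise nnS nnP dc; apply: le_trans (h _); last by lra.
  rewrite lerD2l.
  have -> : coding_PD c / (32 * lexp_hi c) * t = coding_PD c * (t / 4) / (8 * lexp_hi c).
    by field; exact: lt0r_neq0.
  by rewrite ler_pM2r ?invr_gt0 ?mulr_gt0// ler_pM2l//; lra.
- move=> t /andP[tt0 t_lt0]; rewrite scalerN -scaleNr.
  have t_gt0 : 0 < - t by rewrite oppr_gt0.
  have [|d [_ E] [/(_ t_gt0) cd _]] := vP (- t).
    by rewrite normrN ltr0_norm//; lra.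
  rewrite [LHS]/(- julia_PD _) [RHS]/(- julia_PD _) E PDc; congr (- _).
  by apply: (PD_stable nnS nnP cd); lra.
Qed.

End main.

Theorem theorem1p4 (R : realType) :
  (forall l : linf R, Lambda l -> uniformly_hyperbolic quad l) /\
  (forall eta : linf R, Lambda eta -> ~ differentiable (@julia_HD R) eta) /\
  (forall eta : linf R, Lambda eta -> ~ differentiable (@julia_PD R) eta).
Proof.
split; [|split] => [l Ll|eta|eta].
- have [M _ lM] := linf_bounded l.
  exact: quad_uniformly_hyperbolic (fun k => Lambda_ge k Ll) lM.
- exact: julia_HD_not_differentiable.
- exact: julia_PD_not_differentiable.
Qed.
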